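(* For $\tau\in\mathbb{H}^2$ let $q=e^{2\pi i\tau}$ and $$W=\theta^5\begin{bmatrix}1\\ \frac15\end{bmatrix}(0,\tau)\Big/\theta^5\begin{bmatrix}1\\ \frac35\end{bmatrix}(0,\tau).$$ Then $W$ satisfies the Riccati equation $$q\frac{dW}{dq}=\frac{1}{(\sqrt5)^3}\,\frac{(q;q)_\infty^5}{(q^5;q^5)_\infty}\left(W^2-11W-1\right).$$
   Context: $\mathbb{H}^2$ is the upper half-plane. For $\epsilon,\epsilon'\in\mathbb{R}$, $\theta\begin{bmatrix}\epsilon\\ \epsilon'\end{bmatrix}(\zeta,\tau)=\sum_{n\in\mathbb{Z}}\exp\!\Big(2\pi i\Big[\tfrac12\big(n+\tfrac{\epsilon}{2}\big)^2\tau+\big(n+\tfrac{\epsilon}{2}\big)\big(\zeta+\tfrac{\epsilon'}{2}\big)\Big]\Big)$; $\theta^k$ is the $k$-th power. $(q^k;q^k)_\infty=\prod_{n\ge1}(1-q^{kn})$. The derivative $q\,d/dq$ is understood as $\frac{1}{2\pi i}\frac{d}{d\tau}$. *)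

(* Defs.v *)
From Stdlib Require Import Reals Lra ZArith ClassicalEpsilon.
Open Scope R_scope.

Record Cx := mkC { Re : R; Im : R }.

Definition RtoC (x : R) : Cx := mkC x 0.
Definition Czero : Cx := RtoC 0.
Definition Cone : Cx := RtoC 1.
Definition Ci : Cx := mkC 0 1.
Definition Cadd (z w : Cx) : Cx := mkC (Re z + Re w) (Im z + Im w).
Definition Copp (z : Cx) : Cx := mkC (- Re z) (- Im z).
Definition Csub (z w : Cx) : Cx := Cadd z (Copp w).
Definition Cmul (z w : Cx) : Cx :=
  mkC (Re z * Re w - Im z * Im w) (Re z * Im w + Im z * Re w).
Definition Cinv (z : Cx) : Cx :=
  mkC (Re z / (Re z ^ 2 + Im z ^ 2)) (- Im z / (Re z ^ 2 + Im z ^ 2)).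
Definition Cdiv (z w : Cx) : Cx := Cmul z (Cinv w).
Definition Cnorm (z : Cx) : R := sqrt (Re z ^ 2 + Im z ^ 2).
Fixpoint Cpow (z : Cx) (n : nat) : Cx :=
  match n with O => Cone | S m => Cmul z (Cpow z m) end.
Definition Cexp (z : Cx) : Cx := mkC (exp (Re z) * cos (Im z)) (exp (Re z) * sin (Im z)).

Definition twopii : Cx := mkC 0 (2 * PI).

Definition Ccv (u : nat -> Cx) (l : Cx) : Prop :=
  forall eps, 0 < eps -> exists N : nat, forall n, (n >= N)%nat -> Cnorm (Csub (u n) l) < eps.

(* the limit of a sequence (an arbitrary value if it does not converge) *)
Definition Clim (u : nat -> Cx) : Cx := epsilon (inhabits Czero) (fun l => Ccv u l).

Definition C_derivable_lim (f : Cx -> Cx) (z l : Cx) : Prop :=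
  forall eps, 0 < eps -> exists delta, 0 < delta /\
    forall h, h <> Czero -> Cnorm h < delta ->
      Cnorm (Csub (Cdiv (Csub (f (Cadd z h)) (f z)) h) l) < eps.

Fixpoint Csum (f : nat -> Cx) (n : nat) : Cx :=
  match n with O => Czero | S m => Cadd (Csum f m) (f m) end.
Fixpoint Cprod (f : nat -> Cx) (n : nat) : Cx :=
  match n with O => Cone | S m => Cmul (Cprod f m) (f m) end.

Definition theta_term (eps eps' : R) (zeta tau : Cx) (n : Z) : Cx :=
  let a := IZR n + eps / 2 in
  Cexp (Cmul twopii
          (Cadd (Cmul (RtoC (a ^ 2 / 2)) tau)
                (Cmul (RtoC a) (Cadd zeta (RtoC (eps' / 2)))))).

Definition theta_partial (eps eps' : R) (zeta tau : Cx) (N : nat) : Cx :=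
  Csum (fun k => theta_term eps eps' zeta tau (Z.of_nat k - Z.of_nat N)%Z) (2 * N + 1).

Definition theta (eps eps' : R) (zeta tau : Cx) : Cx :=
  Clim (theta_partial eps eps' zeta tau).

Definition qnome (tau : Cx) : Cx := Cexp (Cmul twopii tau).

Definition qpoch_inf (k : nat) (tau : Cx) : Cx :=
  Clim (fun N => Cprod (fun n => Csub Cone (Cpow (qnome tau) (k * S n))) N).

Definition W (tau : Cx) : Cx :=
  Cdiv (Cpow (theta 1 (1/5) Czero tau) 5) (Cpow (theta 1 (3/5) Czero tau) 5).

(* Main.v *)
Require Import Defs.
From Stdlib Require Import Reals Lra Lia ZArith List Classical ClassicalEpsilon Permutation.
Import ListNotations.
Open Scope R_scope.

(** Put [q = e^s], [s = 2 pi i tau], [eta_k = (q^k; q^k)_oo]. Splitting the two theta series modulo 5 gives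
    [X = al a + be b] and [Y = be a - al b] for the numerator and denominator thetas, where
    [al = 2 cos (pi/10)], [be = 2 cos (3 pi/10)] and [a], [b] are the theta series over the classes
    1 and 3 modulo 10 (Rogers-Ramanujan theta functions of [q^5]).
    - By the heat equation, [a b' - a' b] is a double series over pairs [(u, v)] weighted by [v^2 - u^2];
      multiplication by [2 + i] on the Gaussian lattice turns it into the square of Jacobi's
      series for [eta_5^3].  Hence [X' Y - X Y'] is a multiple of [eta_5^6].
    - The triple product gives [X Y = sqrt 5 q^(1/4) eta_1 eta_5], which amounts to
      [a^2 - a b - b^2 = q^(1/4) eta_1 eta_5], and also [a b = q^(5/4) eta_5 eta_25].
    - Replacing [q] by [zeta^k q] for the fifth roots of unity and multiplying the five resulting
      factorizations yields [(a^10 - 11 a^5 b^5 - b^10) eta_25 = q^(5/4) eta_5^11].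
    - [X^10 - 11 X^5 Y^5 - Y^10] is [125 (al be)^5 a b (a^10 - 11 a^5 b^5 - b^10) / (a^2 - a b - b^2)],
      an identity of binary forms over Q(sqrt 5).
    Combining the four gives the Riccati equation. *)

(* No modular forms or holomorphic function theory enter: identities come from rearranging
   absolutely convergent series or from limits of exact finite products. Series over [Z] and [Z * Z]
   must be cut into residue classes and reindexed by bijections, hence the unordered sums. All
   functions are taken in [s] rather than in [q]: the powers q^(1/8), q^(1/4), q^(5/4) become
   single-valued, and the rotation of [q] by a fifth root of unity becomes a translation of [s]. The
   number 2 + i appears because its norm is 5: it matches exponents u^2 + v^2 of products of two
   theta series modulo 10 with exponents 5 (k^2 + l^2) of a product of two Jacobi series in q^5. The
   last binary form identity has a geometric source. Up to signs, a b (a^10 - 11 a^5 b^5 - b^10) is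
   Klein's icosahedral form of degree 12, and (a, b) -> (X, Y) is a symmetry of the icosahedron up
   to scaling. Its determinant is -5, so the form is multiplied by 5^6; as X Y is sqrt 5 times a^2 -
   a b - b^2, division by X Y gives the identity. The auxiliary eta_25 cancels because it divides a
   b and the degree 10 form in opposite directions. *)
Declare Scope Cx_scope.
Delimit Scope Cx_scope with Cx.
Local Notation "x + y" := (Cadd x y) : Cx_scope.
Local Notation "x - y" := (Csub x y) : Cx_scope.
Local Notation "x * y" := (Cmul x y) : Cx_scope.
Local Notation "x / y" := (Cdiv x y) : Cx_scope.
Local Notation "x ^ n" := (Cpow x n) : Cx_scope.
Local Notation "- x" := (Copp x) : Cx_scope.
Local Coercion RtoC : R >-> Cx.
Local Arguments Cnorm z%_Cx.
Local Arguments Re c%_Cx.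
Local Arguments Im c%_Cx.
Local Arguments RtoC x%_R.

(** * The field of complex numbers *)

Lemma Cx_eq (z w : Cx) : Re z = Re w -> Im z = Im w -> z = w.
Proof. destruct z, w; simpl; intros -> ->; reflexivity. Qed.

Ltac cx := intros; apply Cx_eq; simpl; ring.

Lemma Cx_normsq_neq0 (z : Cx) : z <> Czero -> Re z ^ 2 + Im z ^ 2 <> 0.
Proof.
intros Hz H; apply Hz; apply Cx_eq; simpl; nra.
Qed.

Lemma Cx_field_theory :
  field_theory Czero Cone Cadd Cmul Csub Copp Cdiv Cinv (@eq Cx).
Proof.
constructor; [constructor| | |]; try (cx; fail); try reflexivity.
- intros H; injection H; lra.
- intros p Hp; pose proof (Cx_normsq_neq0 p Hp); apply Cx_eq; simpl; field; simpl in *; lra.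
Qed.

(** Integer numerals, which the coercion reads as [RtoC (IZR n)], become coefficients with which
    [ring] and [field] can compute; the forms of degree 10 with coefficients 11 and 125 depend on
    this. *)
Lemma Cx_IZR_morph :
  ring_morph Czero Cone Cadd Cmul Csub Copp (@eq Cx)
    0%Z 1%Z Z.add Z.mul Z.sub Z.opp Z.eqb (fun n : Z => RtoC (IZR n)).
Proof.
constructor; try reflexivity; intros; try (apply Cx_eq; simpl;
  rewrite ?plus_IZR, ?minus_IZR, ?mult_IZR, ?opp_IZR; ring).
apply Z.eqb_eq in H; subst; reflexivity.
Qed.

Lemma Cx_power_theory : power_theory Cone Cmul (@eq Cx) N.to_nat Cpow.
Proof.
constructor; intros r n; destruct n as [|p]; [reflexivity|simpl].
induction p using Pos.peano_ind; [cx|].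
rewrite Pos2Nat.inj_succ; simpl; rewrite IHp.
symmetry; apply (Ring_theory.pow_pos_succ (Eqsth Cx)).
- intros x y E x' y' E'; subst; reflexivity.
- cx.
Qed.

Ltac Cx_IZR_cst t :=
  match t with
  | RtoC (IZR ?z) => match isZcst z with true => constr:(z) | _ => constr:(NotConstant) end
  | Czero => constr:(0%Z)
  | Cone => constr:(1%Z)
  | _ => constr:(NotConstant)
  end.

Ltac Cx_pow_cst t := match isnatcst t with true => constr:(N.of_nat t) | _ => constr:(NotConstant) end.

Add Field Cx_field : Cx_field_theory
  (morphism Cx_IZR_morph, constants [Cx_IZR_cst],
   power_tac Cx_power_theory [Cx_pow_cst]).


Local Open Scope Cx_scope.

(** * Norm, powers and the exponential *)

Lemma Cone_neq_Czero : Cone <> Czero.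
Proof. intros H; injection H; lra. Qed.

Lemma Cnorm_Czero : Cnorm Czero = 0%R.
Proof.
unfold Cnorm; simpl; replace (_ + _)%R with 0%R by ring; apply sqrt_0.
Qed.

Lemma Cnorm_pos (z : Cx) : (0 <= Cnorm z)%R.
Proof. apply sqrt_pos. Qed.

Lemma Cnorm_sq (z : Cx) : (Cnorm z * Cnorm z = Re z ^ 2 + Im z ^ 2)%R.
Proof. apply sqrt_sqrt; nra. Qed.

Lemma Cnorm_RtoC (x : R) : Cnorm x = Rabs x.
Proof.
unfold Cnorm; simpl.
replace (x * (x * 1) + 0 * (0 * 1))%R with (Rsqr x) by (unfold Rsqr; ring).
apply sqrt_Rsqr_abs.
Qed.

Lemma Cnorm_Cone : Cnorm Cone = 1%R.
Proof. change Cone with (RtoC 1); rewrite Cnorm_RtoC; apply Rabs_R1. Qed.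

Lemma Cmul_comm (z w : Cx) : z * w = w * z.
Proof. ring. Qed.

Lemma Cnorm_mul (z w : Cx) : Cnorm (z * w) = (Cnorm z * Cnorm w)%R.
Proof.
unfold Cnorm; rewrite <- sqrt_mult by nra; f_equal; simpl; ring.
Qed.

Lemma Cnorm_opp (z : Cx) : Cnorm (- z) = Cnorm z.
Proof. unfold Cnorm; f_equal; simpl; ring. Qed.

Lemma Cnorm_sub_sym (z w : Cx) : Cnorm (z - w) = Cnorm (w - z).
Proof. rewrite <- Cnorm_opp; f_equal; ring. Qed.

Lemma Cnorm_Re (z : Cx) : (Rabs (Re z) <= Cnorm z)%R.
Proof.
rewrite <- sqrt_Rsqr_abs; unfold Rsqr; apply sqrt_le_1_alt; nra.
Qed.

Lemma Cnorm_Im (z : Cx) : (Rabs (Im z) <= Cnorm z)%R.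
Proof.
rewrite <- sqrt_Rsqr_abs; unfold Rsqr; apply sqrt_le_1_alt; nra.
Qed.

Lemma Cnorm_le_Re_Im (z : Cx) : (Cnorm z <= Rabs (Re z) + Rabs (Im z))%R.
Proof.
pose proof (Rabs_pos (Re z)); pose proof (Rabs_pos (Im z)).
apply Rsqr_incr_0_var; [|lra]; unfold Rsqr; rewrite Cnorm_sq.
rewrite <- (pow2_abs (Re z)), <- (pow2_abs (Im z)); nra.
Qed.

Lemma Cnorm_triangle (z w : Cx) : (Cnorm (z + w) <= Cnorm z + Cnorm w)%R.
Proof.
pose proof (Cnorm_pos z) as Hz; pose proof (Cnorm_pos w) as Hw.
apply Rsqr_incr_0_var; [|lra]; unfold Rsqr; rewrite Cnorm_sq; simpl.
pose proof (Cnorm_sq z) as Ez; pose proof (Cnorm_sq w) as Ew.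
assert (Re z * Re w + Im z * Im w <= Cnorm z * Cnorm w)%R.
{ apply Rsqr_incr_0_var; [|nra]; unfold Rsqr.
  replace (Cnorm z * Cnorm w * (Cnorm z * Cnorm w))%R
    with (Cnorm z * Cnorm z * (Cnorm w * Cnorm w))%R by ring.
  rewrite Ez, Ew; pose proof (pow2_ge_0 (Re z * Im w - Im z * Re w)%R); nra. }
nra.
Qed.

Lemma Cnorm_triangle_sub (z w : Cx) : (Cnorm (z - w) <= Cnorm z + Cnorm w)%R.
Proof. rewrite <- (Cnorm_opp w); apply Cnorm_triangle. Qed.

Lemma Cnorm_triangle_inv (z w : Cx) : (Cnorm z - Cnorm w <= Cnorm (z - w))%R.
Proof.
pose proof (Cnorm_triangle (z - w) w) as H.
replace (z - w + w) with z in H by ring; lra.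
Qed.

Lemma Cnorm_eq0 (z : Cx) : Cnorm z = 0%R -> z = Czero.
Proof.
intros H; pose proof (Cnorm_sq z) as E; rewrite H in E; apply Cx_eq; simpl; nra.
Qed.

Lemma Cnorm_gt0 (z : Cx) : z <> Czero -> (0 < Cnorm z)%R.
Proof.
intros H; destruct (Cnorm_pos z); [assumption|].
exfalso; apply H, Cnorm_eq0; auto.
Qed.

Lemma Cx_eq_of_close (z w : Cx) :
  (forall eps, 0 < eps -> Cnorm (z - w) < eps)%R -> z = w.
Proof.
intros H; destruct (classic (z - w = Czero)) as [E|E].
- replace z with (z - w + w) by ring; rewrite E; ring.
- specialize (H _ (Cnorm_gt0 _ E)); lra.
Qed.

Lemma Cnorm_inv (z : Cx) : z <> Czero -> Cnorm (Cinv z) = (/ Cnorm z)%R.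
Proof.
intros H; pose proof (Cnorm_gt0 z H) as Hp.
apply (Rmult_eq_reg_r (Cnorm z)); [|lra].
rewrite <- Cnorm_mul, Rinv_l by lra.
replace (Cinv z * z) with (RtoC 1) by (field; assumption).
rewrite Cnorm_RtoC; apply Rabs_R1.
Qed.

Lemma Cmul_neq0 (z w : Cx) : z <> Czero -> w <> Czero -> z * w <> Czero.
Proof.
intros Hz Hw E; apply Hw.
replace w with (z * w / z) by (field; assumption); rewrite E; field; assumption.
Qed.

Lemma Cmul_neq0_inv (z w : Cx) : z * w <> Czero -> z <> Czero /\ w <> Czero.
Proof. intros H; split; intros E; apply H; rewrite E; ring. Qed.

Lemma Cmul_reg_l (z x y : Cx) : z <> Czero -> z * x = z * y -> x = y.
Proof.
intros H E; replace x with (z * x / z) by (field; assumption).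
rewrite E; field; assumption.
Qed.

Lemma Cpow_neq0 (z : Cx) (n : nat) : z <> Czero -> z ^ n <> Czero.
Proof.
intros H; induction n; simpl; [apply Cone_neq_Czero|apply Cmul_neq0; auto].
Qed.

Lemma Cpow_add (z : Cx) (m n : nat) : z ^ (m + n) = z ^ m * z ^ n.
Proof. induction m; simpl; [ring|rewrite IHm; ring]. Qed.

Lemma Cpow_mul_base (z w : Cx) (n : nat) : (z * w) ^ n = z ^ n * w ^ n.
Proof. induction n; simpl; [ring|rewrite IHn; ring]. Qed.

Lemma Cpow_mul (z : Cx) (m n : nat) : z ^ (m * n) = (z ^ m) ^ n.
Proof.
rewrite Nat.mul_comm; induction n; simpl; [reflexivity|].
rewrite Cpow_add, IHn; reflexivity.
Qed.

Lemma Cnorm_pow (z : Cx) (n : nat) : Cnorm (z ^ n) = (Cnorm z ^ n)%R.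
Proof.
induction n; simpl; [|rewrite Cnorm_mul, IHn; ring].
change Cone with (RtoC 1); rewrite Cnorm_RtoC; apply Rabs_R1.
Qed.

Lemma Cexp_add (z w : Cx) : Cexp (z + w) = Cexp z * Cexp w.
Proof.
apply Cx_eq; simpl; rewrite exp_plus, ?cos_plus, ?sin_plus; ring.
Qed.

Lemma Cexp_0 : Cexp Czero = Cone.
Proof. apply Cx_eq; simpl; rewrite exp_0, ?cos_0, ?sin_0; simpl; ring. Qed.

Lemma Cnorm_exp (z : Cx) : Cnorm (Cexp z) = exp (Re z).
Proof.
unfold Cnorm; simpl.
replace (_ + _)%R with (Rsqr (exp (Re z)) * (Rsqr (sin (Im z)) + Rsqr (cos (Im z))))%R
  by (unfold Rsqr; ring).
rewrite sin2_cos2, Rmult_1_r; apply sqrt_Rsqr; left; apply exp_pos.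
Qed.

Lemma Cexp_neq0 (z : Cx) : Cexp z <> Czero.
Proof.
intros H; pose proof (Cnorm_exp z) as E; rewrite H, Cnorm_Czero in E.
pose proof (exp_pos (Re z)); lra.
Qed.

Lemma Cexp_opp (z : Cx) : Cexp (- z) = Cinv (Cexp z).
Proof.
apply (Cmul_reg_l (Cexp z)); [apply Cexp_neq0|].
rewrite <- Cexp_add; replace (z + - z) with Czero by ring; rewrite Cexp_0.
field; apply Cexp_neq0.
Qed.

Lemma Cexp_INR_mul (n : nat) (z : Cx) : Cexp (RtoC (INR n) * z) = Cexp z ^ n.
Proof.
induction n.
- simpl; rewrite <- Cexp_0; f_equal; cx.
- rewrite S_INR.
  replace (RtoC (INR n + 1) * z) with (z + RtoC (INR n) * z) by cx.
  rewrite Cexp_add, IHn; reflexivity.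
Qed.

Lemma Cexp_2PI_nat (n : nat) : Cexp (RtoC (INR n) * twopii) = Cone.
Proof.
rewrite Cexp_INR_mul.
replace (Cexp twopii) with Cone.
- induction n; simpl; [reflexivity|rewrite IHn; ring].
- apply Cx_eq; simpl; rewrite exp_0, ?cos_2PI, ?sin_2PI; simpl; ring.
Qed.

Lemma Cexp_2PI_Z (n : Z) : Cexp (RtoC (IZR n) * twopii) = Cone.
Proof.
destruct (Z_le_gt_dec 0 n) as [H|H].
- rewrite <- (Z2Nat.id n) by lia; rewrite <- INR_IZR_INZ; apply Cexp_2PI_nat.
- replace (RtoC (IZR n) * twopii) with (- (RtoC (INR (Z.to_nat (- n))) * twopii)).
  + rewrite Cexp_opp, Cexp_2PI_nat; field; apply Cone_neq_Czero.
  + rewrite INR_IZR_INZ, Z2Nat.id, opp_IZR by lia; cx.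
Qed.

(** * Limits of complex sequences *)

Lemma Ccv_const (c : Cx) : Ccv (fun _ => c) c.
Proof.
intros e He; exists 0%nat; intros; replace (c - c) with Czero by ring.
rewrite Cnorm_Czero; assumption.
Qed.

Lemma Ccv_ext (u v : nat -> Cx) (l : Cx) :
  (forall n, u n = v n) -> Ccv u l -> Ccv v l.
Proof.
intros H Hu e He; destruct (Hu e He) as [N HN]; exists N; intros.
rewrite <- H; auto.
Qed.

Lemma Ccv_unique (u : nat -> Cx) (l m : Cx) : Ccv u l -> Ccv u m -> l = m.
Proof.
intros Hl Hm; apply Cx_eq_of_close; intros e He.
destruct (Hl (e / 2)%R) as [N HN]; [lra|]; destruct (Hm (e / 2)%R) as [M HM]; [lra|].
specialize (HN (N + M)%nat ltac:(lia)); specialize (HM (N + M)%nat ltac:(lia)).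
replace (l - m) with ((u (N + M)%nat - m) - (u (N + M)%nat - l)) by ring.
eapply Rle_lt_trans; [apply Cnorm_triangle_sub|lra].
Qed.

Lemma Clim_eq (u : nat -> Cx) (l : Cx) : Ccv u l -> Clim u = l.
Proof.
intros H; apply (Ccv_unique u); [|assumption].
unfold Clim; apply epsilon_spec; exists l; assumption.
Qed.

Lemma Ccv_add (u v : nat -> Cx) (l m : Cx) :
  Ccv u l -> Ccv v m -> Ccv (fun n => u n + v n) (l + m).
Proof.
intros Hl Hm e He.
destruct (Hl (e / 2)%R) as [N HN]; [lra|]; destruct (Hm (e / 2)%R) as [M HM]; [lra|].
exists (N + M)%nat; intros n Hn.
specialize (HN n ltac:(lia)); specialize (HM n ltac:(lia)).
replace (u n + v n - (l + m)) with ((u n - l) + (v n - m)) by ring.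
eapply Rle_lt_trans; [apply Cnorm_triangle|lra].
Qed.

Lemma Ccv_bounded (u : nat -> Cx) (l : Cx) :
  Ccv u l -> exists N, forall n, (n >= N)%nat -> (Cnorm (u n) <= Cnorm l + 1)%R.
Proof.
intros H; destruct (H 1%R) as [N HN]; [lra|]; exists N; intros n Hn.
pose proof (Cnorm_triangle_inv (u n) l); specialize (HN n Hn); lra.
Qed.

Lemma Ccv_mul (u v : nat -> Cx) (l m : Cx) :
  Ccv u l -> Ccv v m -> Ccv (fun n => u n * v n) (l * m).
Proof.
intros Hl Hm e He.
destruct (Ccv_bounded u l Hl) as [K HK].
pose proof (Cnorm_pos l) as Pl; pose proof (Cnorm_pos m) as Pm.
assert (H1 : (0 < e / 2 / (Cnorm l + 1))%R) by (repeat apply Rdiv_lt_0_compat; lra).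
assert (H2 : (0 < e / 2 / (Cnorm m + 1))%R) by (repeat apply Rdiv_lt_0_compat; lra).
destruct (Hl _ H2) as [N HN]; destruct (Hm _ H1) as [M HM].
exists (K + N + M)%nat; intros n Hn.
specialize (HN n ltac:(lia)); specialize (HM n ltac:(lia)); specialize (HK n ltac:(lia)).
replace (u n * v n - l * m) with (u n * (v n - m) + (u n - l) * m) by ring.
eapply Rle_lt_trans; [apply Cnorm_triangle|rewrite !Cnorm_mul].
pose proof (Cnorm_pos (u n - l)); pose proof (Cnorm_pos (v n - m)); pose proof (Cnorm_pos (u n)).
assert (Cnorm (u n) * Cnorm (v n - m) < e / 2)%R.
{ apply Rle_lt_trans with ((Cnorm l + 1) * Cnorm (v n - m))%R; [nra|].
  replace (e / 2)%R with ((Cnorm l + 1) * (e / 2 / (Cnorm l + 1)))%R by (field; lra).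
  apply Rmult_lt_compat_l; lra. }
assert (Cnorm (u n - l) * Cnorm m <= e / 2)%R.
{ apply Rle_trans with (Cnorm (u n - l) * (Cnorm m + 1))%R; [nra|].
  replace (e / 2)%R with ((e / 2 / (Cnorm m + 1)) * (Cnorm m + 1))%R by (field; lra).
  apply Rmult_le_compat_r; lra. }
lra.
Qed.

Lemma Ccv_scal (c : Cx) (u : nat -> Cx) (l : Cx) :
  Ccv u l -> Ccv (fun n => c * u n) (c * l).
Proof. apply Ccv_mul, Ccv_const. Qed.

Lemma Ccv_opp (u : nat -> Cx) (l : Cx) : Ccv u l -> Ccv (fun n => - u n) (- l).
Proof.
intros H; replace (- l) with (- Cone * l) by ring.
apply Ccv_ext with (fun n => - Cone * u n); [intros; ring|apply Ccv_scal, H].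
Qed.

Lemma Ccv_sub (u v : nat -> Cx) (l m : Cx) :
  Ccv u l -> Ccv v m -> Ccv (fun n => u n - v n) (l - m).
Proof. intros Hu Hv; apply Ccv_add, Ccv_opp; assumption. Qed.

Lemma Ccv_pow (k : nat) (u : nat -> Cx) (l : Cx) :
  Ccv u l -> Ccv (fun n => u n ^ k) (l ^ k).
Proof.
intros H; induction k; simpl; [apply Ccv_const|apply Ccv_mul; assumption].
Qed.

Lemma Ccv_neq0 (u : nat -> Cx) (l : Cx) :
  l <> Czero -> Ccv u l ->
  exists N, forall n, (n >= N)%nat -> (Cnorm l / 2 < Cnorm (u n))%R.
Proof.
intros Hl H; pose proof (Cnorm_gt0 l Hl).
destruct (H (Cnorm l / 2)%R) as [N HN]; [lra|].
exists N; intros n Hn; specialize (HN n Hn).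
pose proof (Cnorm_triangle_inv l (u n)) as T; rewrite Cnorm_sub_sym in T; lra.
Qed.

Lemma Ccv_inv (u : nat -> Cx) (l : Cx) :
  l <> Czero -> Ccv u l -> Ccv (fun n => Cinv (u n)) (Cinv l).
Proof.
intros Hl H e He; pose proof (Cnorm_gt0 l Hl) as Pl.
destruct (Ccv_neq0 u l Hl H) as [N HN].
destruct (H (e * (Cnorm l * Cnorm l / 2))%R) as [M HM]; [apply Rmult_lt_0_compat; [assumption|nra]|].
exists (N + M)%nat; intros n Hn.
specialize (HN n ltac:(lia)); specialize (HM n ltac:(lia)).
assert (Hu : u n <> Czero).
{ intros E; rewrite E, Cnorm_Czero in HN; lra. }
replace (Cinv (u n) - Cinv l) with ((l - u n) * (Cinv (u n) * Cinv l)) by (field; auto).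
rewrite !Cnorm_mul, !Cnorm_inv, Cnorm_sub_sym by assumption.
pose proof (Cnorm_gt0 _ Hu) as Pu.
apply (Rmult_lt_reg_r (Cnorm (u n) * Cnorm l)); [nra|].
replace (Cnorm (u n - l) * (/ Cnorm (u n) * / Cnorm l) * (Cnorm (u n) * Cnorm l))%R
  with (Cnorm (u n - l)) by (field; lra).
eapply Rlt_le_trans; [apply HM|]; apply Rmult_le_compat_l; [lra|nra].
Qed.

Lemma Ccv_div (u v : nat -> Cx) (l m : Cx) :
  m <> Czero -> Ccv u l -> Ccv v m -> Ccv (fun n => u n / v n) (l / m).
Proof. intros Hm Hu Hv; apply Ccv_mul, Ccv_inv; assumption. Qed.

Lemma Ccv_subseq (u : nat -> Cx) (l : Cx) (f : nat -> nat) :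
  (forall n, (n <= f n)%nat) -> Ccv u l -> Ccv (fun n => u (f n)) l.
Proof.
intros Hf H e He; destruct (H e He) as [N HN]; exists N; intros n Hn.
apply HN; specialize (Hf n); lia.
Qed.

Lemma Ccv_eventually (u v : nat -> Cx) (l : Cx) (N : nat) :
  (forall n, (n >= N)%nat -> u n = v n) -> Ccv u l -> Ccv v l.
Proof.
intros H Hu e He; destruct (Hu e He) as [M HM]; exists (N + M)%nat; intros n Hn.
rewrite <- H by lia; apply HM; lia.
Qed.

Lemma Ccv_geometric (z : Cx) : (Cnorm z < 1)%R -> Ccv (fun n => z ^ n) Czero.
Proof.
intros Hz e He.
destruct (pow_lt_1_zero (Cnorm z)) with (y := e) as [N HN]; [|assumption|].
- rewrite Rabs_pos_eq; [assumption|apply Cnorm_pos].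
- exists N; intros n Hn; replace (z ^ n - Czero) with (z ^ n) by ring.
  rewrite Cnorm_pow; rewrite <- (Rabs_pos_eq (Cnorm z ^ n)); [apply HN; lia|].
  apply pow_le, Cnorm_pos.
Qed.

(* Sequential form of differentiability: the algebra of limits of sequences then replaces separate differentiation rules. *)
Lemma C_derivable_lim_seq (f : Cx -> Cx) (z l : Cx) :
  (forall h : nat -> Cx, (forall n, h n <> Czero) -> Ccv h Czero ->
     Ccv (fun n => (f (z + h n) - f z) / h n) l) ->
  C_derivable_lim f z l.
Proof.
intros H eps He; apply NNPP; intros Hn.
assert (Hc : forall n : nat, exists h, h <> Czero /\ (Cnorm h < / (INR n + 1))%R /\
   ~ (Cnorm ((f (z + h) - f z) / h - l)%Cx < eps)%R).
{ intros n; apply NNPP; intros H1; apply Hn.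
  exists (/ (INR n + 1))%R; split.
  - apply Rinv_0_lt_compat; pose proof (pos_INR n); lra.
  - intros h Hh Hd; apply NNPP; intros H2; apply H1; exists h; auto. }
set (h := fun n => proj1_sig (constructive_indefinite_description _ (Hc n))).
assert (Hh : forall n, h n <> Czero /\ (Cnorm (h n) < / (INR n + 1))%R /\
   ~ (Cnorm ((f (z + h n) - f z) / h n - l)%Cx < eps)%R).
{ intros n; unfold h; destruct (constructive_indefinite_description _ _); assumption. }
destruct (H h) with (eps := eps) as [N HN].
- intros n; apply (Hh n).
- intros e Hpe; destruct (archimed_cor1 e Hpe) as [N [HN HN0]]; exists N; intros n Hn'.
  replace (h n - Czero) with (h n) by ring.
  destruct (Hh n) as [_ [H1 _]].
  eapply Rlt_trans; [apply H1|]; eapply Rle_lt_trans; [|apply HN].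
  apply Rinv_le_contravar; [apply lt_0_INR; lia|].
  apply le_INR in Hn'; lra.
- assumption.
- apply (Hh N); apply HN; lia.
Qed.

(** * Unordered sums *)

Fixpoint lsum {I} (f : I -> Cx) (l : list I) : Cx :=
  match l with nil => Czero | i :: l' => f i + lsum f l' end.

Fixpoint rsum {I} (g : I -> R) (l : list I) : R :=
  match l with nil => 0 | i :: l' => g i + rsum g l' end%R.

(* Unordered convergence: limit of the finite partial sums along the net of finite subsets of [I]. *)
Definition HasSum {I} (f : I -> Cx) (s : Cx) : Prop :=
  forall eps, (0 < eps)%R -> exists F : list I, forall G, NoDup G -> incl F G ->
    (Cnorm (lsum f G - s) < eps)%R.

(** Absolute convergence, phrased without a limit so that it passes directly to majorants and
    products; [Summable_HasSum] recovers a sum. *)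
Definition Summable {I} (f : I -> Cx) : Prop :=
  exists M, forall G, NoDup G -> (rsum (fun i => Cnorm (f i)) G <= M)%R.

Lemma classic_eq_dec {I} (x y : I) : {x = y} + {x <> y}.
Proof. apply excluded_middle_informative. Qed.

Definition dedup {I} : list I -> list I := nodup classic_eq_dec.

Lemma dedup_NoDup {I} (l : list I) : NoDup (dedup l).
Proof. apply NoDup_nodup. Qed.

Lemma incl_dedup {I} (l l' : list I) : incl l' l -> incl l' (dedup l).
Proof. intros H x Hx; apply nodup_In; auto. Qed.

(** Plays the role of set difference, with duplicate-free lists as finite sets: a sum over [G]
    becomes the sum over [F] plus a remainder off [F]. *)
Lemma NoDup_incl_split {I} (F G : list I) : NoDup F -> NoDup G -> incl F G ->
  exists H, Permutation G (F ++ H) /\ NoDup H /\ (forall x, In x H -> ~ In x F).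
Proof.
intros NF; revert G; induction NF as [|x F Hx NF IH]; intros G NG HG.
- exists G; split; [apply Permutation_refl|split; [assumption|auto]].
- destruct (in_split x G) as [l1 [l2 E]]; [apply HG; left; reflexivity|subst G].
  pose proof (NoDup_remove_1 _ _ _ NG) as N1; pose proof (NoDup_remove_2 _ _ _ NG) as N2.
  destruct (IH (l1 ++ l2)) as [H [HP [HN HD]]]; [assumption| |].
  + intros y Hy; assert (y <> x) by (intros ->; contradiction).
    specialize (HG y (or_intror Hy)); apply in_app_iff in HG.
    apply in_app_iff; destruct HG as [|[|]]; [auto|congruence|auto].
  + exists H; split; [|split; [assumption|]].
    * apply Permutation_trans with (x :: l1 ++ l2).
      { apply Permutation_sym, Permutation_middle. }
      simpl; constructor; assumption.
    * intros y Hy [->|Hy2]; [|eapply HD; eassumption].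
      apply N2; eapply Permutation_in; [apply Permutation_sym, HP|].
      apply in_app_iff; auto.
Qed.

Lemma lsum_app {I} (f : I -> Cx) (l l' : list I) : lsum f (l ++ l') = lsum f l + lsum f l'.
Proof. induction l; simpl; [ring|rewrite IHl; ring]. Qed.

Lemma rsum_app {I} (f : I -> R) (l l' : list I) : rsum f (l ++ l') = (rsum f l + rsum f l')%R.
Proof. induction l; simpl; [ring|rewrite IHl; ring]. Qed.

Lemma lsum_perm {I} (f : I -> Cx) (l l' : list I) : Permutation l l' -> lsum f l = lsum f l'.
Proof. induction 1; simpl; [reflexivity|congruence|ring|congruence]. Qed.

Lemma rsum_perm {I} (f : I -> R) (l l' : list I) : Permutation l l' -> rsum f l = rsum f l'.
Proof. induction 1; simpl; [reflexivity|congruence|ring|congruence]. Qed.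

Lemma lsum_ext {I} (f g : I -> Cx) (l : list I) :
  (forall i, f i = g i) -> lsum f l = lsum g l.
Proof. intros H; induction l; simpl; [reflexivity|congruence]. Qed.

Lemma lsum_add {I} (f g : I -> Cx) (l : list I) :
  lsum (fun i => f i + g i) l = lsum f l + lsum g l.
Proof. induction l; simpl; [ring|rewrite IHl; ring]. Qed.

Lemma rsum_add {I} (f g : I -> R) (l : list I) :
  rsum (fun i => f i + g i)%R l = (rsum f l + rsum g l)%R.
Proof. induction l; simpl; [ring|rewrite IHl; ring]. Qed.

Lemma lsum_scal {I} (c : Cx) (f : I -> Cx) (l : list I) :
  lsum (fun i => c * f i) l = c * lsum f l.
Proof. induction l; simpl; [ring|rewrite IHl; ring]. Qed.

Lemma rsum_scal {I} (c : R) (f : I -> R) (l : list I) :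
  rsum (fun i => c * f i)%R l = (c * rsum f l)%R.
Proof. induction l; simpl; [ring|rewrite IHl; ring]. Qed.

Lemma lsum_map {I J} (p : J -> I) (f : I -> Cx) (l : list J) :
  lsum f (map p l) = lsum (fun j => f (p j)) l.
Proof. induction l; simpl; congruence. Qed.

Lemma rsum_map {I J} (p : J -> I) (f : I -> R) (l : list J) :
  rsum f (map p l) = rsum (fun j => f (p j)) l.
Proof. induction l; simpl; congruence. Qed.

Lemma rsum_nonneg {I} (f : I -> R) (l : list I) :
  (forall i, 0 <= f i)%R -> (0 <= rsum f l)%R.
Proof. intros H; induction l as [|a l]; simpl; [lra|specialize (H a); lra]. Qed.

Lemma rsum_le {I} (f g : I -> R) (l : list I) :
  (forall i, f i <= g i)%R -> (rsum f l <= rsum g l)%R.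
Proof. intros H; induction l as [|a l]; simpl; [lra|specialize (H a); lra]. Qed.

Lemma rsum_incl {I} (f : I -> R) (F G : list I) : (forall i, 0 <= f i)%R ->
  NoDup F -> NoDup G -> incl F G -> (rsum f F <= rsum f G)%R.
Proof.
intros Hf NF NG H; destruct (NoDup_incl_split F G NF NG H) as [K [HP _]].
rewrite (rsum_perm _ _ _ HP), rsum_app; pose proof (rsum_nonneg f K Hf); lra.
Qed.

Lemma Cnorm_lsum_le {I} (f : I -> Cx) (l : list I) :
  (Cnorm (lsum f l) <= rsum (fun i => Cnorm (f i)) l)%R.
Proof.
induction l; simpl; [rewrite Cnorm_Czero; lra|].
pose proof (Cnorm_triangle (f a) (lsum f l)); lra.
Qed.

Lemma HasSum_unique {I} (f : I -> Cx) (s t : Cx) : HasSum f s -> HasSum f t -> s = t.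
Proof.
intros Hs Ht; apply Cx_eq_of_close; intros e He.
destruct (Hs (e / 2)%R) as [F HF]; [lra|]; destruct (Ht (e / 2)%R) as [G HG]; [lra|].
specialize (HF (dedup (F ++ G)) (dedup_NoDup _) (incl_dedup _ _ (incl_appl _ (incl_refl F)))).
specialize (HG (dedup (F ++ G)) (dedup_NoDup _) (incl_dedup _ _ (incl_appr _ (incl_refl G)))).
set (x := lsum f (dedup (F ++ G))) in *.
replace (s - t) with ((x - t) - (x - s)) by ring.
eapply Rle_lt_trans; [apply Cnorm_triangle_sub|lra].
Qed.

Lemma HasSum_ext {I} (f g : I -> Cx) (s : Cx) :
  (forall i, f i = g i) -> HasSum f s -> HasSum g s.
Proof.
intros H Hs e He; destruct (Hs e He) as [F HF]; exists F; intros G NG HG.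
rewrite <- (lsum_ext f g) by assumption; auto.
Qed.

Lemma HasSum_add {I} (f g : I -> Cx) (s t : Cx) :
  HasSum f s -> HasSum g t -> HasSum (fun i => f i + g i) (s + t).
Proof.
intros Hs Ht e He.
destruct (Hs (e / 2)%R) as [F HF]; [lra|]; destruct (Ht (e / 2)%R) as [G HG]; [lra|].
exists (F ++ G); intros K NK HK; rewrite lsum_add.
specialize (HF K NK (fun x Hx => HK x (incl_appl _ (incl_refl F) x Hx))).
specialize (HG K NK (fun x Hx => HK x (incl_appr _ (incl_refl G) x Hx))).
replace (lsum f K + lsum g K - (s + t)) with ((lsum f K - s) + (lsum g K - t)) by ring.
eapply Rle_lt_trans; [apply Cnorm_triangle|lra].
Qed.

Lemma HasSum_scal {I} (c : Cx) (f : I -> Cx) (s : Cx) :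
  HasSum f s -> HasSum (fun i => c * f i) (c * s).
Proof.
intros Hs e He; pose proof (Cnorm_pos c) as Pc.
destruct (Hs (e / (Cnorm c + 1))%R) as [F HF]; [apply Rdiv_lt_0_compat; lra|].
exists F; intros G NG HG; specialize (HF G NG HG); rewrite lsum_scal.
replace (c * lsum f G - c * s) with (c * (lsum f G - s)) by ring.
rewrite Cnorm_mul; pose proof (Cnorm_pos (lsum f G - s)).
apply Rle_lt_trans with ((Cnorm c + 1) * Cnorm (lsum f G - s))%R; [nra|].
replace e with ((Cnorm c + 1) * (e / (Cnorm c + 1)))%R by (field; lra).
apply Rmult_lt_compat_l; lra.
Qed.

Lemma HasSum_div {I} (c : Cx) (f : I -> Cx) (s : Cx) :
  HasSum f s -> HasSum (fun i => Cinv c * f i) (s / c).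
Proof. unfold Cdiv; rewrite Cmul_comm; apply HasSum_scal. Qed.

Lemma HasSum_opp {I} (f : I -> Cx) (s : Cx) : HasSum f s -> HasSum (fun i => - f i) (- s).
Proof.
intros H; replace (- s) with (- Cone * s) by ring.
apply HasSum_ext with (fun i => - Cone * f i); [intros; ring|apply HasSum_scal, H].
Qed.

Lemma HasSum_sub {I} (f g : I -> Cx) (s t : Cx) :
  HasSum f s -> HasSum g t -> HasSum (fun i => f i - g i) (s - t).
Proof. intros Hf Hg; apply HasSum_add, HasSum_opp; assumption. Qed.

Lemma HasSum_reindex {I J} (p : J -> I) (p' : I -> J) (f : I -> Cx) (s : Cx) :
  (forall i, p (p' i) = i) -> (forall j, p' (p j) = j) ->
  HasSum f s -> HasSum (fun j => f (p j)) s.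
Proof.
intros H1 H2 Hs e He; destruct (Hs e He) as [F HF]; exists (map p' F); intros G NG HG.
rewrite <- lsum_map; apply HF.
- apply FinFun.Injective_map_NoDup; [|assumption].
  intros x y E; rewrite <- (H2 x), E; apply H2.
- intros i Hi; rewrite <- (H1 i); apply in_map, HG, in_map, Hi.
Qed.

Lemma HasSum_finite {I} (f : I -> Cx) (F : list I) : NoDup F ->
  (forall i, ~ In i F -> f i = Czero) -> HasSum f (lsum f F).
Proof.
intros NF H e He; exists F; intros G NG HG.
destruct (NoDup_incl_split F G NF NG HG) as [K [HP [_ HK]]].
rewrite (lsum_perm _ _ _ HP), lsum_app.
replace (lsum f K) with Czero.
- replace (lsum f F + Czero - lsum f F) with Czero by ring; rewrite Cnorm_Czero; assumption.
- clear HP; induction K as [|k K]; simpl; [reflexivity|].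
  rewrite <- IHK, (H k) by (intros; apply HK; simpl; auto); ring.
Qed.

Lemma sum_list_split {I J} (f : I + J -> Cx) (G : list (I + J)) : NoDup G ->
  exists A B, NoDup A /\ NoDup B /\
    (forall i, In i A <-> In (inl i) G) /\ (forall j, In j B <-> In (inr j) G) /\
    lsum f G = lsum (fun i => f (inl i)) A + lsum (fun j => f (inr j)) B.
Proof.
induction 1 as [|x G Hx NG [A [B [NA [NB [HA [HB E]]]]]]].
- exists nil, nil; repeat split; try constructor; simpl; try tauto; ring.
- destruct x as [i|j].
  + exists (i :: A), B; repeat split; auto.
    * constructor; [rewrite HA|]; assumption.
    * simpl; rewrite HA; intros [->|]; auto.
    * simpl; rewrite HA; intros [Ei|]; [injection Ei|]; auto.
    * simpl; rewrite HB; auto.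
    * simpl; rewrite HB; intros [Ei|]; [discriminate|auto].
    * simpl; rewrite E; ring.
  + exists A, (j :: B); repeat split; auto.
    * constructor; [rewrite HB|]; assumption.
    * simpl; rewrite HA; auto.
    * simpl; rewrite HA; intros [Ei|]; [discriminate|auto].
    * simpl; rewrite HB; intros [->|]; auto.
    * simpl; rewrite HB; intros [Ei|]; [injection Ei|]; auto.
    * simpl; rewrite E; ring.
Qed.

Lemma HasSum_sum {I J} (f : I + J -> Cx) (s t : Cx) :
  HasSum (fun i => f (inl i)) s -> HasSum (fun j => f (inr j)) t -> HasSum f (s + t).
Proof.
intros Hs Ht e He.
destruct (Hs (e / 2)%R) as [F1 HF1]; [lra|]; destruct (Ht (e / 2)%R) as [F2 HF2]; [lra|].
exists (map inl F1 ++ map inr F2); intros G NG HG.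
destruct (sum_list_split f G NG) as [A [B [NA [NB [HA [HB E]]]]]].
assert (H1 : incl F1 A).
{ intros i Hi; apply HA, HG, in_app_iff; left; apply in_map, Hi. }
assert (H2 : incl F2 B).
{ intros i Hi; apply HB, HG, in_app_iff; right; apply in_map, Hi. }
specialize (HF1 A NA H1); specialize (HF2 B NB H2); rewrite E.
set (x := lsum _ A) in *; set (y := lsum _ B) in *.
replace (x + y - (s + t)) with ((x - s) + (y - t)) by ring.
eapply Rle_lt_trans; [apply Cnorm_triangle|lra].
Qed.

(** Labels for residues modulo 5. Reindexing a series over [class5 * J] turns its splitting into
    residue classes into a case analysis. *)
Inductive class5 := cl0 | cl1 | cl2 | cl3 | cl4.

Lemma HasSum_class5 {J} (f : class5 * J -> Cx) (s0 s1 s2 s3 s4 : Cx) :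
  HasSum (fun j => f (cl0, j)) s0 -> HasSum (fun j => f (cl1, j)) s1 ->
  HasSum (fun j => f (cl2, j)) s2 -> HasSum (fun j => f (cl3, j)) s3 ->
  HasSum (fun j => f (cl4, j)) s4 -> HasSum f (s0 + (s1 + (s2 + (s3 + s4)))).
Proof.
intros H0 H1 H2 H3 H4.
set (to := fun x : class5 * J => match x with
  | (cl0, j) => inl j | (cl1, j) => inr (inl j) | (cl2, j) => inr (inr (inl j))
  | (cl3, j) => inr (inr (inr (inl j))) | (cl4, j) => inr (inr (inr (inr j))) end
  : J + (J + (J + (J + J)))).
set (of := fun x : J + (J + (J + (J + J))) => match x with
  | inl j => (cl0, j) | inr (inl j) => (cl1, j) | inr (inr (inl j)) => (cl2, j)
  | inr (inr (inr (inl j))) => (cl3, j) | inr (inr (inr (inr j))) => (cl4, j) end).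
apply HasSum_ext with (fun x => f (of (to x))); [intros [[] j]; reflexivity|].
apply (HasSum_reindex to of (fun y => f (of y))).
- intros [|[|[|[|]]]]; reflexivity.
- intros [[] j]; reflexivity.
- repeat apply HasSum_sum; assumption.
Qed.

(** Finite sums of non-negative terms grow with the index set, so their supremum is the limit along
    the net. *)
Lemma rsum_sup {I} (g : I -> R) (M : R) : (forall i, 0 <= g i)%R ->
  (forall G, NoDup G -> rsum g G <= M)%R ->
  exists s, forall e, (0 < e)%R -> exists F, forall G, NoDup G -> incl F G ->
    (Rabs (rsum g G - s) < e)%R.
Proof.
intros Hg HM.
destruct (completeness (fun x => exists G, NoDup G /\ x = rsum g G)) as [s [Hub Hlub]].
- exists M; intros x [G [NG ->]]; auto.
- exists 0%R, nil; split; [constructor|reflexivity].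
- exists s; intros e He.
  assert (Hex : exists F, NoDup F /\ (s - e < rsum g F)%R).
  { apply NNPP; intros H; assert (s <= s - e)%R; [|lra].
    apply Hlub; intros x [G [NG ->]]; apply Rnot_lt_le; intros Hlt; apply H; eauto. }
  destruct Hex as [F [NF HF]]; exists F; intros G NG HG.
  assert (rsum g G <= s)%R by (apply Hub; exists G; auto).
  pose proof (rsum_incl g F G Hg NF NG HG).
  rewrite Rabs_left1; lra.
Qed.

Lemma Re_lsum {I} (f : I -> Cx) (l : list I) : Re (lsum f l) = rsum (fun i => Re (f i)) l.
Proof. induction l; simpl; congruence. Qed.

Lemma Im_lsum {I} (f : I -> Cx) (l : list I) : Im (lsum f l) = rsum (fun i => Im (f i)) l.
Proof. induction l; simpl; congruence. Qed.

(* [h] is the difference of the non-negative families [g + h] and [g]. *)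
Lemma rsum_cv {I} (g h : I -> R) (M : R) : (forall i, Rabs (h i) <= g i)%R ->
  (forall G, NoDup G -> rsum g G <= M)%R ->
  exists s, forall e, (0 < e)%R -> exists F, forall G, NoDup G -> incl F G ->
    (Rabs (rsum h G - s) < e)%R.
Proof.
intros Hh HM.
assert (Hb : forall i, (- g i <= h i <= g i)%R).
{ intros i; specialize (Hh i); pose proof (Rle_abs (h i)); pose proof (Rle_abs (- h i)).
  rewrite Rabs_Ropp in *; lra. }
destruct (rsum_sup g M) as [s Hs]; [intros i; specialize (Hb i); lra|assumption|].
destruct (rsum_sup (fun i => g i + h i)%R (M + M)) as [t Ht].
- intros i; specialize (Hb i); lra.
- intros G NG; rewrite rsum_add; specialize (HM G NG).
  assert (rsum h G <= rsum g G)%R by (apply rsum_le; intros i; apply Hb); lra.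
- exists (t - s)%R; intros e He.
  destruct (Hs (e / 2)%R) as [F1 HF1]; [lra|]; destruct (Ht (e / 2)%R) as [F2 HF2]; [lra|].
  exists (F1 ++ F2); intros G NG HG.
  specialize (HF1 G NG (fun x Hx => HG x (incl_appl _ (incl_refl F1) x Hx))).
  specialize (HF2 G NG (fun x Hx => HG x (incl_appr _ (incl_refl F2) x Hx))).
  rewrite rsum_add in HF2.
  apply Rabs_def2 in HF1; apply Rabs_def2 in HF2; apply Rabs_def1; lra.
Qed.

Lemma Summable_HasSum {I} (f : I -> Cx) : Summable f -> exists s, HasSum f s.
Proof.
intros [M HM].
destruct (rsum_cv _ (fun i => Re (f i)) M (fun i => Cnorm_Re (f i)) HM) as [x Hx].
destruct (rsum_cv _ (fun i => Im (f i)) M (fun i => Cnorm_Im (f i)) HM) as [y Hy].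
exists (mkC x y); intros e He.
destruct (Hx (e / 2)%R) as [F1 HF1]; [lra|]; destruct (Hy (e / 2)%R) as [F2 HF2]; [lra|].
exists (F1 ++ F2); intros G NG HG.
specialize (HF1 G NG (fun x Hx => HG x (incl_appl _ (incl_refl F1) x Hx))).
specialize (HF2 G NG (fun x Hx => HG x (incl_appr _ (incl_refl F2) x Hx))).
eapply Rle_lt_trans; [apply Cnorm_le_Re_Im|].
simpl; rewrite Re_lsum, Im_lsum; unfold Rminus in *; lra.
Qed.

Definition tsum {I} (f : I -> Cx) : Cx := epsilon (inhabits Czero) (HasSum f).

Lemma HasSum_tsum {I} (f : I -> Cx) : Summable f -> HasSum f (tsum f).
Proof. intros H; unfold tsum; apply epsilon_spec, Summable_HasSum, H. Qed.

Lemma tsum_eq {I} (f : I -> Cx) (s : Cx) : HasSum f s -> tsum f = s.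
Proof.
intros H; apply (HasSum_unique f); [|assumption].
unfold tsum; apply epsilon_spec; exists s; assumption.
Qed.

Lemma Summable_le {I} (f : I -> Cx) (g : I -> R) (M : R) :
  (forall i, Cnorm (f i) <= g i)%R -> (forall G, NoDup G -> rsum g G <= M)%R -> Summable f.
Proof.
intros H HM; exists M; intros G NG.
eapply Rle_trans; [apply rsum_le, H|apply HM, NG].
Qed.

Lemma rsum_list_prod {I J} (f : I -> R) (g : J -> R) (A : list I) (B : list J) :
  rsum (fun p => f (fst p) * g (snd p))%R (list_prod A B) = (rsum f A * rsum g B)%R.
Proof.
induction A as [|a A]; simpl; [ring|].
rewrite rsum_app, IHA, rsum_map; simpl; rewrite rsum_scal; ring.
Qed.

Lemma lsum_list_prod {I J} (f : I -> Cx) (g : J -> Cx) (A : list I) (B : list J) :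
  lsum (fun p => f (fst p) * g (snd p)) (list_prod A B) = lsum f A * lsum g B.
Proof.
induction A as [|a A]; simpl; [ring|].
rewrite lsum_app, IHA, lsum_map; simpl; rewrite lsum_scal; ring.
Qed.

Lemma NoDup_list_prod {I J} (A : list I) (B : list J) :
  NoDup A -> NoDup B -> NoDup (list_prod A B).
Proof.
intros NA NB; induction NA as [|a A Ha NA IH]; simpl; [constructor|].
apply NoDup_app; [|assumption|].
- apply FinFun.Injective_map_NoDup; [|assumption]; intros x y E; injection E; auto.
- intros [x y] H1 H2; apply in_map_iff in H1; destruct H1 as [z [E _]]; injection E as <- <-.
  apply in_prod_iff in H2; tauto.
Qed.

Lemma incl_box {I J} (G : list (I * J)) :
  incl G (list_prod (dedup (map fst G)) (dedup (map snd G))).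
Proof.
intros [i j] H; apply in_prod_iff; split; apply nodup_In;
  [apply (in_map fst) in H|apply (in_map snd) in H]; exact H.
Qed.

Lemma Summable_prod {I J} (f : I -> Cx) (g : J -> Cx) :
  Summable f -> Summable g -> Summable (fun p => f (fst p) * g (snd p)).
Proof.
intros [M HM] [N HN]; exists (M * N)%R; intros G NG.
eapply Rle_trans; [apply (rsum_incl _ G (list_prod (dedup (map fst G)) (dedup (map snd G))))|].
- intros; apply Cnorm_pos.
- assumption.
- apply NoDup_list_prod; apply dedup_NoDup.
- apply incl_box.
- eapply Rle_trans; [apply rsum_le; intros i; rewrite Cnorm_mul; apply Rle_refl|].
  rewrite (rsum_list_prod (fun i => Cnorm (f i)) (fun j => Cnorm (g j))).
  apply Rmult_le_compat; try (apply rsum_nonneg; intros; apply Cnorm_pos);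
    [apply HM|apply HN]; apply dedup_NoDup.
Qed.

(** Absolute convergence of the product family provides some sum [u]. Over rectangles the partial
    sums factor, and rectangles are cofinal among finite sets of pairs, which forces [u = s * t]. *)
Lemma HasSum_prod {I J} (f : I -> Cx) (g : J -> Cx) (s t : Cx) :
  Summable f -> Summable g -> HasSum f s -> HasSum g t ->
  HasSum (fun p => f (fst p) * g (snd p)) (s * t).
Proof.
intros Sf Sg Hs Ht.
destruct (Summable_HasSum _ (Summable_prod f g Sf Sg)) as [u Hu].
replace (s * t) with u; [assumption|].
apply Cx_eq_of_close; intros e He.
pose proof (Cnorm_pos s) as Ps; pose proof (Cnorm_pos t) as Pt.
assert (H1 : (0 < e / 4 / (Cnorm s + 1))%R) by (repeat apply Rdiv_lt_0_compat; lra).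
(* The cap at 1 ensures [Cnorm x <= Cnorm s + 1], needed below to bound [x * (y - t)]. *)
assert (H2 : (0 < Rmin 1 (e / 4 / (Cnorm t + 1)))%R).
{ apply Rmin_pos; [lra|repeat apply Rdiv_lt_0_compat; lra]. }
destruct (Hu (e / 4)%R) as [F0 HF0]; [lra|].
destruct (Hs _ H2) as [F1 HF1]; destruct (Ht _ H1) as [F2 HF2].
set (A := dedup (map fst F0 ++ F1)); set (B := dedup (map snd F0 ++ F2)).
specialize (HF1 A (dedup_NoDup _) (incl_dedup _ _ (incl_appr _ (incl_refl F1)))).
specialize (HF2 B (dedup_NoDup _) (incl_dedup _ _ (incl_appr _ (incl_refl F2)))).
assert (HI : incl F0 (list_prod A B)).
{ intros [i j] Hij; apply in_prod_iff; split; apply nodup_In, in_app_iff; left;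
    [apply (in_map fst) in Hij|apply (in_map snd) in Hij]; exact Hij. }
specialize (HF0 (list_prod A B) (NoDup_list_prod _ _ (dedup_NoDup _) (dedup_NoDup _)) HI).
rewrite lsum_list_prod in HF0.
set (x := lsum f A) in *; set (y := lsum g B) in *.
replace (u - s * t) with ((x * (y - t) + (x - s) * t) - (x * y - u)) by ring.
eapply Rle_lt_trans; [apply Cnorm_triangle_sub|].
pose proof (Cnorm_triangle (x * (y - t)) ((x - s) * t)) as HT; rewrite !Cnorm_mul in HT.
pose proof (Cnorm_triangle_inv x s) as Hx.
pose proof (Rmin_l 1 (e / 4 / (Cnorm t + 1))); pose proof (Rmin_r 1 (e / 4 / (Cnorm t + 1))).
pose proof (Cnorm_pos (x - s)); pose proof (Cnorm_pos (y - t)); pose proof (Cnorm_pos x).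
assert (Cnorm x * Cnorm (y - t) <= e / 4)%R.
{ apply Rle_trans with ((Cnorm s + 1) * Cnorm (y - t))%R; [apply Rmult_le_compat_r; lra|].
  replace (e / 4)%R with ((Cnorm s + 1) * (e / 4 / (Cnorm s + 1)))%R by (field; lra).
  apply Rmult_le_compat_l; lra. }
assert (Cnorm (x - s) * Cnorm t <= e / 4)%R.
{ apply Rle_trans with (Cnorm (x - s) * (Cnorm t + 1))%R; [apply Rmult_le_compat_l; lra|].
  replace (e / 4)%R with ((e / 4 / (Cnorm t + 1)) * (Cnorm t + 1))%R by (field; lra).
  apply Rmult_le_compat_r; lra. }
lra.
Qed.

Lemma rsum_tail {I} (g : I -> R) (M e : R) : (forall i, 0 <= g i)%R ->
  (forall G, NoDup G -> rsum g G <= M)%R -> (0 < e)%R ->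
  exists F, NoDup F /\ forall K, NoDup K -> (forall x, In x K -> ~ In x F) -> (rsum g K <= e)%R.
Proof.
intros Hg HM He; destruct (rsum_sup g M Hg HM) as [s Hs].
destruct (Hs (e / 2)%R) as [F HF]; [lra|].
exists (dedup F); split; [apply dedup_NoDup|]; intros K NK HK.
assert (HF1 := HF (dedup F) (dedup_NoDup _) (incl_dedup _ _ (incl_refl _))).
assert (HF2 := HF (dedup F ++ K)).
rewrite rsum_app in HF2.
assert (Rabs (rsum g (dedup F) + rsum g K - s) < e / 2)%R.
{ apply HF2.
  - apply NoDup_app; [apply dedup_NoDup|assumption|]; intros x H1 H2; eapply HK; eassumption.
  - apply incl_appl, incl_dedup, incl_refl. }
apply Rabs_def2 in H; apply Rabs_def2 in HF1; lra.
Qed.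

Lemma HasSum_tail {I} (f : I -> Cx) (s : Cx) (F : list I) (e : R) :
  HasSum f s -> NoDup F ->
  (forall K, NoDup K -> (forall x, In x K -> ~ In x F) ->
     rsum (fun i => Cnorm (f i)) K <= e)%R ->
  (Cnorm (s - lsum f F) <= e)%R.
Proof.
intros Hs NF HK; apply Rnot_lt_le; intros Hlt.
destruct (Hs (Cnorm (s - lsum f F) - e)%R) as [G HG]; [lra|].
set (L := dedup (F ++ G)).
assert (HG' := HG L (dedup_NoDup _) (incl_dedup _ _ (incl_appr _ (incl_refl _)))).
destruct (NoDup_incl_split F L NF (dedup_NoDup _) (incl_dedup _ _ (incl_appl _ (incl_refl _))))
  as [K [HP [NK HKF]]].
specialize (HK K NK HKF); pose proof (Cnorm_lsum_le f K).
rewrite (lsum_perm _ _ _ HP), lsum_app in HG'.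
assert (HT : s - lsum f F = lsum f K - (lsum f F + lsum f K - s)) by ring.
pose proof (Cnorm_triangle_sub (lsum f K) (lsum f F + lsum f K - s)) as Ht.
rewrite <- HT in Ht; lra.
Qed.

Lemma Ccv_lsum {I} (f : nat -> I -> Cx) (g : I -> Cx) (F : list I) :
  (forall i, Ccv (fun n => f n i) (g i)) -> Ccv (fun n => lsum (f n) F) (lsum g F).
Proof.
intros H; induction F as [|a F]; simpl; [apply Ccv_const|].
apply Ccv_add; [apply H|apply IHF].
Qed.

(* Tannery's theorem (dominated convergence for series). *)
Lemma HasSum_dominated {I} (f : nat -> I -> Cx) (h : I -> Cx) (g : I -> R) (M : R)
  (N0 : nat) (s : nat -> Cx) (t : Cx) :
  (forall n i, (n >= N0)%nat -> Cnorm (f n i) <= g i)%R ->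
  (forall G, NoDup G -> rsum g G <= M)%R ->
  (forall i, Ccv (fun n => f n i) (h i)) ->
  (forall n, (n >= N0)%nat -> HasSum (f n) (s n)) -> HasSum h t -> Ccv s t.
Proof.
intros Hd HM Hp Hs Ht e He.
assert (Hg : forall i, (0 <= g i)%R).
{ intros i; eapply Rle_trans; [apply Cnorm_pos|apply (Hd N0 i); lia]. }
assert (Hh : forall i, (Cnorm (h i) <= g i)%R).
{ intros i; apply Rnot_lt_le; intros Hlt.
  destruct (Hp i (Cnorm (h i) - g i)%R) as [N HN]; [lra|].
  specialize (HN (N + N0)%nat ltac:(lia)); specialize (Hd (N + N0)%nat i ltac:(lia)).
  rewrite Cnorm_sub_sym in HN; pose proof (Cnorm_triangle_inv (h i) (f (N + N0)%nat i)); lra. }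
destruct (rsum_tail g M (e / 4) Hg HM) as [F [NF HF]]; [lra|].
destruct (Ccv_lsum f h F Hp (e / 4)%R) as [N HN]; [lra|].
exists (N + N0)%nat; intros n Hn; specialize (HN n ltac:(lia)).
assert (H1 : (Cnorm (s n - lsum (f n) F) <= e / 4)%R).
{ apply HasSum_tail; [apply Hs; lia|assumption|]; intros K NK HK.
  eapply Rle_trans; [apply rsum_le; intros i; apply Hd; lia|apply HF; assumption]. }
assert (H2 : (Cnorm (t - lsum h F) <= e / 4)%R).
{ apply HasSum_tail; [apply Ht|assumption|]; intros K NK HK.
  eapply Rle_trans; [apply rsum_le; intros i; apply Hh|apply HF; assumption]. }
replace (s n - t) with ((s n - lsum (f n) F + (lsum (f n) F - lsum h F)) - (t - lsum h F)) by ring.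
eapply Rle_lt_trans; [apply Cnorm_triangle_sub|].
pose proof (Cnorm_triangle (s n - lsum (f n) F) (lsum (f n) F - lsum h F)); lra.
Qed.

(** * Geometric and Gaussian majorants *)

Lemma rsum_geometric (x : R) (l : list nat) : (0 <= x < 1)%R -> NoDup l ->
  (rsum (fun n => x ^ n)%R l <= / (1 - x))%R.
Proof.
intros Hx Nl.
assert (Hs : forall N, rsum (fun n => x ^ n)%R (seq 0 N) = ((1 - x ^ N) / (1 - x))%R).
{ induction N; [simpl; field; lra|].
  rewrite seq_S, rsum_app, IHN; simpl; field; lra. }
apply Rle_trans with (rsum (fun n => x ^ n)%R (seq 0 (S (list_max l)))).
- apply rsum_incl; [intros; apply pow_le; lra|assumption|apply seq_NoDup|].
  intros n Hn; apply in_seq.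
  assert (n <= list_max l)%nat; [|lia].
  pose proof (proj1 (list_max_le l (list_max l)) (le_n _)) as HF.
  rewrite Forall_forall in HF; auto.
- rewrite Hs; unfold Rdiv; rewrite <- (Rmult_1_l (/ (1 - x))) at 2.
  apply Rmult_le_compat_r; [left; apply Rinv_0_lt_compat; lra|].
  pose proof (pow_le x (S (list_max l)) (proj1 Hx)); lra.
Qed.

Lemma rsum_filter {I} (p : I -> bool) (f : I -> R) (l : list I) :
  rsum f l = (rsum f (filter p l) + rsum f (filter (fun x => negb (p x)) l))%R.
Proof.
induction l as [|a l]; simpl; [ring|]; rewrite IHl; destruct (p a); simpl; ring.
Qed.

Lemma rsum_map_inj {I J} (p : I -> J) (f : J -> R) (A : list I) (M : R) : NoDup A ->
  (forall x y, In x A -> In y A -> p x = p y -> x = y) ->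
  (forall G, NoDup G -> rsum f G <= M)%R -> (rsum (fun i => f (p i)) A <= M)%R.
Proof.
intros NA Hp HM; rewrite <- rsum_map; apply HM.
apply NoDup_map_NoDup_ForallPairs; [|assumption].
intros x y Hx Hy; apply Hp; assumption.
Qed.

(** Two geometric series of ratio [exp (- 1)], one for each sign of the index. *)
Definition exp_abs_bound : R := (2 * / (1 - exp (- 1)))%R.

Lemma rsum_exp_abs (l : list Z) : NoDup l ->
  (rsum (fun n => exp (- Rabs (IZR n))) l <= exp_abs_bound)%R.
Proof.
intros Nl; rewrite (rsum_filter (Z.leb 0)).
assert (Hx : (0 <= exp (- 1) < 1)%R).
{ split; [left; apply exp_pos|rewrite <- exp_0; apply exp_increasing; lra]. }
assert (He : forall n : Z, exp (- Rabs (IZR n)) = (exp (- 1) ^ Z.abs_nat n)%R).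
{ intros n; rewrite <- abs_IZR, <- Zabs2Nat.id_abs, <- INR_IZR_INZ.
  induction (Z.abs_nat n) as [|k IH]; [simpl; rewrite Ropp_0; apply exp_0|].
  rewrite S_INR; simpl; rewrite <- IH, <- exp_plus; f_equal; ring. }
unfold exp_abs_bound; rewrite <- Rplus_diag; apply Rplus_le_compat.
- eapply Rle_trans; [apply rsum_le; intros n; rewrite He; apply Rle_refl|].
  apply (rsum_map_inj Z.abs_nat (fun k => exp (- 1) ^ k)%R).
  + apply NoDup_filter, Nl.
  + intros x y H1 H2 E; apply filter_In in H1, H2; lia.
  + intros G; apply rsum_geometric, Hx.
- eapply Rle_trans; [apply rsum_le; intros n; rewrite He; apply Rle_refl|].
  apply (rsum_map_inj Z.abs_nat (fun k => exp (- 1) ^ k)%R).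
  + apply NoDup_filter, Nl.
  + intros x y H1 H2 E; apply filter_In in H1, H2; lia.
  + intros G; apply rsum_geometric, Hx.
Qed.

Lemma rsum_exp_abs_scal (c : R) (l : list Z) : (0 <= c)%R -> NoDup l ->
  (rsum (fun n => c * exp (- Rabs (IZR n)))%R l <= c * exp_abs_bound)%R.
Proof.
intros Hc Nl; rewrite rsum_scal; apply Rmult_le_compat_l; [assumption|].
apply rsum_exp_abs, Nl.
Qed.

(** With y = |x|, the bound 1 + y^2 <= 4 e^y absorbs the weight and raises the linear coefficient to
    be + 1; splitting off e^(-y) raises it to be + 2. Completing the square bounds -al y^2 + (be +
    2) y by (be + 2)^2 / (4 al). *)
Lemma gauss_le_exp_abs (al be D x : R) : (0 < al)%R -> (0 <= D)%R ->
  (D * (1 + x * x) * exp (- al * (x * x) + be * Rabs x)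
   <= 4 * D * exp ((be + 2) * (be + 2) / (4 * al)) * exp (- Rabs x))%R.
Proof.
intros Ha HD; set (y := Rabs x).
assert (Hy : (0 <= y)%R) by apply Rabs_pos.
replace (x * x)%R with (y * y)%R by (unfold y; rewrite <- Rabs_mult; apply Rabs_pos_eq; nra).
assert (H1 : (1 + y * y <= 4 * exp y)%R).
{ assert (1 + y / 2 <= exp (y / 2))%R.
  { destruct (Req_dec y 0) as [->|Hn]; [|left; apply exp_ineq1; lra].
    replace (0 / 2)%R with 0%R by field; rewrite exp_0; lra. }
  replace (exp y) with (exp (y / 2) * exp (y / 2))%R by (rewrite <- exp_plus; f_equal; field).
  nra. }
apply Rle_trans with (D * (4 * exp y) * exp (- al * (y * y) + be * y))%R.
{ apply Rmult_le_compat_r; [left; apply exp_pos|]; apply Rmult_le_compat_l; assumption. }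
replace (D * (4 * exp y) * exp (- al * (y * y) + be * y))%R
  with (4 * D * exp (y + (- al * (y * y) + be * y)))%R by (rewrite exp_plus; ring).
replace (4 * D * exp ((be + 2) * (be + 2) / (4 * al)) * exp (- y))%R
  with (4 * D * exp ((be + 2) * (be + 2) / (4 * al) + - y))%R by (rewrite exp_plus; ring).
apply Rmult_le_compat_l; [lra|].
assert (y + (- al * (y * y) + be * y) <= (be + 2) * (be + 2) / (4 * al) + - y)%R.
{ apply (Rmult_le_reg_r (4 * al)); [lra|].
  replace (((be + 2) * (be + 2) / (4 * al) + - y) * (4 * al))%R
    with ((be + 2) * (be + 2) - y * (4 * al))%R by (field; lra).
  pose proof (pow2_ge_0 (2 * al * y - (be + 2))); nra. }
destruct H as [H| ->]; [left; apply exp_increasing, H|apply Rle_refl].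
Qed.

(** The convergence test behind every theta series below; one differentiation in [s] introduces the
    quadratic weight. *)
Lemma Summable_gauss (f : Z -> Cx) (al be D : R) : (0 < al)%R -> (0 <= D)%R ->
  (forall n, Cnorm (f n) <= D * (1 + IZR n * IZR n)
      * exp (- al * (IZR n * IZR n) + be * Rabs (IZR n)))%R -> Summable f.
Proof.
intros Ha HD H.
set (c := (4 * D * exp ((be + 2) * (be + 2) / (4 * al)))%R).
apply (Summable_le f (fun n => c * exp (- Rabs (IZR n)))%R (c * exp_abs_bound)).
- intros n; eapply Rle_trans; [apply H|apply gauss_le_exp_abs; assumption].
- intros G NG; apply rsum_exp_abs_scal; [|assumption].
  unfold c; pose proof (exp_pos ((be + 2) * (be + 2) / (4 * al))); apply Rmult_le_pos; lra.
Qed.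

Lemma HasSum_antisym (f : Z -> Cx) (s : Cx) (p : Z -> Z) :
  (forall n, p (p n) = n) -> (forall n, f (p n) = - f n) -> HasSum f s -> s = Czero.
Proof.
intros Hp Hf Hs.
assert (E : s = - s).
{ apply (HasSum_unique f); [assumption|].
  apply HasSum_ext with (fun n => f (p (p n))); [intros; rewrite Hp; reflexivity|].
  apply HasSum_ext with (fun n => - f (p n)); [intros; rewrite <- Hf; reflexivity|].
  apply HasSum_opp, (HasSum_reindex p p); auto. }
replace s with ((s + s) / 2); [|field; intros H; injection H; lra].
rewrite E at 2; field; intros H; injection H; lra.
Qed.

(** * Infinite products *)

(** The finite q-Pochhammer symbol (q;q)_N. Its limit [euler q] is (q;q)_oo, and eta_k is [euler] at
    the k-th power of the nome. *)
Definition euler_partial (q : Cx) (N : nat) : Cx := Cprod (fun n => Cone - q ^ S n) N.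

Definition euler (q : Cx) : Cx := Clim (euler_partial q).

Lemma Cprod_ext (f g : nat -> Cx) (N : nat) : (forall n, f n = g n) -> Cprod f N = Cprod g N.
Proof. intros H; induction N; simpl; congruence. Qed.

Lemma Cprod_mul (f g : nat -> Cx) (N : nat) :
  Cprod (fun n => f n * g n) N = Cprod f N * Cprod g N.
Proof. induction N; simpl; [ring|rewrite IHN; ring]. Qed.

Lemma Cprod_shift (f : nat -> Cx) (N : nat) : Cprod f N * f N = f 0%nat * Cprod (fun n => f (S n)) N.
Proof. induction N; simpl; [ring|simpl in IHN; rewrite IHN; ring]. Qed.

Lemma Cprod_group5 (f : nat -> Cx) (N : nat) :
  Cprod f (5 * N) = Cprod (fun n => f (5 * n)%nat * f (5 * n + 1)%nat * f (5 * n + 2)%nat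
     * f (5 * n + 3)%nat * f (5 * n + 4)%nat) N.
Proof.
induction N; [reflexivity|].
replace (5 * S N)%nat with (S (S (S (S (S (5 * N)))))) by lia.
cbn [Cprod]; rewrite IHN.
replace (5 * N + 1)%nat with (S (5 * N)) by lia.
replace (5 * N + 2)%nat with (S (S (5 * N))) by lia.
replace (5 * N + 3)%nat with (S (S (S (5 * N)))) by lia.
replace (5 * N + 4)%nat with (S (S (S (S (5 * N))))) by lia.
ring.
Qed.

Lemma exp_ge_1_plus (x : R) : (0 <= x)%R -> (1 + x <= exp x)%R.
Proof.
intros [H| <-]; [left; apply exp_ineq1; lra|rewrite exp_0; lra].
Qed.

Lemma exp_le_compat (x y : R) : (x <= y)%R -> (exp x <= exp y)%R.
Proof. intros [H| ->]; [left; apply exp_increasing, H|apply Rle_refl]. Qed.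

(** Multiply |1 - q^n| <= exp(|q|^n). The induction carries the partial geometric sum, because the
    final bound is not inductive by itself. *)
Lemma euler_partial_le (q : Cx) (N : nat) : (Cnorm q < 1)%R ->
  (Cnorm (euler_partial q N) <= exp (/ (1 - Cnorm q)))%R.
Proof.
intros Hq; pose proof (Cnorm_pos q) as Hp; set (x := Cnorm q) in *.
apply Rle_trans with (exp ((1 - x ^ N) / (1 - x))).
- induction N.
  + change (euler_partial q 0) with Cone; simpl pow; rewrite Cnorm_Cone.
    replace ((1 - 1) / (1 - x))%R with 0%R by (field; lra); rewrite exp_0; lra.
  + change (euler_partial q (S N)) with (euler_partial q N * (Cone - q ^ S N)).
    rewrite Cnorm_mul.
    apply Rle_trans with (exp ((1 - x ^ N) / (1 - x)) * exp (x ^ S N))%R.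
    * apply Rmult_le_compat; try apply Cnorm_pos; [assumption|].
      eapply Rle_trans; [apply Cnorm_triangle_sub|].
      rewrite Cnorm_pow; rewrite Cnorm_Cone.
      apply exp_ge_1_plus, pow_le; assumption.
    * rewrite <- exp_plus; apply exp_le_compat.
      replace ((1 - x ^ S N) / (1 - x))%R with ((1 - x ^ N) / (1 - x) + x ^ N)%R
        by (simpl; field; lra).
      pose proof (pow_le x N Hp); simpl; nra.
- apply exp_le_compat; unfold Rdiv; rewrite <- (Rmult_1_l (/ (1 - x))) at 2.
  apply Rmult_le_compat_r; [left; apply Rinv_0_lt_compat; lra|].
  pose proof (pow_le x N Hp); lra.
Qed.

(** For u = |q|^n one has 1 - u >= exp(-u / (1 - u)), and u <= |q| makes the exponents geometric.
    This uniform lower bound is what makes the infinite product invertible. *)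
Lemma euler_partial_ge (q : Cx) (N : nat) : (Cnorm q < 1)%R ->
  (exp (- / (1 - Cnorm q) ^ 2) <= Cnorm (euler_partial q N))%R.
Proof.
intros Hq; pose proof (Cnorm_pos q) as Hp; set (x := Cnorm q) in *.
assert (Hi : (0 < / (1 - x))%R) by (apply Rinv_0_lt_compat; lra).
apply Rle_trans with (exp (- ((1 - x ^ N) / (1 - x) ^ 2))).
- apply exp_le_compat, Ropp_le_contravar; unfold Rdiv.
  rewrite <- (Rmult_1_l (/ (1 - x) ^ 2)) at 2.
  apply Rmult_le_compat_r; [left; apply Rinv_0_lt_compat; nra|].
  pose proof (pow_le x N Hp); lra.
- induction N.
  + change (euler_partial q 0) with Cone; simpl pow; rewrite Cnorm_Cone.
    replace (- ((1 - 1) / ((1 - x) * ((1 - x) * 1))))%R with 0%R by (field; lra).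
    rewrite exp_0; lra.
  + change (euler_partial q (S N)) with (euler_partial q N * (Cone - q ^ S N)).
    rewrite Cnorm_mul.
    pose proof (pow_le x N Hp) as HN.
    assert (HS : (x ^ S N <= x)%R).
    { simpl; rewrite <- (Rmult_1_r x) at 3; apply Rmult_le_compat_l; [assumption|].
      rewrite <- (pow1 N); apply pow_incr; lra. }
    assert (HS0 : (0 <= x ^ S N)%R) by (apply pow_le; assumption).
    apply Rle_trans with (exp (- ((1 - x ^ N) / (1 - x) ^ 2)) * exp (- (x ^ S N / (1 - x))))%R.
    * rewrite <- exp_plus; apply exp_le_compat.
      replace ((1 - x ^ S N) / (1 - x) ^ 2)%R
        with ((1 - x ^ N) / (1 - x) ^ 2 + x ^ N / (1 - x))%R by (simpl; field; lra).
      assert (x ^ S N / (1 - x) <= x ^ N / (1 - x))%R; [|lra].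
      apply Rmult_le_compat_r; [lra|simpl; nra].
    * apply Rmult_le_compat; try (left; apply exp_pos); [assumption|].
      apply Rle_trans with (1 - x ^ S N)%R.
      -- set (u := (x ^ S N)%R) in *; rewrite exp_Ropp.
         assert (Hu : (0 < 1 - u)%R) by lra.
         rewrite <- (Rinv_inv (1 - u)); apply Rinv_le_contravar.
         { apply Rinv_0_lt_compat; assumption. }
         apply Rle_trans with (exp (u / (1 - u))).
         ++ replace (/ (1 - u))%R with (1 + u / (1 - u))%R by (field; lra).
            apply exp_ge_1_plus; apply Rmult_le_pos; [assumption|].
            left; apply Rinv_0_lt_compat; assumption.
         ++ apply exp_le_compat; apply Rmult_le_compat_l; [assumption|].
            apply Rinv_le_contravar; lra.
      -- pose proof (Cnorm_triangle_inv Cone (q ^ S N)) as HT.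
         rewrite Cnorm_pow, Cnorm_Cone in HT; exact HT.
Qed.

Lemma HasSum_nat_Ccv (f : nat -> Cx) (s : Cx) :
  HasSum f s -> Ccv (fun N => lsum f (seq 0 N)) s.
Proof.
intros H e He; destruct (H e He) as [F HF]; exists (S (list_max F)); intros n Hn.
apply HF; [apply seq_NoDup|]; intros k Hk; apply in_seq.
pose proof (proj1 (list_max_le F (list_max F)) (le_n _)) as HM.
rewrite Forall_forall in HM; specialize (HM k Hk); lia.
Qed.

(** Telescoping: the increments -q^(n+1) (q;q)_n are dominated by a geometric series. *)
Lemma euler_cv (q : Cx) : (Cnorm q < 1)%R -> Ccv (euler_partial q) (euler q).
Proof.
intros Hq; pose proof (Cnorm_pos q) as Hp.
set (d := fun n => euler_partial q (S n) - euler_partial q n).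
assert (Sd : Summable d).
{ set (M := exp (/ (1 - Cnorm q))).
  apply (Summable_le d (fun n => M * Cnorm q ^ n)%R (M * / (1 - Cnorm q))).
  - intros n; unfold d.
    change (euler_partial q (S n)) with (euler_partial q n * (Cone - q ^ S n)).
    replace (euler_partial q n * (Cone - q ^ S n) - euler_partial q n)
      with (- (euler_partial q n * (q * q ^ n))) by (simpl; ring).
    rewrite Cnorm_opp, !Cnorm_mul, Cnorm_pow.
    apply Rmult_le_compat; [apply Cnorm_pos| |apply euler_partial_le, Hq|].
    + apply Rmult_le_pos; [assumption|apply pow_le; assumption].
    + pose proof (pow_le (Cnorm q) n Hp); nra.
  - intros G NG; rewrite rsum_scal; apply Rmult_le_compat_l; [left; apply exp_pos|].
    apply rsum_geometric; [lra|assumption]. }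
destruct (Summable_HasSum d Sd) as [s Hs]; apply HasSum_nat_Ccv in Hs.
assert (H : Ccv (euler_partial q) (Cone + s)).
{ apply Ccv_ext with (fun N => Cone + lsum d (seq 0 N)).
  - intros N; induction N; [simpl; unfold euler_partial; simpl; ring|].
    rewrite seq_S, lsum_app; simpl lsum; simpl in IHN.
    replace (euler_partial q (S N)) with (euler_partial q N + d N) by (unfold d; ring).
    rewrite <- IHN; ring.
  - apply Ccv_add; [apply Ccv_const|assumption]. }
unfold euler; rewrite (Clim_eq _ _ H); assumption.
Qed.

Lemma euler_neq0 (q : Cx) : (Cnorm q < 1)%R -> euler q <> Czero.
Proof.
intros Hq E; pose proof (euler_cv q Hq) as H; rewrite E in H.
destruct (H (exp (- / (1 - Cnorm q) ^ 2))) as [N HN]; [apply exp_pos|].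
specialize (HN N (le_n N)); pose proof (euler_partial_ge q N Hq).
replace (euler_partial q N - Czero) with (euler_partial q N) in HN by ring; lra.
Qed.

Lemma euler_partial_neq0 (q : Cx) (N : nat) : (Cnorm q < 1)%R -> euler_partial q N <> Czero.
Proof.
intros Hq E; pose proof (euler_partial_ge q N Hq) as H.
rewrite E, Cnorm_Czero in H; pose proof (exp_pos (- / (1 - Cnorm q) ^ 2)); lra.
Qed.

Lemma Cnorm_exp_lt1 (s : Cx) : (Re s < 0)%R -> (Cnorm (Cexp s) < 1)%R.
Proof. intros H; rewrite Cnorm_exp, <- exp_0; apply exp_increasing, H. Qed.

(** * The Jacobi triple product *)

(* [1 / (q;q)_k], extended by 0 to negative [k], so that the recurrence below holds on all of [Z]. *)
Definition inv_euler (q : Cx) (k : Z) : Cx :=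
  if (k <? 0)%Z then Czero else Cinv (euler_partial q (Z.to_nat k)).

Lemma inv_euler_rec (s : Cx) (k : Z) : (Re s < 0)%R ->
  inv_euler (Cexp s) (k - 1) = (Cone - Cexp (RtoC (IZR k) * s)) * inv_euler (Cexp s) k.
Proof.
intros Hs; unfold inv_euler.
destruct (Z.ltb_spec (k - 1) 0); destruct (Z.ltb_spec k 0); try lia.
- ring.
- replace k with 0%Z by lia; replace (RtoC 0 * s) with Czero by cx; rewrite Cexp_0; ring.
- replace (Z.to_nat k) with (S (Z.to_nat (k - 1))) by lia.
  set (n := Z.to_nat (k - 1)).
  change (euler_partial (Cexp s) (S n)) with (euler_partial (Cexp s) n * (Cone - Cexp s ^ S n)).
  replace k with (Z.of_nat (S n)) by lia; rewrite <- INR_IZR_INZ, Cexp_INR_mul.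
  pose proof (euler_partial_neq0 _ (S n) (Cnorm_exp_lt1 s Hs)) as Hn.
  change (euler_partial (Cexp s) (S n)) with (euler_partial (Cexp s) n * (Cone - Cexp s ^ S n)) in Hn.
  apply Cmul_neq0_inv in Hn; field; split; apply Hn.
Qed.

Lemma inv_euler_le (q : Cx) (k : Z) : (Cnorm q < 1)%R ->
  (Cnorm (inv_euler q k) <= exp (/ (1 - Cnorm q) ^ 2))%R.
Proof.
intros Hq; unfold inv_euler; destruct (Z.ltb_spec k 0).
- rewrite Cnorm_Czero; left; apply exp_pos.
- rewrite Cnorm_inv by (apply euler_partial_neq0, Hq).
  rewrite <- (Ropp_involutive (/ (1 - Cnorm q) ^ 2)), exp_Ropp.
  apply Rinv_le_contravar; [apply exp_pos|apply euler_partial_ge, Hq].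
Qed.

Lemma inv_euler_cv (q : Cx) (k : nat -> Z) : (Cnorm q < 1)%R ->
  (forall K, exists N, forall n, (n >= N)%nat -> (Z.of_nat K <= k n)%Z) ->
  Ccv (fun n => inv_euler q (k n)) (Cinv (euler q)).
Proof.
intros Hq Hk e He.
destruct (Ccv_inv _ _ (euler_neq0 q Hq) (euler_cv q Hq) e He) as [K HK].
destruct (Hk K) as [N HN]; exists N; intros n Hn; specialize (HN n Hn).
unfold inv_euler; destruct (Z.ltb_spec (k n) 0); [lia|apply HK; lia].
Qed.

(** The logarithm of q^(n(n-1)/2) z^n for q = e^s and z = e^w; negative and fractional powers then
    need no choice of branch. *)
Definition jtp_exponent (s w : Cx) (n : Z) : Cx :=
  RtoC (IZR (n * (n - 1)) / 2) * s + RtoC (IZR n) * w.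

Definition jtp_partial (s w : Cx) (N : nat) : Cx :=
  Cprod (fun j => (Cone + Cexp w * Cexp s ^ j) * (Cone + Cexp (- w) * Cexp s ^ S j)) N.

(** Up to the factor (q;q)_(2N) this is q^(n(n-1)/2) z^n times the Gaussian binomial coefficient of
    2N over N + n. It vanishes for |n| > N by the convention on [inv_euler], so finite identities
    can be written as sums over all of [Z]. *)
Definition jtp_finite_term (s w : Cx) (N : nat) (n : Z) : Cx :=
  Cexp (jtp_exponent s w n)
  * (inv_euler (Cexp s) (Z.of_nat N + n) * inv_euler (Cexp s) (Z.of_nat N - n)).

(** The coefficient form of multiplication by the next factor, (1 + z q^N)(1 + z^-1 q^(N+1)) = (1 +
    q^(2N+1)) + z q^N + z^-1 q^(N+1): powers of z shift the index. *)
Lemma jtp_finite_term_rec (s w : Cx) (N : nat) (n : Z) : (Re s < 0)%R ->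
  (Cone - Cexp s ^ (2 * N + 1)) * (Cone - Cexp s ^ (2 * N + 2)) * jtp_finite_term s w (S N) n =
  (Cone + Cexp s ^ (2 * N + 1)) * jtp_finite_term s w N n
  + (Cexp w * Cexp s ^ N) * jtp_finite_term s w N (n - 1)
  + (Cexp (- w) * Cexp s ^ (S N)) * jtp_finite_term s w N (n + 1).
Proof.
intros Hs; unfold jtp_finite_term.
set (q := Cexp s); set (Z0 := Z.of_nat N).
replace (Z.of_nat (S N)) with (Z0 + 1)%Z by lia.
set (H := inv_euler q (Z0 + 1 + n)); set (H' := inv_euler q (Z0 + 1 - n)).
(* With x = q^(N+n), y = q^(N-n) and x y = q^(2N), everything reduces to a polynomial identity in x,
   y, q. *)
set (x := Cexp (RtoC (IZR (Z0 + n)) * s)); set (y := Cexp (RtoC (IZR (Z0 - n)) * s)).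
assert (E1 : inv_euler q (Z0 + n) = (Cone - x * q) * H).
{ unfold H; replace (Z0 + n)%Z with (Z0 + 1 + n - 1)%Z at 1 by lia.
  unfold q; rewrite inv_euler_rec by assumption; f_equal; f_equal.
  unfold x; rewrite <- Cexp_add; f_equal.
  replace (Z0 + 1 + n)%Z with (Z0 + n + 1)%Z by lia; rewrite (plus_IZR (Z0 + n)); cx. }
assert (E2 : inv_euler q (Z0 - n) = (Cone - y * q) * H').
{ unfold H'; replace (Z0 - n)%Z with (Z0 + 1 - n - 1)%Z at 1 by lia.
  unfold q; rewrite inv_euler_rec by assumption; f_equal; f_equal.
  unfold y; rewrite <- Cexp_add; f_equal.
  replace (Z0 + 1 - n)%Z with (Z0 - n + 1)%Z by lia; rewrite (plus_IZR (Z0 - n)); cx. }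
assert (E3 : inv_euler q (Z0 + (n - 1)) = (Cone - x) * ((Cone - x * q) * H)).
{ rewrite <- E1; replace (Z0 + (n - 1))%Z with (Z0 + n - 1)%Z by lia.
  unfold q; rewrite inv_euler_rec by assumption; reflexivity. }
assert (E4 : inv_euler q (Z0 - (n + 1)) = (Cone - y) * ((Cone - y * q) * H')).
{ rewrite <- E2; replace (Z0 - (n + 1))%Z with (Z0 - n - 1)%Z by lia.
  unfold q; rewrite inv_euler_rec by assumption; reflexivity. }
replace (Z0 - (n - 1))%Z with (Z0 + 1 - n)%Z by lia.
replace (Z0 + (n + 1))%Z with (Z0 + 1 + n)%Z by lia.
fold H H'; rewrite E1, E2, E3, E4.
set (e := Cexp (jtp_exponent s w n)).
assert (F0 : q ^ N = Cexp (RtoC (IZR Z0) * s)).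
{ unfold q, Z0; rewrite <- INR_IZR_INZ, Cexp_INR_mul; reflexivity. }
assert (F1 : Cexp w * q ^ N * Cexp (jtp_exponent s w (n - 1)) = e * (y * q)).
{ rewrite F0; unfold e, y, q; rewrite <- !Cexp_add; f_equal; unfold jtp_exponent.
  rewrite !mult_IZR, !minus_IZR; apply Cx_eq; simpl; field. }
assert (F2 : Cexp (- w) * q ^ S N * Cexp (jtp_exponent s w (n + 1)) = e * (x * q)).
{ change (q ^ S N) with (q * q ^ N).
  rewrite F0; unfold e, x, q; rewrite <- !Cexp_add; f_equal; unfold jtp_exponent.
  rewrite !mult_IZR, !minus_IZR, !plus_IZR; apply Cx_eq; simpl; field. }
assert (F3 : q ^ (2 * N) = x * y).
{ replace (2 * N)%nat with (N + N)%nat by lia; rewrite Cpow_add, F0.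
  unfold x, y; rewrite <- !Cexp_add; f_equal; rewrite plus_IZR, minus_IZR; cx. }
replace (Cexp w * q ^ N * (Cexp (jtp_exponent s w (n - 1)) * ((Cone - x) * ((Cone - x * q) * H) * H')))
  with (Cexp w * q ^ N * Cexp (jtp_exponent s w (n - 1)) * ((Cone - x) * ((Cone - x * q) * H) * H'))
  by ring.
replace (Cexp (- w) * q ^ S N * (Cexp (jtp_exponent s w (n + 1)) * (H * ((Cone - y) * ((Cone - y * q) * H')))))
  with (Cexp (- w) * q ^ S N * Cexp (jtp_exponent s w (n + 1)) * (H * ((Cone - y) * ((Cone - y * q) * H'))))
  by ring.
rewrite F1, F2, !Cpow_add, F3; ring.
Qed.

Lemma HasSum_shift (f : Z -> Cx) (k : Z) (s : Cx) : HasSum f s -> HasSum (fun n => f (n + k)%Z) s.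
Proof.
apply (HasSum_reindex (fun n => n + k)%Z (fun n => n - k)%Z); intros; lia.
Qed.

(** Base case with a free weight: [c = 1] serves the product, [c n = n] its logarithmic derivative
    in z. *)
Lemma jtp_finite_term_0 (s w : Cx) (c : Z -> Cx) :
  HasSum (fun n => c n * jtp_finite_term s w 0 n) (c 0%Z).
Proof.
replace (c 0%Z) with (lsum (fun n => c n * jtp_finite_term s w 0 n) [0%Z]).
- apply HasSum_finite; [repeat constructor; simpl; tauto|].
  intros i Hi; unfold jtp_finite_term, inv_euler.
  destruct (Z.ltb_spec (Z.of_nat 0 + i) 0); [ring|].
  destruct (Z.ltb_spec (Z.of_nat 0 - i) 0); [ring|].
  exfalso; apply Hi; simpl; lia.
- simpl; unfold jtp_finite_term, inv_euler, jtp_exponent; simpl.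
  replace (RtoC (0 / 2) * s + RtoC 0 * w) with Czero by (apply Cx_eq; simpl; field).
  rewrite Cexp_0; unfold euler_partial; simpl; field; apply Cone_neq_Czero.
Qed.

Lemma one_sub_pow_neq0 (q : Cx) (n : nat) : (Cnorm q < 1)%R -> Cone - q ^ S n <> Czero.
Proof.
intros Hq; pose proof (euler_partial_neq0 q (S n) Hq) as H.
exact (proj2 (Cmul_neq0_inv _ _ H)).
Qed.

Lemma euler_partial_double (q : Cx) (N : nat) : euler_partial q (2 * S N) =
  euler_partial q (2 * N) * ((Cone - q ^ (2 * N + 1)) * (Cone - q ^ (2 * N + 2))).
Proof.
replace (2 * S N)%nat with (S (S (2 * N))) by lia.
replace (2 * N + 1)%nat with (S (2 * N)) by lia.
replace (2 * N + 2)%nat with (S (S (2 * N))) by lia.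
unfold euler_partial; cbn [Cprod]; ring.
Qed.

(** The finite triple product, exact for every [N]; the infinite one then costs a single passage to
    the limit. *)
Lemma jtp_finite (s w : Cx) (N : nat) : (Re s < 0)%R ->
  HasSum (jtp_finite_term s w N) (jtp_partial s w N / euler_partial (Cexp s) (2 * N)).
Proof.
intros Hs; pose proof (Cnorm_exp_lt1 s Hs) as Hq; induction N.
- replace (_ / _) with Cone by (unfold jtp_partial, euler_partial; simpl; field; apply Cone_neq_Czero).
  apply HasSum_ext with (fun n => Cone * jtp_finite_term s w 0 n); [intros; ring|].
  apply (jtp_finite_term_0 s w (fun _ => Cone)).
- set (q := Cexp s) in *.
  assert (K1 : Cone - q ^ (2 * N + 1) <> Czero)
    by (rewrite Nat.add_1_r; apply one_sub_pow_neq0, Hq).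
  assert (K2 : Cone - q ^ (2 * N + 2) <> Czero)
    by (rewrite Nat.add_succ_r; apply one_sub_pow_neq0, Hq).
  pose proof (euler_partial_neq0 q (2 * N) Hq) as K3.
  set (k := (Cone - q ^ (2 * N + 1)) * (Cone - q ^ (2 * N + 2))).
  assert (Hk : k <> Czero) by (apply Cmul_neq0; assumption).
  apply HasSum_ext with (fun n => Cinv k * (
    (Cone + q ^ (2 * N + 1)) * jtp_finite_term s w N n
    + (Cexp w * q ^ N) * jtp_finite_term s w N (n + -1)
    + (Cexp (- w) * q ^ (S N)) * jtp_finite_term s w N (n + 1))).
  { intros n; replace (n + -1)%Z with (n - 1)%Z by lia; unfold q.
    rewrite <- jtp_finite_term_rec by assumption; fold q; fold k; field; assumption. }
  rewrite euler_partial_double; fold k.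
  change (jtp_partial s w (S N)) with
    (jtp_partial s w N * ((Cone + Cexp w * q ^ N) * (Cone + Cexp (- w) * q ^ S N))).
  set (T := jtp_partial s w N / euler_partial q (2 * N)) in *.
  replace (_ / _) with (Cinv k * ((Cone + q ^ (2 * N + 1)) * T
     + (Cexp w * q ^ N) * T + (Cexp (- w) * q ^ (S N)) * T)).
  + apply HasSum_scal; repeat apply HasSum_add; apply HasSum_scal;
      [|apply HasSum_shift|apply HasSum_shift]; assumption.
  + assert (Ew : Cexp w <> Czero) by apply Cexp_neq0.
    unfold T; rewrite Cexp_opp; replace (2 * N + 1)%nat with (N + S N)%nat by lia.
    rewrite Cpow_add; field; repeat split; assumption.
Qed.

(** The weight [n] is the effect of d/dw, performed on coefficients instead of by differentiation:
    shifting the index by one turns [D] into [D + S0] or [D - S0]. *)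
Lemma jtp_finite_deriv_step (s w D : Cx) (N : nat) : (Re s < 0)%R ->
  HasSum (fun n => RtoC (IZR n) * jtp_finite_term s w N n) D ->
  let S0 := jtp_partial s w N / euler_partial (Cexp s) (2 * N) in
  HasSum (fun n => RtoC (IZR n) * jtp_finite_term s w (S N) n)
    (((Cone + Cexp s ^ (2 * N + 1)) * D + (Cexp w * Cexp s ^ N) * (D + S0)
       + (Cexp (- w) * Cexp s ^ (S N)) * (D - S0))
     / ((Cone - Cexp s ^ (2 * N + 1)) * (Cone - Cexp s ^ (2 * N + 2)))).
Proof.
intros Hs HD S0; pose proof (Cnorm_exp_lt1 s Hs) as Hq.
pose proof (jtp_finite s w N Hs) as HS; fold S0 in HS.
set (q := Cexp s) in *.
assert (K1 : Cone - q ^ (2 * N + 1) <> Czero)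
  by (rewrite Nat.add_1_r; apply one_sub_pow_neq0, Hq).
assert (K2 : Cone - q ^ (2 * N + 2) <> Czero)
  by (rewrite Nat.add_succ_r; apply one_sub_pow_neq0, Hq).
set (k := (Cone - q ^ (2 * N + 1)) * (Cone - q ^ (2 * N + 2))).
assert (Hk : k <> Czero) by (apply Cmul_neq0; assumption).
set (F := jtp_finite_term s w N) in *.
apply HasSum_ext with (fun n => Cinv k * (
    (Cone + q ^ (2 * N + 1)) * (RtoC (IZR n) * F n)
    + (Cexp w * q ^ N) * (RtoC (IZR (n + -1)) * F (n + -1)%Z + F (n + -1)%Z)
    + (Cexp (- w) * q ^ (S N)) * (RtoC (IZR (n + 1)) * F (n + 1)%Z - F (n + 1)%Z))).
{ intros n.
  replace (RtoC (IZR (n + -1)) * F (n + -1)%Z + F (n + -1)%Z)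
    with (RtoC (IZR n) * F (n + -1)%Z) by (rewrite plus_IZR; cx).
  replace (RtoC (IZR (n + 1)) * F (n + 1)%Z - F (n + 1)%Z)
    with (RtoC (IZR n) * F (n + 1)%Z) by (rewrite plus_IZR; cx).
  transitivity (RtoC (IZR n) * (Cinv k * ((Cone + q ^ (2 * N + 1)) * F n
    + (Cexp w * q ^ N) * F (n - 1)%Z + (Cexp (- w) * q ^ (S N)) * F (n + 1)%Z))).
  { replace (n + -1)%Z with (n - 1)%Z by lia; ring. }
  unfold F, q; rewrite <- jtp_finite_term_rec by assumption; fold q; fold k; field; assumption. }
apply HasSum_div; repeat apply HasSum_add; apply HasSum_scal.
- assumption.
- apply HasSum_add.
  + apply (HasSum_shift (fun n => RtoC (IZR n) * F n)); assumption.
  + apply HasSum_shift; assumption.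
- apply HasSum_sub.
  + apply (HasSum_shift (fun n => RtoC (IZR n) * F n)); assumption.
  + apply HasSum_shift; assumption.
Qed.

Lemma Re_jtp_exponent (s w : Cx) (n : Z) :
  Re (jtp_exponent s w n) = (IZR n * (IZR n - 1) / 2 * Re s + IZR n * Re w)%R.
Proof. unfold jtp_exponent; simpl; rewrite mult_IZR, minus_IZR; field. Qed.

Lemma Summable_jtp (s w : Cx) (c : Z -> Cx) (D : R) : (Re s < 0)%R -> (0 <= D)%R ->
  (forall n, Cnorm (c n) <= D * (1 + IZR n * IZR n))%R ->
  Summable (fun n => c n * Cexp (jtp_exponent s w n)).
Proof.
intros Hs HD Hc.
apply (Summable_gauss _ (- Re s / 2) (- Re s / 2 + Rabs (Re w)) D); [lra|assumption|].
intros n; rewrite Cnorm_mul, Cnorm_exp.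
apply Rmult_le_compat; [apply Cnorm_pos|left; apply exp_pos|apply Hc|].
apply exp_le_compat; rewrite Re_jtp_exponent.
pose proof (Rle_abs (IZR n * Re w)) as H1; rewrite Rabs_mult in H1.
pose proof (Rle_abs (IZR n)) as H2; nra.
Qed.

(** Both [inv_euler] factors are bounded uniformly in [N] and [n], and each tends to 1 / (q;q)_oo;
    hence the square in the limit. *)
Lemma jtp_dominated (s w : Cx) (c : Z -> Cx) (L : Cx) (D : nat -> Cx) : (Re s < 0)%R ->
  (forall n, Cnorm (c n) <= 1 * (1 + IZR n * IZR n))%R ->
  HasSum (fun n => c n * Cexp (jtp_exponent s w n)) L ->
  (forall N, HasSum (fun n => c n * jtp_finite_term s w N n) (D N)) ->
  Ccv D (L / (euler (Cexp s) * euler (Cexp s))).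
Proof.
intros Hs Hc HL HD; pose proof (Cnorm_exp_lt1 s Hs) as Hq; set (q := Cexp s) in *.
pose proof (euler_neq0 q Hq) as Hn.
destruct (Summable_jtp s w c 1 Hs Rle_0_1 Hc) as [M HM].
set (B := exp (/ (1 - Cnorm q) ^ 2)).
assert (HB : (0 < B)%R) by apply exp_pos.
apply (HasSum_dominated (fun N n => c n * jtp_finite_term s w N n)
  (fun n => Cinv (euler q * euler q) * (c n * Cexp (jtp_exponent s w n)))
  (fun n => B * B * Cnorm (c n * Cexp (jtp_exponent s w n)))%R (B * B * M) 0 D).
- intros N n _; unfold jtp_finite_term; fold q.
  replace (c n * (Cexp (jtp_exponent s w n) *
      (inv_euler q (Z.of_nat N + n) * inv_euler q (Z.of_nat N - n))))
    with (inv_euler q (Z.of_nat N + n) * inv_euler q (Z.of_nat N - n)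
      * (c n * Cexp (jtp_exponent s w n))) by ring.
  rewrite (Cnorm_mul (_ * _) (c n * _)), (Cnorm_mul (inv_euler _ _)).
  apply Rmult_le_compat_r; [apply Cnorm_pos|].
  apply Rmult_le_compat; try apply Cnorm_pos; apply inv_euler_le, Hq.
- intros G NG; rewrite rsum_scal; apply Rmult_le_compat_l; [nra|auto].
- intros n; unfold jtp_finite_term; fold q.
  replace (Cinv (euler q * euler q) * (c n * Cexp (jtp_exponent s w n)))
    with (c n * (Cexp (jtp_exponent s w n) * (Cinv (euler q) * Cinv (euler q))))
    by (field; assumption).
  apply Ccv_scal, Ccv_scal, Ccv_mul; apply inv_euler_cv; try assumption; intros K;
    exists (K + Z.abs_nat n)%nat; intros; lia.
- intros N _; apply HD.
- apply HasSum_div, HL.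
Qed.

(** Kept as a limit of partial products, because later arguments regroup the finite products of two
    thetas before passing to the limit. *)
Lemma jacobi_triple_product (s w : Cx) (L : Cx) : (Re s < 0)%R ->
  HasSum (fun n => Cexp (jtp_exponent s w n)) L ->
  Ccv (jtp_partial s w) (L / euler (Cexp s)).
Proof.
intros Hs HL; pose proof (Cnorm_exp_lt1 s Hs) as Hq.
pose proof (euler_neq0 _ Hq) as Hn.
pose proof (euler_cv _ Hq) as He.
apply Ccv_subseq with (f := fun N => (2 * N)%nat) in He; [|intros; lia].
assert (H : Ccv (fun N => jtp_partial s w N / euler_partial (Cexp s) (2 * N))
   (L / (euler (Cexp s) * euler (Cexp s)))).
{ apply (jtp_dominated s w (fun _ => Cone)); [assumption| | |].
  - intros n; rewrite Cnorm_Cone; nra.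
  - apply HasSum_ext with (2 := HL); intros; ring.
  - intros N; apply HasSum_ext with (2 := jtp_finite s w N Hs); intros; ring. }
replace (L / euler (Cexp s)) with (L / (euler (Cexp s) * euler (Cexp s)) * euler (Cexp s))
  by (field; assumption).
eapply Ccv_ext; [|apply (Ccv_mul _ _ _ _ H He)].
intros N; simpl; field; apply euler_partial_neq0, Hq.
Qed.

(** * Jacobi's identity for the cube of the Euler product *)

Lemma Cexp_iPI : Cexp (mkC 0 PI) = - Cone.
Proof. apply Cx_eq; simpl; rewrite exp_0, ?cos_PI, ?sin_PI; ring. Qed.

Lemma Cexp_opp_iPI : Cexp (- mkC 0 PI) = - Cone.
Proof. rewrite Cexp_opp, Cexp_iPI; apply Cx_eq; simpl; field. Qed.

Lemma jtp_partial_iPI (s : Cx) (N : nat) : jtp_partial s (mkC 0 PI) (S N) = Czero.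
Proof.
unfold jtp_partial; induction N; cbn [Cprod].
- rewrite Cexp_iPI; simpl; ring.
- cbn [Cprod] in IHN; rewrite IHN; ring.
Qed.

(** At z = -1 the factor 1 + z vanishes, so the product rule leaves only its derivative -1 times the
    remaining factors, (q;q)_N (q;q)_(N+1). The index is [S N] because the vanishing factor enters
    at the first step. *)
Lemma jtp_finite_deriv (s : Cx) (N : nat) : (Re s < 0)%R ->
  HasSum (fun n => RtoC (IZR n) * jtp_finite_term s (mkC 0 PI) (S N) n)
    (- (euler_partial (Cexp s) N * euler_partial (Cexp s) (S N)
        / euler_partial (Cexp s) (2 * S N))).
Proof.
intros Hs; pose proof (Cnorm_exp_lt1 s Hs) as Hq; set (q := Cexp s) in *.
assert (H1 : forall n, Cone - q ^ S n <> Czero) by (intros; apply one_sub_pow_neq0, Hq).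
assert (H2 : forall n, euler_partial q n <> Czero) by (intros; apply euler_partial_neq0, Hq).
induction N.
- pose proof (jtp_finite_deriv_step s (mkC 0 PI) Czero 0 Hs
    (jtp_finite_term_0 s (mkC 0 PI) (fun n => RtoC (IZR n)))) as H.
  cbv zeta in H; fold q in H; rewrite Cexp_iPI, Cexp_opp_iPI in H.
  replace (- _) with ((((Cone + q ^ (2 * 0 + 1)) * Czero
     + - Cone * q ^ 0 * (Czero + jtp_partial s (mkC 0 PI) 0 / euler_partial q (2 * 0)) +
     - Cone * q ^ 1 * (Czero - jtp_partial s (mkC 0 PI) 0 / euler_partial q (2 * 0))) /
    ((Cone - q ^ (2 * 0 + 1)) * (Cone - q ^ (2 * 0 + 2))))); [exact H|].
  pose proof (H1 0%nat) as A; pose proof (H1 1%nat) as B; simpl in A, B.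
  unfold jtp_partial, euler_partial; simpl; field.
  repeat split; try apply Cone_neq_Czero; intros E;
   first [apply A; rewrite <- E; ring|apply B; rewrite <- E; ring].
- pose proof (jtp_finite_deriv_step s (mkC 0 PI) _ (S N) Hs IHN) as H.
  cbv zeta in H; fold q in H; rewrite Cexp_iPI, Cexp_opp_iPI, jtp_partial_iPI in H.
  eapply eq_rect; [exact H|].
  rewrite (euler_partial_double q (S N)).
  change (euler_partial q (S (S N))) with (euler_partial q (S N) * (Cone - q ^ S (S N))).
  replace (euler_partial q (S N) * (euler_partial q (S N) * (Cone - q ^ S (S N))))
    with (euler_partial q N * (Cone - q ^ S N) * (euler_partial q (S N) * (Cone - q ^ S (S N))))
    by reflexivity.
  pose proof (H1 (2 * S N)%nat) as A; pose proof (H1 (S (2 * S N))) as B.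
  pose proof (H2 (2 * S N)%nat) as C.
  replace (S (2 * S N)) with (2 * S N + 1)%nat in A by lia.
  replace (S (S (2 * S N))) with (2 * S N + 2)%nat in B by lia.
  set (D := Cone - q ^ (2 * S N + 1)) in *; set (D' := Cone - q ^ (2 * S N + 2)) in *.
  replace (Cone + q ^ (2 * S N + 1)) with (Cone + q ^ S N * q ^ S (S N))
    by (rewrite <- Cpow_add; do 2 f_equal; lia).
  set (E := euler_partial q (2 * S N)) in *.
  set (x := q ^ S N); set (y := q ^ S (S N)).
  field; repeat split; assumption.
Qed.

Lemma Ccv_shift (u : nat -> Cx) (l : Cx) : Ccv u l -> Ccv (fun n => u (S n)) l.
Proof. apply (Ccv_subseq u l S); intros; lia. Qed.

Lemma Ccv_unshift (u : nat -> Cx) (l : Cx) : Ccv (fun n => u (S n)) l -> Ccv u l.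
Proof.
intros H e He; destruct (H e He) as [N HN]; exists (S N); intros [|n] Hn; [lia|].
apply HN; lia.
Qed.

(** Jacobi's series in an unsymmetric form, with weight [n] and sum over all of [Z]. Combined with
    [jtp_iPI] it yields the usual odd weights. *)
Lemma jacobi_cube (s : Cx) : (Re s < 0)%R ->
  HasSum (fun n => RtoC (IZR n) * Cexp (jtp_exponent s (mkC 0 PI) n)) (- (euler (Cexp s) ^ 3)).
Proof.
intros Hs; pose proof (Cnorm_exp_lt1 s Hs) as Hq.
pose proof (euler_neq0 _ Hq) as Hn.
assert (Hc : forall n : Z, (Cnorm (RtoC (IZR n)) <= 1 * (1 + IZR n * IZR n))%R).
{ intros n; rewrite Cnorm_RtoC; apply Rabs_le; nra. }
destruct (Summable_HasSum _ (Summable_jtp s (mkC 0 PI) (fun n => RtoC (IZR n)) 1 Hs Rle_0_1 Hc)) as [L HL].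
set (D := fun N => match N with O => Czero | S N =>
  - (euler_partial (Cexp s) N * euler_partial (Cexp s) (S N)
        / euler_partial (Cexp s) (2 * S N)) end).
assert (H : Ccv D (L / (euler (Cexp s) * euler (Cexp s)))).
{ apply (jtp_dominated s (mkC 0 PI) (fun n => RtoC (IZR n))); try assumption.
  intros [|N]; [apply jtp_finite_term_0|apply jtp_finite_deriv, Hs]. }
assert (H' : Ccv D (- (euler (Cexp s) * euler (Cexp s) / euler (Cexp s)))).
{ apply Ccv_unshift; pose proof (euler_cv _ Hq) as He.
  apply Ccv_opp, Ccv_div; [assumption| |].
  - apply Ccv_mul; [assumption|apply Ccv_shift; assumption].
  - apply (Ccv_subseq _ _ (fun N => 2 * S N)%nat); [intros; lia|assumption]. }
replace (- (euler (Cexp s) ^ 3)) with L; [assumption|].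
replace L with (L / (euler (Cexp s) * euler (Cexp s)) * (euler (Cexp s) * euler (Cexp s)))
  by (field; assumption).
rewrite (Ccv_unique _ _ _ H H'); field; assumption.
Qed.

Lemma jtp_iPI (s : Cx) : (Re s < 0)%R ->
  HasSum (fun n => Cexp (jtp_exponent s (mkC 0 PI) n)) Czero.
Proof.
intros Hs; pose proof (Cnorm_exp_lt1 s Hs) as Hq; pose proof (euler_neq0 _ Hq) as Hn.
assert (Hc : forall n : Z, (Cnorm Cone <= 1 * (1 + IZR n * IZR n))%R).
{ intros n; rewrite Cnorm_Cone; nra. }
destruct (Summable_HasSum _ (Summable_jtp s (mkC 0 PI) (fun n => Cone) 1 Hs Rle_0_1 Hc)) as [L HL].
assert (HL' : HasSum (fun n => Cexp (jtp_exponent s (mkC 0 PI) n)) L).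
{ apply HasSum_ext with (2 := HL); intros; ring. }
pose proof (jacobi_triple_product s (mkC 0 PI) L Hs HL') as H.
assert (H0 : Ccv (jtp_partial s (mkC 0 PI)) Czero).
{ apply Ccv_unshift; apply Ccv_ext with (fun _ => Czero); [|apply Ccv_const].
  intros; symmetry; apply jtp_partial_iPI. }
replace Czero with L; [assumption|].
replace L with (L / euler (Cexp s) * euler (Cexp s)) by (field; assumption).
rewrite (Ccv_unique _ _ _ H H0); ring.
Qed.

Local Notation iPI := (mkC 0 PI).

Lemma Cexp_even_iPI (k : Z) : Cexp (RtoC (IZR (2 * k)) * iPI) = Cone.
Proof.
rewrite <- (Cexp_2PI_Z k); f_equal; rewrite mult_IZR; unfold twopii; cx.
Qed.

Lemma Cexp_odd_iPI (k : Z) : Cexp (RtoC (IZR (2 * k + 1)) * iPI) = - Cone.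
Proof.
rewrite plus_IZR.
replace (RtoC (IZR (2 * k) + 1) * iPI) with (RtoC (IZR (2 * k)) * iPI + iPI) by cx.
rewrite Cexp_add, Cexp_even_iPI, Cexp_iPI; ring.
Qed.

(** * The theta series modulo 10 *)

(* The two series of Rogers and Ramanujan at [q^5], up to a power of [q], are the cases [c = 1] and [c = 3]. *)
Definition quintic_term (c : Z) (s : Cx) (m : Z) : Cx :=
  Cexp (RtoC (IZR (10 * m + c) ^ 2 / 8) * s + RtoC (IZR m) * iPI).

Definition quintic (c : Z) (s : Cx) : Cx := tsum (quintic_term c s).

(** Eight times the derivative of [quintic c] in [s]; leaving out 1/8 keeps the weights integral. *)
Definition quintic_d (c : Z) (s : Cx) : Cx :=
  tsum (fun m => RtoC (IZR (10 * m + c) ^ 2) * quintic_term c s m).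

Lemma Cnorm_quintic_term (c : Z) (s : Cx) (m : Z) :
  Cnorm (quintic_term c s m) = exp (IZR (10 * m + c) ^ 2 / 8 * Re s).
Proof. unfold quintic_term; rewrite Cnorm_exp; f_equal; simpl; ring. Qed.

Lemma quintic_weight_le (c m : Z) :
  (IZR (10 * m + c) ^ 2 <= (200 + 2 * IZR c ^ 2) * (1 + IZR m * IZR m))%R.
Proof.
rewrite plus_IZR, mult_IZR.
pose proof (pow2_ge_0 (10 * IZR m - IZR c)); pose proof (pow2_ge_0 (IZR c * IZR m)); nra.
Qed.

Lemma quintic_exponent_le (c m : Z) (x : R) : (x <= 0)%R ->
  (IZR (10 * m + c) ^ 2 / 8 * x
   <= - (- x * 100 / 8) * (IZR m * IZR m) + (- x * 20 * Rabs (IZR c) / 8) * Rabs (IZR m))%R.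
Proof.
intros Hx; rewrite plus_IZR, mult_IZR.
pose proof (Rle_abs (- (IZR c * IZR m))) as H; rewrite Rabs_Ropp, Rabs_mult in H.
pose proof (pow2_ge_0 (IZR c)); nra.
Qed.

Lemma Summable_quintic (c : Z) (s : Cx) (w : Z -> Cx) (D : R) : (Re s < 0)%R -> (0 <= D)%R ->
  (forall m, Cnorm (w m) <= D * (1 + IZR m * IZR m))%R ->
  Summable (fun m => w m * quintic_term c s m).
Proof.
intros Hs HD Hw.
apply (Summable_gauss _ (- Re s * 100 / 8) (- Re s * 20 * Rabs (IZR c) / 8) D); [lra|assumption|].
intros m; rewrite Cnorm_mul, Cnorm_quintic_term.
apply Rmult_le_compat; [apply Cnorm_pos|left; apply exp_pos|apply Hw|].
apply exp_le_compat, quintic_exponent_le; lra.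
Qed.

Lemma Summable_ext {I} (f g : I -> Cx) : (forall i, f i = g i) -> Summable f -> Summable g.
Proof.
intros H [M HM]; exists M; intros G NG.
eapply Rle_trans; [apply rsum_le; intros i; rewrite <- H; apply Rle_refl|apply HM, NG].
Qed.

Lemma Summable_quintic_0 (c : Z) (s : Cx) : (Re s < 0)%R -> Summable (quintic_term c s).
Proof.
intros Hs; apply Summable_ext with (fun m => Cone * quintic_term c s m); [intros; ring|].
apply (Summable_quintic c s _ 1); [assumption|lra|].
intros m; rewrite Cnorm_Cone; nra.
Qed.

Lemma Summable_quintic_d (c : Z) (s : Cx) : (Re s < 0)%R ->
  Summable (fun m => RtoC (IZR (10 * m + c) ^ 2) * quintic_term c s m).
Proof.
intros Hs; apply (Summable_quintic c s _ (200 + 2 * IZR c ^ 2)); [assumption|nra|].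
intros m; rewrite Cnorm_RtoC, Rabs_pos_eq by apply pow2_ge_0; apply quintic_weight_le.
Qed.

Lemma HasSum_quintic (c : Z) (s : Cx) : (Re s < 0)%R ->
  HasSum (quintic_term c s) (quintic c s).
Proof. intros Hs; apply HasSum_tsum, Summable_quintic_0, Hs. Qed.

Lemma HasSum_quintic_d (c : Z) (s : Cx) : (Re s < 0)%R ->
  HasSum (fun m => RtoC (IZR (10 * m + c) ^ 2) * quintic_term c s m) (quintic_d c s).
Proof. intros Hs; apply HasSum_tsum, Summable_quintic_d, Hs. Qed.

(** The map m -> -1 - m changes the parity of m and sends 10 m + (10 - c) to its negative in the
    class of c. Of the odd classes modulo 10 only 1 and 3 remain: 9 and 7 are their negatives, and 5
    is its own mirror image. *)
Lemma quintic_term_reflect (c : Z) (s : Cx) (m : Z) :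
  quintic_term (10 - c) s m = - quintic_term c s (- 1 - m).
Proof.
unfold quintic_term.
replace (RtoC (IZR (10 * m + (10 - c)) ^ 2 / 8) * s + RtoC (IZR m) * iPI)
  with (RtoC (IZR (10 * (-1 - m) + c) ^ 2 / 8) * s + RtoC (IZR (-1 - m)) * iPI
        + RtoC (IZR (2 * m + 1)) * iPI).
- rewrite Cexp_add, Cexp_odd_iPI; ring.
- rewrite !plus_IZR, !minus_IZR, !mult_IZR, ?plus_IZR, ?minus_IZR, ?mult_IZR.
  apply Cx_eq; simpl; field.
Qed.

Lemma quintic_reflect (c : Z) (s : Cx) : (Re s < 0)%R -> quintic (10 - c) s = - quintic c s.
Proof.
intros Hs; apply tsum_eq.
apply HasSum_ext with (fun m => - quintic_term c s (- 1 - m)).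
- intros m; symmetry; apply quintic_term_reflect.
- apply HasSum_opp.
  apply (HasSum_reindex (fun m => - 1 - m)%Z (fun m => - 1 - m)%Z); [lia|lia|].
  apply HasSum_quintic, Hs.
Qed.

Lemma quintic_d_reflect (c : Z) (s : Cx) : (Re s < 0)%R ->
  quintic_d (10 - c) s = - quintic_d c s.
Proof.
intros Hs; apply tsum_eq.
apply HasSum_ext with
  (fun m => - (RtoC (IZR (10 * (- 1 - m) + c) ^ 2) * quintic_term c s (- 1 - m))).
- intros m; rewrite quintic_term_reflect.
  replace (IZR (10 * m + (10 - c)) ^ 2)%R with (IZR (10 * (-1 - m) + c) ^ 2)%R; [ring|].
  rewrite !plus_IZR, !mult_IZR, !minus_IZR; ring.
- apply HasSum_opp.
  apply (HasSum_reindex (fun m => - 1 - m)%Z (fun m => - 1 - m)%Z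
    (fun m => RtoC (IZR (10 * m + c) ^ 2) * quintic_term c s m)); [lia|lia|].
  apply HasSum_quintic_d, Hs.
Qed.

Lemma quintic_5 (s : Cx) : (Re s < 0)%R -> quintic 5 s = Czero.
Proof.
intros Hs; apply (HasSum_antisym (quintic_term 5 s) _ (fun m => - 1 - m)%Z).
- intros; lia.
- intros n; change 5%Z with (10 - 5)%Z at 1; rewrite quintic_term_reflect; do 2 f_equal; lia.
- apply HasSum_quintic, Hs.
Qed.

(** The symmetric intervals in the definition of [theta] eventually contain any finite set of
    indices, so they see the unordered sum. *)
Lemma HasSum_theta_partial (e : R) (tau L : Cx) :
  HasSum (theta_term 1 e Czero tau) L -> theta 1 e Czero tau = L.
Proof.
intros H; apply Clim_eq; intros eps He; destruct (H eps He) as [F HF].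
exists (list_max (map Z.abs_nat F)); intros N HN.
unfold theta_partial.
assert (E : forall f n, Csum f n = lsum f (seq 0 n)).
{ intros f n; induction n; [reflexivity|].
  rewrite seq_S, lsum_app; simpl; rewrite IHn; ring. }
rewrite E, <- (lsum_map (fun k => Z.of_nat k - Z.of_nat N)%Z (theta_term 1 e Czero tau)).
apply HF.
- apply FinFun.Injective_map_NoDup; [intros x y; lia|apply seq_NoDup].
- intros n Hn; apply in_map_iff; exists (Z.to_nat (n + Z.of_nat N)).
  assert (Z.abs_nat n <= N)%nat.
  { pose proof (proj1 (list_max_le _ _) (le_n (list_max (map Z.abs_nat F)))) as HM.
    rewrite Forall_forall in HM; specialize (HM _ (in_map Z.abs_nat F n Hn)); lia. }
  split; [lia|apply in_seq; lia].
Qed.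

(* The five classes of [n] modulo 5 are those of [2 n + 1] modulo 10. *)
Lemma HasSum_theta_split (k : Z) (tau : Cx) : (0 < Im tau)%R ->
  let s := twopii * tau in let j := IZR (2 * k + 1) in
  HasSum (theta_term 1 (j / 5) Czero tau)
    (RtoC (2 * cos (j * PI / 10)) * quintic 1 s
     + RtoC (2 * cos (3 * j * PI / 10)) * quintic 3 s).
Proof.
intros Ht s j.
assert (Hs : (Re s < 0)%R).
{ unfold s; simpl; pose proof PI_RGT_0; nra. }
set (r := fun x => match x with cl0 => 0 | cl1 => 1 | cl2 => 2 | cl3 => 3 | cl4 => 4 end%Z).
set (om := fun c : Z => Cexp (RtoC (j * IZR c / 10) * iPI)).
set (f := theta_term 1 (j / 5) Czero tau).
assert (Hf : forall c m, f (5 * m + c)%Z = om (2 * c + 1)%Z * quintic_term (2 * c + 1) s m).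
{ intros c m; unfold f, theta_term, om, quintic_term.
  (* The phase of the theta term contains m (2k + 1) half-turns while [quintic_term] has m of them;
     the even difference 2 k m is inserted as a factor 1. *)
  match goal with |- _ = ?y => replace y with (y * Cexp (RtoC (IZR (2 * (k * m))) * iPI))
    by (rewrite Cexp_even_iPI; ring) end.
  rewrite <- !Cexp_add; f_equal; unfold j, s, twopii.
  rewrite !plus_IZR, !mult_IZR, ?plus_IZR, ?mult_IZR; apply Cx_eq; simpl; field. }
apply HasSum_ext with (fun n => f (5 * (n / 5) + n mod 5)%Z).
{ intros n; f_equal; symmetry; apply Z.div_mod; lia. }
set (g := fun p : class5 * Z => f (5 * snd p + r (fst p))%Z).
set (to := fun n : Z => ((if (n mod 5 =? 0)%Z then cl0 else if (n mod 5 =? 1)%Z then cl1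
   else if (n mod 5 =? 2)%Z then cl2 else if (n mod 5 =? 3)%Z then cl3 else cl4), (n / 5)%Z)).
assert (Hr : forall n, r (fst (to n)) = (n mod 5)%Z).
{ intros n; pose proof (Z.mod_pos_bound n 5); unfold to; simpl.
  repeat match goal with |- context [(?a =? ?b)%Z] => destruct (Z.eqb_spec a b) end; simpl; lia. }
apply HasSum_ext with (fun n => g (to n)).
{ intros n; unfold g; rewrite Hr; reflexivity. }
apply (HasSum_reindex to (fun p => 5 * snd p + r (fst p))%Z).
- intros [x m].
  assert (Hx : (0 <= r x < 5)%Z) by (destruct x; simpl; lia).
  simpl fst; simpl snd.
  assert (E1 : ((5 * m + r x) / 5 = m)%Z) by (symmetry; apply Z.div_unique with (r x); lia).
  assert (E2 : ((5 * m + r x) mod 5 = r x)%Z) by (symmetry; apply Z.mod_unique with m; lia).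
  unfold to; rewrite E1, E2; destruct x; reflexivity.
- intros n; rewrite Hr; symmetry; apply (Z.div_mod n 5); lia.
- replace (_ + _) with (om 1%Z * quintic 1 s + (om 3%Z * quintic 3 s + (om 5%Z * quintic 5 s
     + (om 7%Z * quintic 7 s + om 9%Z * quintic 9 s)))).
  + apply HasSum_class5; unfold g; simpl fst; simpl snd; simpl r;
      (eapply HasSum_ext; [intros m; symmetry; apply Hf|]); simpl (2 * _ + 1)%Z;
      apply HasSum_scal, HasSum_quintic, Hs.
  + rewrite quintic_5 by assumption.
    replace (quintic 7 s) with (- quintic 3 s) by (symmetry; apply (quintic_reflect 3 s Hs)).
    replace (quintic 9 s) with (- quintic 1 s) by (symmetry; apply (quintic_reflect 1 s Hs)).
    (* As j is odd, the phase of class 10 - c is minus the conjugate phase of class c. With the sign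
       of the reflection the two classes add up to twice a cosine. *)
    assert (Ho : forall c : R, Cexp (RtoC (j * (10 - c) / 10) * iPI)
       = - Cexp (- (RtoC (j * c / 10) * iPI))).
    { intros c.
      replace (RtoC (j * (10 - c) / 10) * iPI)
        with (RtoC j * iPI + - (RtoC (j * c / 10) * iPI)) by (apply Cx_eq; simpl; field).
      unfold j; rewrite Cexp_add, Cexp_odd_iPI; ring. }
    assert (Hcos : forall c : R, Cexp (RtoC (j * c / 10) * iPI) + Cexp (- (RtoC (j * c / 10) * iPI))
       = RtoC (2 * cos (c * j * PI / 10))).
    { intros c; replace (c * j * PI / 10)%R with (j * c / 10 * PI)%R by field.
      apply Cx_eq; simpl.
      - replace (j * c / 10 * 0 - 0 * PI)%R with 0%R by ring.
        rewrite Ropp_0, exp_0.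
        replace (j * c / 10 * PI + 0 * 0)%R with (j * c / 10 * PI)%R by ring.
        rewrite cos_neg; ring.
      - replace (j * c / 10 * 0 - 0 * PI)%R with 0%R by ring.
        rewrite Ropp_0, exp_0.
        replace (j * c / 10 * PI + 0 * 0)%R with (j * c / 10 * PI)%R by ring.
        rewrite sin_neg; ring. }
    assert (O7 : om 7%Z = - Cexp (- (RtoC (j * 3 / 10) * iPI))).
    { rewrite <- (Ho 3%R); unfold om; do 3 f_equal; lra. }
    assert (O9 : om 9%Z = - Cexp (- (RtoC (j * 1 / 10) * iPI))).
    { rewrite <- (Ho 1%R); unfold om; do 3 f_equal; lra. }
    rewrite O7, O9, <- (Hcos 3%R).
    replace (j * PI / 10)%R with (1 * j * PI / 10)%R by field.
    rewrite <- (Hcos 1%R); unfold om; ring.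
Qed.

(* [al / be] is the golden ratio. *)
Definition al : R := (2 * cos (PI / 10))%R.
Definition be : R := (2 * cos (3 * (PI / 10)))%R.

(** For x = cos(pi/5) and y = cos(2 pi/5), doubling gives y = 2 x^2 - 1 and -x = 2 y^2 - 1.
    Subtracting and dividing by x + y > 0 yields x - y = 1/2, whence (4 x - 1)^2 = 5. *)
Lemma cos_pi_5 : cos (2 * (PI / 10)) = ((1 + sqrt 5) / 4)%R /\
  cos (2 * (3 * (PI / 10))) = ((1 - sqrt 5) / 4)%R.
Proof.
set (t := (PI / 10)%R).
assert (Hx : (0 < cos (2 * t))%R).
{ apply cos_gt_0; unfold t; pose proof PI_RGT_0; lra. }
assert (Hy : (0 < cos (4 * t))%R).
{ apply cos_gt_0; unfold t; pose proof PI_RGT_0; lra. }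
replace (cos (2 * (3 * t))) with (- cos (4 * t))%R.
2: { rewrite <- Rtrigo_facts.cos_pi_minus; f_equal; unfold t; field. }
assert (E1 : cos (4 * t) = (2 * cos (2 * t) * cos (2 * t) - 1)%R).
{ replace (4 * t)%R with (2 * (2 * t))%R by ring; apply cos_2a_cos. }
assert (E2 : (- cos (2 * t) = 2 * cos (4 * t) * cos (4 * t) - 1)%R).
{ rewrite <- cos_2a_cos, <- Rtrigo_facts.cos_pi_minus; f_equal; unfold t; field. }
set (x := cos (2 * t)) in *; set (y := cos (4 * t)) in *.
assert (E3 : (x - y = / 2)%R).
{ apply (Rmult_eq_reg_l (2 * (x + y))); [|lra]; nra. }
assert (E4 : (sqrt 5 = 4 * x - 1)%R).
{ apply sqrt_lem_1; nra. }
rewrite E4; split; lra.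
Qed.

Lemma al_gt0 : (0 < al)%R.
Proof.
unfold al; apply Rmult_lt_0_compat; [lra|].
apply cos_gt_0; pose proof PI_RGT_0; lra.
Qed.

Lemma be_gt0 : (0 < be)%R.
Proof.
unfold be; apply Rmult_lt_0_compat; [lra|].
apply cos_gt_0; pose proof PI_RGT_0; lra.
Qed.

Lemma al_sq : (al * al = (5 + sqrt 5) / 2)%R.
Proof. unfold al; destruct cos_pi_5 as [H _]; rewrite cos_2a_cos in H; nra. Qed.

Lemma be_sq : (be * be = (5 - sqrt 5) / 2)%R.
Proof. unfold be; destruct cos_pi_5 as [_ H]; rewrite cos_2a_cos in H; nra. Qed.

Lemma al_be : (al * be = sqrt 5)%R.
Proof.
symmetry; apply sqrt_lem_1; [lra| |].
- left; apply Rmult_lt_0_compat; [apply al_gt0|apply be_gt0].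
- replace (al * be * (al * be))%R with (al * al * (be * be))%R by ring.
  rewrite al_sq, be_sq; pose proof (sqrt_sqrt 5); nra.
Qed.

Lemma theta_1_5 (tau : Cx) : (0 < Im tau)%R ->
  theta 1 (1 / 5) Czero tau = RtoC al * quintic 1 (twopii * tau) + RtoC be * quintic 3 (twopii * tau).
Proof.
intros H; apply HasSum_theta_partial.
pose proof (HasSum_theta_split 0 tau H) as HS; cbv zeta in HS; simpl (2 * 0 + 1)%Z in HS.
unfold al, be.
replace (PI / 10)%R with (1 * PI / 10)%R by field.
replace (3 * (1 * PI / 10))%R with (3 * 1 * PI / 10)%R by field; exact HS.
Qed.

Lemma theta_3_5 (tau : Cx) : (0 < Im tau)%R ->
  theta 1 (3 / 5) Czero tau = RtoC be * quintic 1 (twopii * tau) - RtoC al * quintic 3 (twopii * tau).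
Proof.
intros H; apply HasSum_theta_partial.
pose proof (HasSum_theta_split 1 tau H) as HS; cbv zeta in HS; simpl (2 * 1 + 1)%Z in HS.
replace (RtoC be * quintic 1 (twopii * tau) - RtoC al * quintic 3 (twopii * tau))
  with (RtoC be * quintic 1 (twopii * tau) + RtoC (- al) * quintic 3 (twopii * tau)) by cx.
unfold al, be.
replace (- (2 * cos (PI / 10)))%R with (2 * cos (3 * 3 * PI / 10))%R.
- replace (3 * (PI / 10))%R with (3 * PI / 10)%R by field; exact HS.
- replace (3 * 3 * PI / 10)%R with (PI - PI / 10)%R by field.
  rewrite Rtrigo_facts.cos_pi_minus; ring.
Qed.

Lemma Cnorm_pow_lt1 (q : Cx) (n : nat) : (Cnorm q < 1)%R -> (Cnorm (q ^ S n) < 1)%R.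
Proof.
intros H; rewrite Cnorm_pow; pose proof (Cnorm_pos q) as Hp.
simpl; assert (Cnorm q ^ n <= 1)%R by (rewrite <- (pow1 n); apply pow_incr; lra).
pose proof (pow_le _ n Hp); nra.
Qed.

(** * Product identities *)

Lemma theta_term_jtp (e : R) (tau : Cx) (n : Z) :
  let s := twopii * tau in
  theta_term 1 e Czero tau n =
  Cexp (RtoC (/ 8) * s + RtoC (e / 2) * iPI) * Cexp (jtp_exponent s (s + RtoC e * iPI) n).
Proof.
intros s; unfold theta_term, jtp_exponent, s, twopii; rewrite <- Cexp_add; f_equal.
rewrite mult_IZR, minus_IZR; apply Cx_eq; simpl; field.
Qed.

Lemma Cexp_twocos (x : R) : Cexp (RtoC x * iPI) * (Cone + Cexp (- (RtoC (2 * x) * iPI)))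
  = RtoC (2 * cos (x * PI)).
Proof.
transitivity (Cexp (RtoC x * iPI) + Cexp (- (RtoC x * iPI))).
- replace (- (RtoC (2 * x) * iPI)) with (- (RtoC x * iPI) + - (RtoC x * iPI)) by cx.
  rewrite Cexp_add, Cexp_opp; field; apply Cexp_neq0.
- apply Cx_eq; simpl;
  replace (x * 0 - 0 * PI)%R with 0%R by ring;
  replace (x * PI + 0 * 0)%R with (x * PI)%R by ring;
  rewrite Ropp_0, exp_0, ?cos_neg, ?sin_neg; ring.
Qed.

(* The linear factors of [1 - x^5], written with the fifth root of unity [- u]. *)
Lemma five_factors (u x : Cx) :
  Cone - u + u ^ 2 - u ^ 3 + u ^ 4 = Czero ->
  (Cone - u ^ 4 * x) * (Cone + u * x) * ((Cone - u ^ 2 * x) * (Cone + u ^ 3 * x)) * (Cone - x)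
  = Cone - x ^ 5.
Proof.
intros H.
assert (H4 : u ^ 4 = u ^ 3 - u ^ 2 + u - Cone).
{ replace (u ^ 4) with ((Cone - u + u ^ 2 - u ^ 3 + u ^ 4) + (u ^ 3 - u ^ 2 + u - Cone)) by ring.
  rewrite H; ring. }
ring [H4].
Qed.

Lemma fifth_root_alt : let u := Cexp (- (RtoC (1 / 5) * iPI)) in
  u ^ 5 = - Cone /\ Cone - u + u ^ 2 - u ^ 3 + u ^ 4 = Czero.
Proof.
intros u.
assert (H5 : u ^ 5 = - Cone).
{ unfold u; rewrite <- Cexp_INR_mul, <- Cexp_opp_iPI; f_equal; apply Cx_eq; simpl; field. }
split; [assumption|].
apply (Cmul_reg_l (Cone + u)).
- intros E; apply (f_equal Im) in E; unfold u in E; simpl in E.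
  replace (- (1 / 5 * 0 - 0 * PI))%R with 0%R in E by ring.
  replace (- (1 / 5 * PI + 0 * 0))%R with (- (PI / 5))%R in E by field.
  rewrite exp_0, sin_neg in E; pose proof PI_RGT_0.
  assert (0 < sin (PI / 5))%R by (apply sin_gt_0; lra); lra.
- transitivity (Cone + u ^ 5); [ring|rewrite H5; ring].
Qed.

(** The triple products of the two thetas supply linear factors in powers of q whose coefficients
    are the four non-trivial fifth roots of unity; joined with the factors of (q;q)_oo they make up
    1 - q^(5n). *)
Lemma theta_product (tau : Cx) : (0 < Im tau)%R ->
  let s := twopii * tau in
  theta 1 (1 / 5) Czero tau * theta 1 (3 / 5) Czero tau
  = RtoC (al * be) * (Cexp (RtoC (/ 4) * s) * (euler (Cexp s) * euler (Cexp s ^ 5))).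
Proof.
intros Ht s.
assert (Hs : (Re s < 0)%R).
{ unfold s; simpl; pose proof PI_RGT_0; nra. }
pose proof (Cnorm_exp_lt1 s Hs) as Hq.
set (q := Cexp s) in *.
pose proof (euler_neq0 q Hq) as Hn.
set (w := fun e : R => s + RtoC e * iPI).
set (pf := fun e : R => Cexp (RtoC (/ 8) * s + RtoC (e / 2) * iPI)).
assert (HX : forall k, let e := (IZR (2 * k + 1) / 5)%R in
  Ccv (jtp_partial s (w e)) (theta 1 e Czero tau / (pf e * euler q))).
{ intros k e.
  pose proof (HasSum_theta_split k tau Ht) as HS; cbv zeta in HS; fold e in HS.
  rewrite (HasSum_theta_partial _ _ _ HS); set (X := _ + _) in *.
  assert (Hp : pf e <> Czero) by apply Cexp_neq0.
  assert (HL : HasSum (fun n => Cexp (jtp_exponent s (w e) n)) (X / pf e)).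
  { apply HasSum_ext with (fun n => Cinv (pf e) * theta_term 1 e Czero tau n).
    - intros n; rewrite theta_term_jtp; fold s; fold (pf e); fold (w e); field; assumption.
    - apply HasSum_div, HS. }
  replace (X / (pf e * euler q)) with (X / pf e / euler q) by (field; auto).
  apply jacobi_triple_product; assumption. }
pose proof (HX 0%Z) as H1; pose proof (HX 1%Z) as H3; clear HX.
simpl (2 * _ + 1)%Z in H1, H3; cbv zeta in H1, H3.
destruct fifth_root_alt as [Hu5 Hu]; set (u := Cexp (- (RtoC (1 / 5) * iPI))) in *.
assert (E1 : Cexp (w (1 / 5)%R) = - (u ^ 4 * q) /\ Cexp (- w (1 / 5)%R) * q = u).
{ split.
  - transitivity (- Cone * (u ^ 4 * q)); [|ring].
    rewrite <- Cexp_iPI; unfold u, q; rewrite <- Cexp_INR_mul, <- !Cexp_add; f_equal.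
    unfold w; apply Cx_eq; simpl; field.
  - unfold u, q; rewrite <- !Cexp_add; f_equal; unfold w; cx. }
assert (E3 : Cexp (w (3 / 5)%R) = - (u ^ 2 * q) /\ Cexp (- w (3 / 5)%R) * q = u ^ 3).
{ split.
  - transitivity (- Cone * (u ^ 2 * q)); [|ring].
    rewrite <- Cexp_iPI; unfold u, q; rewrite <- Cexp_INR_mul, <- !Cexp_add; f_equal.
    unfold w; apply Cx_eq; simpl; field.
  - unfold u, q; rewrite <- Cexp_INR_mul, <- !Cexp_add; f_equal; unfold w; apply Cx_eq; simpl; field. }
assert (EP : forall e N, jtp_partial s (w e) N =
  Cprod (fun j => Cone + Cexp (w e) * q ^ j) N * Cprod (fun j => Cone + (Cexp (- w e) * q) * q ^ j) N).
{ intros e N; rewrite <- Cprod_mul; apply Cprod_ext; intros j; simpl; fold q; ring. }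
(* Two of the four families start at q^0 instead of q^1. Shifting them leaves (1 + u)(1 + u^3) at
   the lower end and factors tending to 1 at the upper end. *)
assert (EQ : forall N,
  jtp_partial s (w (1 / 5)%R) N * jtp_partial s (w (3 / 5)%R) N * euler_partial q N
   * ((Cone + u * q ^ N) * (Cone + u ^ 3 * q ^ N))
  = (Cone + u) * (Cone + u ^ 3) * euler_partial (q ^ 5) N).
{ intros N; rewrite !EP.
  destruct E1 as [-> ->]; destruct E3 as [-> ->].
  pose proof (Cprod_shift (fun j => Cone + u * q ^ j) N) as S1.
  pose proof (Cprod_shift (fun j => Cone + u ^ 3 * q ^ j) N) as S3.
  cbv beta in S1, S3.
  set (A1 := Cprod (fun j => Cone + u * q ^ j) N) in *.
  set (A3 := Cprod (fun j => Cone + u ^ 3 * q ^ j) N) in *.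
  set (B1 := Cprod (fun j => Cone + - (u ^ 4 * q) * q ^ j) N).
  set (B3 := Cprod (fun j => Cone + - (u ^ 2 * q) * q ^ j) N).
  transitivity (A1 * (Cone + u * q ^ N) * (A3 * (Cone + u ^ 3 * q ^ N)) * (B1 * B3 * euler_partial q N));
    [ring|rewrite S1, S3].
  change (q ^ 0) with Cone.
  transitivity ((Cone + u) * (Cone + u ^ 3) *
    (B1 * Cprod (fun n => Cone + u * q ^ S n) N * (B3 * Cprod (fun n => Cone + u ^ 3 * q ^ S n) N)
      * euler_partial q N)); [ring|f_equal].
  unfold B1, B3, euler_partial; rewrite <- !Cprod_mul; apply Cprod_ext; intros n.
  rewrite <- Cpow_mul, (Nat.mul_comm 5), Cpow_mul, <- (five_factors u (q ^ S n) Hu).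
  simpl; ring. }
pose proof (euler_cv q Hq) as He.
pose proof (euler_cv (q ^ 5) (Cnorm_pow_lt1 q 4 Hq)) as He5.
pose proof (Ccv_geometric q Hq) as Hg.
assert (HF : forall c, Ccv (fun N => Cone + c * q ^ N) Cone).
{ intros c; pose proof (Ccv_add _ _ _ _ (Ccv_const Cone) (Ccv_scal c _ _ Hg)) as H.
  replace (Cone + c * Czero) with Cone in H by ring; exact H. }
pose proof (Ccv_mul _ _ _ _ (Ccv_mul _ _ _ _ (Ccv_mul _ _ _ _ H1 H3) He)
  (Ccv_mul _ _ _ _ (HF u) (HF (u ^ 3)))) as HA.
pose proof (Ccv_scal ((Cone + u) * (Cone + u ^ 3)) _ _ He5) as HB.
apply (Ccv_ext _ _ _ EQ) in HA.
pose proof (Ccv_unique _ _ _ HA HB) as E.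
set (X := theta 1 (1 / 5) Czero tau) in *; set (Y := theta 1 (3 / 5) Czero tau) in *.
(* The half phase in [pf] symmetrizes the boundary factor 1 + u into 2 cos(pi/10); likewise 1 + u^3
   into 2 cos(3 pi/10). *)
assert (P1 : pf (1 / 5)%R * (Cone + u) = Cexp (RtoC (/ 8) * s) * RtoC al).
{ unfold pf, u; rewrite Cexp_add.
  replace (RtoC (1 / 5)) with (RtoC (2 * (1 / 5 / 2))) by (f_equal; field).
  unfold al; replace (PI / 10)%R with (1 / 5 / 2 * PI)%R by field.
  rewrite <- Cexp_twocos.
  replace (2 * (1 / 5 / 2) / 2)%R with (1 / 5 / 2)%R by field; ring. }
assert (P3 : pf (3 / 5)%R * (Cone + u ^ 3) = Cexp (RtoC (/ 8) * s) * RtoC be).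
{ unfold pf, u; rewrite Cexp_add, <- Cexp_INR_mul.
  unfold be; replace (3 * (PI / 10))%R with (3 / 5 / 2 * PI)%R by field.
  rewrite <- Cexp_twocos.
  replace (RtoC (INR 3) * - (RtoC (1 / 5) * iPI)) with (- (RtoC (2 * (3 / 5 / 2)) * iPI))
    by (apply Cx_eq; simpl; field); ring. }
assert (N1 : pf (1 / 5)%R <> Czero) by apply Cexp_neq0.
assert (N3 : pf (3 / 5)%R <> Czero) by apply Cexp_neq0.
transitivity (pf (1 / 5)%R * (Cone + u) * (pf (3 / 5)%R * (Cone + u ^ 3)) * (euler q * euler (q ^ 5))).
- transitivity (pf (1 / 5)%R * pf (3 / 5)%R * euler q * ((Cone + u) * (Cone + u ^ 3) * euler (q ^ 5)));
    [rewrite <- E; field; auto|ring].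
- rewrite P1, P3.
  replace (Cexp (RtoC (/ 4) * s)) with (Cexp (RtoC (/ 8) * s) * Cexp (RtoC (/ 8) * s)).
  + replace (RtoC (al * be)) with (RtoC al * RtoC be) by cx; ring.
  + rewrite <- Cexp_add; f_equal; apply Cx_eq; simpl; field.
Qed.

Lemma RtoC_neq0 (x : R) : x <> 0%R -> RtoC x <> Czero.
Proof. intros H E; apply H; injection E; auto. Qed.

Lemma RtoC_mul (x y : R) : RtoC (x * y) = RtoC x * RtoC y.
Proof. cx. Qed.

Lemma al_be_relations : RtoC al * RtoC al = RtoC al * RtoC be + RtoC be * RtoC be /\
  RtoC al * RtoC al + RtoC be * RtoC be = RtoC 5.
Proof.
rewrite <- !RtoC_mul; split; apply Cx_eq; simpl; rewrite ?al_sq, ?be_sq, ?al_be; field.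
Qed.

Lemma al_be_form (a b : Cx) :
  (RtoC al * a + RtoC be * b) * (RtoC be * a - RtoC al * b)
  = RtoC (al * be) * (a ^ 2 - a * b - b ^ 2).
Proof.
destruct al_be_relations as [H _]; rewrite RtoC_mul.
set (x := RtoC al) in *; set (y := RtoC be) in *.
transitivity (x * y * (a ^ 2 - b ^ 2) - (x * x - y * y) * (a * b)); [ring|rewrite H; ring].
Qed.

(** Compare the two evaluations of the theta product and cancel al be. The variable [s] stays free
    so that the identity can be used at the rotated points. *)
Lemma quintic_form (s : Cx) : (Re s < 0)%R ->
  quintic 1 s ^ 2 - quintic 1 s * quintic 3 s - quintic 3 s ^ 2
  = Cexp (RtoC (/ 4) * s) * (euler (Cexp s) * euler (Cexp s ^ 5)).
Proof.
intros Hs.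
assert (N2 : twopii <> Czero).
{ intros E; apply (f_equal Im) in E; simpl in E; pose proof PI_RGT_0; lra. }
set (tau := s / twopii).
assert (Es : s = twopii * tau) by (unfold tau; field; assumption).
clearbody tau.
assert (Ht : (0 < Im tau)%R).
{ rewrite Es in Hs; simpl in Hs; pose proof PI_RGT_0; nra. }
pose proof (theta_product tau Ht) as H; cbv zeta in H.
rewrite theta_1_5, theta_3_5, <- Es, al_be_form in H by assumption.
apply Cmul_reg_l in H; [assumption|].
apply RtoC_neq0; pose proof al_gt0; pose proof be_gt0; nra.
Qed.

(** In base q^25 the triple product gives [quintic 1] the exponents congruent to 10 and 15 modulo
    25, and [quintic 3] those congruent to 5 and 20. With the multiples of 25 these are all
    multiples of 5. *)
Lemma quintic_mul (s : Cx) : (Re s < 0)%R ->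
  quintic 1 s * quintic 3 s
  = Cexp (RtoC (5 / 4) * s) * (euler (Cexp s ^ 5) * euler (Cexp s ^ 25)).
Proof.
intros Hs; pose proof (Cnorm_exp_lt1 s Hs) as Hq; set (q := Cexp s) in *.
set (s25 := RtoC 25 * s).
assert (Hs25 : (Re s25 < 0)%R) by (unfold s25; simpl; nra).
assert (E25 : Cexp s25 = q ^ 25).
{ unfold s25; replace (RtoC 25) with (RtoC (INR 25)) by (f_equal; simpl; ring).
  apply Cexp_INR_mul. }
set (w := fun c : R => RtoC ((25 + 5 * c) / 2) * s + iPI).
assert (HA : forall c : Z, Ccv (jtp_partial s25 (w (IZR c)))
   (quintic c s / Cexp (RtoC (IZR c ^ 2 / 8) * s) / euler (q ^ 25))).
{ intros c; rewrite <- E25; apply jacobi_triple_product; [assumption|].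
  eapply HasSum_ext; [|apply HasSum_div, (HasSum_quintic c s Hs)].
  intros m; unfold quintic_term; rewrite <- Cexp_opp, <- Cexp_add; f_equal.
  unfold jtp_exponent, s25, w.
  rewrite plus_IZR, !mult_IZR, minus_IZR; apply Cx_eq; simpl; field. }
pose proof (HA 1%Z) as H1; pose proof (HA 3%Z) as H3; clear HA.
assert (HP : forall n, Cexp (RtoC (INR n * 5) * s) = (q ^ 5) ^ n).
{ intros n; unfold q; rewrite <- !Cexp_INR_mul; f_equal; apply Cx_eq; simpl; ring. }
assert (HW : forall c m n, ((25 + 5 * c) / 2 = INR m * 5)%R -> (m + n = 5)%nat ->
  Cexp (w c) = - ((q ^ 5) ^ m) /\ Cexp (- w c) * q ^ 25 = - ((q ^ 5) ^ n)).
{ intros c m n E Emn.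
  assert (Hw : Cexp (w c) = - ((q ^ 5) ^ m)).
  { unfold w; rewrite E, Cexp_add, HP, Cexp_iPI; ring. }
  split; [assumption|].
  rewrite Cexp_opp, Hw; change 25%nat with (5 * 5)%nat; 
  assert (E5 : (q ^ 5) ^ 5 = (q ^ 5) ^ m * (q ^ 5) ^ n) by (rewrite <- Cpow_add, Emn; reflexivity).
  rewrite Cpow_mul, E5.
  assert (Hm : (q ^ 5) ^ m <> Czero) by (apply Cpow_neq0, Cpow_neq0, Cexp_neq0).
  set (x := (q ^ 5) ^ m) in *; set (y := (q ^ 5) ^ n).
  apply (Cmul_reg_l x); [assumption|].
  replace (Cinv (- x)) with (- Cinv x); [field; assumption|].
  apply (Cmul_reg_l (- x)); [intros E0; apply Hm; transitivity (- - x); [ring|rewrite E0; ring]|].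
  field; split; [intros E0; apply Hm; transitivity (- - x); [ring|rewrite E0; ring]|assumption]. }
destruct (HW 1%R 3%nat 2%nat) as [W1 W1']; [simpl; field|reflexivity|].
destruct (HW 3%R 4%nat 1%nat) as [W3 W3']; [simpl; field|reflexivity|].
assert (EQ : forall N, jtp_partial s25 (w 1%R) N * jtp_partial s25 (w 3%R) N * euler_partial (q ^ 25) N
  = euler_partial (q ^ 5) (5 * N)).
{ intros N; unfold euler_partial at 2; rewrite Cprod_group5.
  unfold jtp_partial, euler_partial; rewrite <- !Cprod_mul; apply Cprod_ext; intros n.
  rewrite E25, W1, W3.
  change ((q ^ 25) ^ S n) with (q ^ 25 * (q ^ 25) ^ n).
  replace (Cexp (- w 1%R) * (q ^ 25 * (q ^ 25) ^ n)) with (- (q ^ 5) ^ 2 * (q ^ 25) ^ n)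
    by (rewrite <- W1'; ring).
  replace (Cexp (- w 3%R) * (q ^ 25 * (q ^ 25) ^ n)) with (- (q ^ 5) ^ 1 * (q ^ 25) ^ n)
    by (rewrite <- W3'; ring).
  replace ((q ^ 25) ^ n) with ((q ^ 5) ^ (5 * n)) by (rewrite <- !Cpow_mul; f_equal; lia).
  replace (q ^ 25) with ((q ^ 5) ^ 5) by (rewrite <- Cpow_mul; f_equal; lia).
  set (Q := q ^ 5); set (x := Q ^ (5 * n)).
  replace (Q ^ S (5 * n)) with (Q * x) by reflexivity.
  replace (Q ^ S (5 * n + 1)) with (Q ^ 2 * x) by (unfold x; rewrite <- Cpow_add; f_equal; lia).
  replace (Q ^ S (5 * n + 2)) with (Q ^ 3 * x) by (unfold x; rewrite <- Cpow_add; f_equal; lia).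
  replace (Q ^ S (5 * n + 3)) with (Q ^ 4 * x) by (unfold x; rewrite <- Cpow_add; f_equal; lia).
  replace (Q ^ S (5 * n + 4)) with (Q ^ 5 * x) by (unfold x; rewrite <- Cpow_add; f_equal; lia).
  ring. }
pose proof (euler_cv (q ^ 25) (Cnorm_pow_lt1 q 24 Hq)) as He25.
pose proof (euler_cv (q ^ 5) (Cnorm_pow_lt1 q 4 Hq)) as He5.
apply (Ccv_subseq _ _ (fun N => 5 * N)%nat) in He5; [|intros; lia].
pose proof (Ccv_ext _ _ _ EQ (Ccv_mul _ _ _ _ (Ccv_mul _ _ _ _ H1 H3) He25)) as HA.
pose proof (Ccv_unique _ _ _ HA He5) as E.
rewrite <- E.
replace (Cexp (RtoC (5 / 4) * s))
  with (Cexp (RtoC (1 ^ 2 / 8) * s) * Cexp (RtoC (3 ^ 2 / 8) * s))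
  by (rewrite <- Cexp_add; f_equal; apply Cx_eq; simpl; field).
field; repeat split; try apply Cexp_neq0; apply euler_neq0, (Cnorm_pow_lt1 q 24 Hq).
Qed.

(** * Rotation of q by fifth roots of unity *)

Lemma fifth_root : let z := Cexp (RtoC (2 / 5) * iPI) in
  z ^ 5 = Cone /\ Cone + z + z ^ 2 + z ^ 3 + z ^ 4 = Czero.
Proof.
intros z.
assert (H5 : z ^ 5 = Cone).
{ unfold z; rewrite <- Cexp_INR_mul, <- (Cexp_even_iPI 1); f_equal; apply Cx_eq; simpl; field. }
split; [assumption|].
apply (Cmul_reg_l (Cone - z)).
- intros E; apply (f_equal Im) in E; unfold z in E; simpl in E.
  replace (2 / 5 * 0 - 0 * PI)%R with 0%R in E by ring.
  replace (2 / 5 * PI + 0 * 0)%R with (2 / 5 * PI)%R in E by ring.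
  rewrite exp_0 in E; pose proof PI_RGT_0.
  assert (0 < sin (2 / 5 * PI))%R by (apply sin_gt_0; lra); lra.
- transitivity (Cone - z ^ 5); [ring|rewrite H5; ring].
Qed.

Lemma five_factors_root (z x : Cx) : Cone + z + z ^ 2 + z ^ 3 + z ^ 4 = Czero ->
  (Cone - x) * (Cone - z * x) * (Cone - z ^ 2 * x) * (Cone - z ^ 3 * x) * (Cone - z ^ 4 * x)
  = Cone - x ^ 5.
Proof.
intros H.
assert (H4 : z ^ 4 = - Cone - z - z ^ 2 - z ^ 3).
{ replace (z ^ 4) with ((Cone + z + z ^ 2 + z ^ 3 + z ^ 4) + (- Cone - z - z ^ 2 - z ^ 3)) by ring.
  rewrite H; ring. }
ring [H4].
Qed.

(** For n prime to 5 the five rotated factors multiply to 1 - q^(5n); for n divisible by 5 they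
    coincide and give (1 - q^n)^5. The first kind contributes eta_5 / eta_25, the second eta_5^5. *)
Lemma euler_rotations (q z : Cx) : (Cnorm q < 1)%R -> Cnorm z = 1%R -> z ^ 5 = Cone ->
  Cone + z + z ^ 2 + z ^ 3 + z ^ 4 = Czero ->
  euler q * euler (z * q) * euler (z ^ 2 * q) * euler (z ^ 3 * q) * euler (z ^ 4 * q)
    * euler (q ^ 25) = euler (q ^ 5) ^ 6.
Proof.
intros Hq Hz Z5 HZ.
assert (HN : forall k, (Cnorm (z ^ k * q)%Cx < 1)%R).
{ intros k; rewrite Cnorm_mul, Cnorm_pow, Hz, pow1; lra. }
assert (HC : forall k, Ccv (fun N => euler_partial (z ^ k * q) (5 * N)) (euler (z ^ k * q))).
{ intros k; apply (Ccv_subseq _ _ (fun N => 5 * N)%nat); [intros; lia|apply euler_cv, HN]. }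
pose proof (HC 0%nat) as C0; pose proof (HC 1%nat) as C1; pose proof (HC 2%nat) as C2;
pose proof (HC 3%nat) as C3; pose proof (HC 4%nat) as C4.
replace (z ^ 0 * q) with q in C0 by (simpl; ring).
replace (z ^ 1 * q) with (z * q) in C1 by (simpl; ring).
pose proof (euler_cv (q ^ 25) (Cnorm_pow_lt1 q 24 Hq)) as C25.
pose proof (euler_cv (q ^ 5) (Cnorm_pow_lt1 q 4 Hq)) as C5.
pose proof (Ccv_subseq (euler_partial (q ^ 5)) _ (fun N => 5 * N)%nat ltac:(intros; cbv beta; lia) C5) as C5'.
pose proof (Ccv_mul _ _ _ _ (Ccv_mul _ _ _ _ (Ccv_mul _ _ _ _ (Ccv_mul _ _ _ _
  (Ccv_mul _ _ _ _ C0 C1) C2) C3) C4) C25) as HA.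
pose proof (Ccv_mul _ _ _ _ C5' (Ccv_pow 5 _ _ C5)) as HB.
change (euler (q ^ 5) ^ 6) with (euler (q ^ 5) * euler (q ^ 5) ^ 5).
apply (fun H => Ccv_unique _ _ _ (Ccv_ext _ _ _ H HA) HB); intros N.
unfold euler_partial; rewrite !Cprod_group5.
assert (EP : forall f n, Cprod f n ^ 5 = Cprod (fun j => f j ^ 5) n).
{ intros f n; induction n; simpl; [ring|]; simpl in IHn; rewrite <- IHn; ring. }
rewrite EP, <- !Cprod_mul; apply Cprod_ext; intros n.
assert (ZP : forall k r, (z ^ k) ^ (5 * n + r) = (z ^ r) ^ k).
{ intros k r; rewrite <- !Cpow_mul.
  replace (k * (5 * n + r))%nat with (5 * (k * n) + r * k)%nat by ring.
  rewrite Cpow_add, Cpow_mul, Z5.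
  replace (Cone ^ (k * n)) with Cone; [ring|].
  induction (k * n)%nat as [|m IH]; simpl; [reflexivity|rewrite <- IH; ring]. }
assert (ZR : forall r, (r = 1 \/ r = 2 \/ r = 3 \/ r = 4)%nat ->
   Cone + z ^ r + (z ^ r) ^ 2 + (z ^ r) ^ 3 + (z ^ r) ^ 4 = Czero).
{ assert (Z5' : z ^ 5 = Cone) by exact Z5.
  intros r [->|[->|[->| ->]]]; rewrite <- HZ; ring [Z5']. }
assert (HR : forall r, (r = 1 \/ r = 2 \/ r = 3 \/ r = 4)%nat ->
   (Cone - q ^ (5 * n + r)) * (Cone - (z * q) ^ (5 * n + r)) * (Cone - (z ^ 2 * q) ^ (5 * n + r))
   * (Cone - (z ^ 3 * q) ^ (5 * n + r)) * (Cone - (z ^ 4 * q) ^ (5 * n + r))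
   = Cone - (q ^ 5) ^ (5 * n + r)).
{ intros r Hr; rewrite !Cpow_mul_base, !ZP.
  replace (z ^ (5 * n + r)) with (z ^ r).
  - rewrite five_factors_root by (apply ZR, Hr).
    rewrite <- !Cpow_mul; do 2 f_equal; lia.
  - rewrite Cpow_add, Cpow_mul, Z5.
    replace (Cone ^ n) with Cone; [ring|].
    clear; induction n; simpl; [reflexivity|rewrite <- IHn; ring]. }
pose proof (HR 1%nat ltac:(auto)) as R1; pose proof (HR 2%nat ltac:(auto)) as R2.
pose proof (HR 3%nat ltac:(auto)) as R3; pose proof (HR 4%nat ltac:(auto)) as R4.
assert (H5 : forall k, (z ^ k * q) ^ (5 * n + 5) = q ^ (5 * n + 5)).
{ intros k; rewrite Cpow_mul_base, ZP, Z5.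
  replace (Cone ^ k) with Cone; [ring|].
  clear; induction k; simpl; [reflexivity|rewrite <- IHk; ring]. }
pose proof (H5 1%nat) as F1; replace (z ^ 1) with z in F1 by (simpl; ring).
replace (S (5 * n)) with (5 * n + 1)%nat by lia.
replace (S (5 * n + 1)) with (5 * n + 2)%nat by lia.
replace (S (5 * n + 2)) with (5 * n + 3)%nat by lia.
replace (S (5 * n + 3)) with (5 * n + 4)%nat by lia.
replace (S (5 * n + 4)) with (5 * n + 5)%nat by lia.
rewrite <- R1, <- R2, <- R3, <- R4, F1, !H5.
replace ((q ^ 25) ^ S n) with ((q ^ 5) ^ (5 * n + 5)) by (rewrite <- !Cpow_mul; f_equal; lia).
replace ((q ^ 5) ^ S n) with (q ^ (5 * n + 5)) by (rewrite <- !Cpow_mul; f_equal; lia).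
repeat match goal with |- context [Cone - ?x] =>
  let v := fresh in set (v := Cone - x); clearbody v end.
ring.
Qed.

(** For odd d, (10 m + d)^2 / 20 = (5 m^2 + m d) + d^2 / 20 with 5 m^2 + m d even, so the phase
    picked up by a term does not depend on m. *)
Lemma quintic_rotate (s : Cx) (c : Z) (k : nat) : (Re s < 0)%R ->
  quintic (2 * c + 1) (s + RtoC (INR k * (2 / 5)) * iPI)
  = Cexp (RtoC (INR k * IZR (2 * c + 1) ^ 2 / 20) * iPI) * quintic (2 * c + 1) s.
Proof.
intros Hs; apply tsum_eq.
eapply HasSum_ext; [|apply HasSum_scal, (HasSum_quintic (2 * c + 1) s Hs)].
intros m; cbv beta; unfold quintic_term.
assert (Hm : exists t, (m * m + m = 2 * t)%Z).
{ destruct (Z.Even_or_Odd m) as [[x ->]|[x ->]];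
    [exists (2 * x * x + x)%Z|exists (2 * x * x + 3 * x + 1)%Z]; ring. }
destruct Hm as [t Hm]; apply (f_equal IZR) in Hm; rewrite plus_IZR, !mult_IZR in Hm.
match goal with |- ?y = _ => replace y with
  (y * Cexp (RtoC (IZR (2 * (Z.of_nat k * (2 * m * m + c * m + t)))) * iPI))
  by (rewrite Cexp_even_iPI; ring) end.
rewrite <- !Cexp_add; f_equal; rewrite INR_IZR_INZ.
rewrite ?plus_IZR, ?mult_IZR, ?plus_IZR, ?mult_IZR, ?plus_IZR, ?mult_IZR.
replace (IZR t) with ((IZR m * IZR m + IZR m) / 2)%R by lra.
apply Cx_eq; simpl; field.
Qed.

(** With g = e^(i pi k/20), rotation multiplies a, b and q^(1/4) by g, g^9 and g^2. Division by g^2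
    leaves only powers of g^8 = z^k. *)
Lemma quintic_form_rotate (s : Cx) (k : nat) : (Re s < 0)%R ->
  let z := Cexp (RtoC (2 / 5) * iPI) in let a := quintic 1 s in let b := quintic 3 s in
  a ^ 2 - z ^ k * a * b - (z ^ k) ^ 2 * b ^ 2
  = Cexp (RtoC (/ 4) * s) * (euler (z ^ k * Cexp s) * euler (Cexp s ^ 5)).
Proof.
intros Hs z a b.
set (sk := s + RtoC (INR k * (2 / 5)) * iPI).
assert (Hsk : (Re sk < 0)%R) by (unfold sk; simpl; lra).
pose proof (quintic_form sk Hsk) as H.
set (g := Cexp (RtoC (INR k / 20) * iPI)).
assert (Hg : forall n x, x = (INR n * (INR k / 20))%R -> Cexp (RtoC x * iPI) = g ^ n).
{ intros n x ->; unfold g; rewrite <- Cexp_INR_mul; f_equal; apply Cx_eq; simpl; ring. }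
assert (E1 : quintic 1 sk = g * a).
{ unfold sk; pose proof (quintic_rotate s 0 k Hs) as E; simpl (2 * 0 + 1)%Z in E.
  rewrite E, (Hg 1%nat) by (simpl; field); unfold a; simpl; ring. }
assert (E3 : quintic 3 sk = g ^ 9 * b).
{ unfold sk; pose proof (quintic_rotate s 1 k Hs) as E; simpl (2 * 1 + 1)%Z in E.
  rewrite E, (Hg 9%nat) by (simpl; field); unfold b; reflexivity. }
assert (Ez : z ^ k = g ^ 8).
{ unfold z, g; rewrite <- !Cexp_INR_mul; f_equal; apply Cx_eq; simpl; field. }
assert (Eq : Cexp sk = z ^ k * Cexp s).
{ unfold sk, z; rewrite Cexp_add, <- Cexp_INR_mul, (Cmul_comm (Cexp s)); f_equal.
  f_equal; apply Cx_eq; simpl; ring. }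
assert (E4 : Cexp (RtoC (/ 4) * sk) = g ^ 2 * Cexp (RtoC (/ 4) * s)).
{ unfold g; rewrite <- Cexp_INR_mul, <- Cexp_add; f_equal; unfold sk; apply Cx_eq; simpl; field. }
rewrite E1, E3, Eq, E4 in H.
apply (Cmul_reg_l (g ^ 2)); [apply Cpow_neq0, Cexp_neq0|].
replace ((z ^ k * Cexp s) ^ 5) with (Cexp s ^ 5) in H.
- transitivity ((g * a) ^ 2 - g * a * (g ^ 9 * b) - (g ^ 9 * b) ^ 2); [rewrite Ez; ring|].
  rewrite H; ring.
- rewrite Cpow_mul_base, <- Cpow_mul, Nat.mul_comm, Cpow_mul.
  unfold z; destruct fifth_root as [H5 _]; cbv zeta in H5; rewrite H5.
  replace (Cone ^ k) with Cone; [ring|].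
  clear; induction k; simpl; [reflexivity|rewrite <- IHk; ring].
Qed.

(** Origin of the 11: with p the golden ratio, a^2 - w a b - w^2 b^2 = (a - p w b)(a + w b / p), so
    the product over fifth roots of unity w is (a^5 - p^5 b^5)(a^5 + b^5 / p^5), and p^5 - p^(-5) =
    11. *)
Lemma quintic_degree_10 (s : Cx) : (Re s < 0)%R ->
  let a := quintic 1 s in let b := quintic 3 s in
  (a ^ 10 - 11 * a ^ 5 * b ^ 5 - b ^ 10) * euler (Cexp s ^ 25)
  = Cexp (RtoC (5 / 4) * s) * euler (Cexp s ^ 5) ^ 11.
Proof.
intros Hs a b; pose proof (Cnorm_exp_lt1 s Hs) as Hq.
pose proof (fun k => quintic_form_rotate s k Hs) as H; cbv zeta in H; fold a b in H.
destruct fifth_root as [Z5 HZ].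
set (z := Cexp (RtoC (2 / 5) * iPI)) in *; set (q := Cexp s) in *.
assert (Hz : Cnorm z = 1%R).
{ unfold z; rewrite Cnorm_exp, <- exp_0; f_equal; simpl; ring. }
pose proof (euler_rotations q z Hq Hz Z5 HZ) as HR.
pose proof (H 0%nat) as H0; pose proof (H 1%nat) as H1; pose proof (H 2%nat) as H2;
pose proof (H 3%nat) as H3; pose proof (H 4%nat) as H4; clear H.
replace (z ^ 0 * q) with q in H0 by (simpl; ring).
replace (z ^ 1 * q) with (z * q) in H1 by (simpl; ring).
set (e := Cexp (RtoC (/ 4) * s)) in *.
assert (E : Cexp (RtoC (5 / 4) * s) = e ^ 5).
{ unfold e; rewrite <- Cexp_INR_mul; f_equal; apply Cx_eq; simpl; field. }
rewrite E.
transitivity (e ^ 5 * (euler q * euler (z * q) * euler (z ^ 2 * q) * euler (z ^ 3 * q)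
   * euler (z ^ 4 * q) * euler (q ^ 25)) * euler (q ^ 5) ^ 5); [|rewrite HR; ring].
transitivity (e * (euler q * euler (q ^ 5)) * (e * (euler (z * q) * euler (q ^ 5)))
  * (e * (euler (z ^ 2 * q) * euler (q ^ 5))) * (e * (euler (z ^ 3 * q) * euler (q ^ 5)))
  * (e * (euler (z ^ 4 * q) * euler (q ^ 5))) * euler (q ^ 25)); [|ring].
rewrite <- H0, <- H1, <- H2, <- H3, <- H4; f_equal.
assert (Z4 : z ^ 4 = - Cone - z - z ^ 2 - z ^ 3).
{ replace (z ^ 4) with ((Cone + z + z ^ 2 + z ^ 3 + z ^ 4) + (- Cone - z - z ^ 2 - z ^ 3)) by ring.
  rewrite HZ; ring. }
clearbody a b z; clear -Z4.
simpl (z ^ 0); ring [Z4].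
Qed.

(** * The Wronskian *)

(** The general term of Jacobi's series for eta_5^3, up to a power of q and without its weight 2 i +
    1. *)
Definition odd_term (s : Cx) (i : Z) : Cx :=
  Cexp (RtoC (5 * IZR (2 * i + 1) ^ 2 / 8) * s + RtoC (IZR i) * iPI).

Lemma odd_term_jtp (s : Cx) (i : Z) :
  odd_term s i = Cexp (RtoC (5 / 8) * s)
    * Cexp (jtp_exponent (RtoC 5 * s) (RtoC 5 * s + iPI) i).
Proof.
unfold odd_term, jtp_exponent; rewrite <- Cexp_add; f_equal.
rewrite plus_IZR, !mult_IZR, minus_IZR; apply Cx_eq; simpl; field.
Qed.

Lemma Summable_scal {I} (c : Cx) (f : I -> Cx) : Summable f -> Summable (fun i => c * f i).
Proof.
intros [M HM]; exists (Cnorm c * M)%R; intros G NG.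
eapply Rle_trans; [apply rsum_le; intros i; rewrite Cnorm_mul; apply Rle_refl|].
rewrite rsum_scal; apply Rmult_le_compat_l; [apply Cnorm_pos|auto].
Qed.

(** The constant 9 leaves room for the heaviest weight in use, (2 i + 1)^2. *)
Lemma Summable_odd (s : Cx) (w : Z -> Cx) : (Re s < 0)%R ->
  (forall i, Cnorm (w i) <= 9 * (1 + IZR i * IZR i))%R ->
  Summable (fun i => w i * odd_term s i).
Proof.
intros Hs Hw.
apply Summable_ext with (fun i => Cexp (RtoC (5 / 8) * s)
    * (w i * Cexp (jtp_exponent (RtoC 5 * s) (RtoC 5 * s + iPI) i))).
- intros i; rewrite odd_term_jtp; ring.
- apply Summable_scal, (Summable_jtp _ _ w 9); [simpl; lra|lra|assumption].
Qed.

(** Twice [jacobi_cube] minus the vanishing series [jtp_iPI] has weight 2 n - 1; putting n = i + 1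
    makes the exponent symmetric under i -> -1 - i. Each term and its mirror image agree, hence the
    factor 2. *)
Lemma HasSum_odd (s : Cx) : (Re s < 0)%R ->
  HasSum (fun i => RtoC (IZR (2 * i + 1)) * odd_term s i)
    (2 * Cexp (RtoC (5 / 8) * s) * euler (Cexp s ^ 5) ^ 3).
Proof.
intros Hs; set (s5 := RtoC 5 * s).
assert (Hs5 : (Re s5 < 0)%R) by (unfold s5; simpl; lra).
assert (E5 : Cexp s5 = Cexp s ^ 5).
{ rewrite <- Cexp_INR_mul; unfold s5; f_equal; apply Cx_eq; simpl; ring. }
pose proof (jacobi_cube s5 Hs5) as H1; pose proof (jtp_iPI s5 Hs5) as H0.
rewrite E5 in H1.
apply (HasSum_scal 2) in H1; pose proof (HasSum_sub _ _ _ _ H1 H0) as H; clear H1 H0.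
apply (HasSum_scal (- Cexp (RtoC (5 / 8) * s))), (fun H => HasSum_shift _ 1 _ H) in H.
replace (2 * Cexp (RtoC (5 / 8) * s) * euler (Cexp s ^ 5) ^ 3)
  with (- Cexp (RtoC (5 / 8) * s) * (2 * - euler (Cexp s ^ 5) ^ 3 - Czero)) by ring.
eapply HasSum_ext; [|exact H]; intros i; cbv beta.
assert (E : odd_term s i = - Cexp (RtoC (5 / 8) * s) * Cexp (jtp_exponent s5 iPI (i + 1))).
{ transitivity (- Cone * (Cexp (RtoC (5 / 8) * s) * Cexp (jtp_exponent s5 iPI (i + 1)))); [|ring].
  rewrite <- Cexp_opp_iPI, <- !Cexp_add; unfold odd_term; f_equal; unfold jtp_exponent, s5.
  rewrite !mult_IZR, minus_IZR, !plus_IZR, !mult_IZR; apply Cx_eq; simpl; field. }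
rewrite E; replace (RtoC (IZR (2 * i + 1))) with (2 * RtoC (IZR (i + 1)) - Cone); [ring|].
rewrite !plus_IZR, mult_IZR; apply Cx_eq; simpl; ring.
Qed.

(* [(k, l) = (2 i + 1, 2 j + 1)] is sent to [(u, v) = (2 k - l, k + 2 l)], so that [u^2 + v^2 = 5 (k^2 + l^2)] and [v^2 - u^2 = 8 k l + 3 (l^2 - k^2)]. *)
Lemma odd_term_rotate (s : Cx) (u v m n i j t : Z) (b : bool) :
  (2 * (2 * i + 1) - (2 * j + 1) = 10 * m + u)%Z ->
  ((2 * i + 1) + 2 * (2 * j + 1) = 10 * n + v)%Z ->
  (i + j = m + n + 2 * t + (if b then 1 else 0))%Z ->
  3 * (odd_term s i * (RtoC (IZR (2 * j + 1) ^ 2) * odd_term s j))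
  - 3 * ((RtoC (IZR (2 * i + 1) ^ 2) * odd_term s i) * odd_term s j)
  + 8 * ((RtoC (IZR (2 * i + 1)) * odd_term s i) * (RtoC (IZR (2 * j + 1)) * odd_term s j))
  = (if b then - Cone else Cone) *
    (quintic_term u s m * (RtoC (IZR (10 * n + v) ^ 2) * quintic_term v s n)
     - (RtoC (IZR (10 * m + u) ^ 2) * quintic_term u s m) * quintic_term v s n).
Proof.
intros Hu Hv Ht; rewrite <- Hu, <- Hv.
assert (E : odd_term s i * odd_term s j
  = (if b then - Cone else Cone) * (quintic_term u s m * quintic_term v s n)).
{ assert (Es : Cexp (RtoC (IZR (2 * t + (if b then 1 else 0))) * iPI) = if b then - Cone else Cone).
  { destruct b; [apply Cexp_odd_iPI|rewrite Z.add_0_r; apply Cexp_even_iPI]. }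
  rewrite <- Es; unfold odd_term, quintic_term; rewrite <- !Cexp_add; f_equal.
  rewrite <- Hu, <- Hv.
  replace (2 * t + (if b then 1 else 0))%Z with (i + j - m - n)%Z by lia.
  rewrite !minus_IZR, !plus_IZR, !mult_IZR, !plus_IZR, !mult_IZR.
  apply Cx_eq; simpl; field. }
set (x := odd_term s i) in *; set (y := odd_term s j) in *.
set (X := quintic_term u s m) in *; set (Y := quintic_term v s n) in *.
transitivity (RtoC (IZR (2 * i + 1 + 2 * (2 * j + 1)) ^ 2 - IZR (2 * (2 * i + 1) - (2 * j + 1)) ^ 2)
   * (x * y)).
- rewrite !minus_IZR, !plus_IZR, !mult_IZR, !plus_IZR, !mult_IZR; cx.
- rewrite E; destruct b; cx.
Qed.

Lemma HasSum_quintic_wronskian (u v : Z) (s : Cx) : (Re s < 0)%R ->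
  HasSum (fun p : Z * Z =>
     quintic_term u s (fst p) * (RtoC (IZR (10 * snd p + v) ^ 2) * quintic_term v s (snd p))
     - (RtoC (IZR (10 * fst p + u) ^ 2) * quintic_term u s (fst p)) * quintic_term v s (snd p))
    (quintic u s * quintic_d v s - quintic_d u s * quintic v s).
Proof.
intros Hs; apply HasSum_sub.
- apply (HasSum_prod (quintic_term u s) (fun n => RtoC (IZR (10 * n + v) ^ 2) * quintic_term v s n));
    auto using Summable_quintic_0, Summable_quintic_d, HasSum_quintic, HasSum_quintic_d.
- apply (HasSum_prod (fun n => RtoC (IZR (10 * n + u) ^ 2) * quintic_term u s n) (quintic_term v s));
    auto using Summable_quintic_0, Summable_quintic_d, HasSum_quintic, HasSum_quintic_d.
Qed.

(** The image of the odd pairs (k, l) consists of the odd pairs (u, v) with v = 3 u modulo 10, that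
    is, of the classes (1,3), (3,9), (5,5), (7,1), (9,7). By reflection four of them give the same
    Wronskian and the one of (5,5) is 0. On the other side the weights 3 (l^2 - k^2) cancel by
    symmetry, leaving 8 times the square of Jacobi's series. *)
Lemma quintic_wronskian (s : Cx) : (Re s < 0)%R ->
  quintic 1 s * quintic_d 3 s - quintic_d 1 s * quintic 3 s
  = 8 * (Cexp (RtoC (5 / 4) * s) * euler (Cexp s ^ 5) ^ 6).
Proof.
intros Hs.
assert (S0 : Summable (odd_term s)).
{ apply Summable_ext with (fun i => Cone * odd_term s i); [intros; ring|].
  apply Summable_odd; [assumption|]; intros i; rewrite Cnorm_Cone; nra. }
assert (S1 : Summable (fun i => RtoC (IZR (2 * i + 1)) * odd_term s i)).
{ apply Summable_odd; [assumption|]; intros i; rewrite Cnorm_RtoC, plus_IZR, mult_IZR.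
  apply Rabs_le; nra. }
assert (S2 : Summable (fun i => RtoC (IZR (2 * i + 1) ^ 2) * odd_term s i)).
{ apply Summable_odd; [assumption|]; intros i; rewrite Cnorm_RtoC, plus_IZR, mult_IZR.
  apply Rabs_le; nra. }
destruct (Summable_HasSum _ S0) as [g0 H0]; pose proof (HasSum_odd s Hs) as H1.
destruct (Summable_HasSum _ S2) as [g2 H2].
set (g1 := 2 * Cexp (RtoC (5 / 8) * s) * euler (Cexp s ^ 5) ^ 3) in *.
pose proof (HasSum_add _ _ _ _ (HasSum_sub _ _ _ _
  (HasSum_scal 3 _ _ (HasSum_prod _ _ _ _ S0 S2 H0 H2))
  (HasSum_scal 3 _ _ (HasSum_prod _ _ _ _ S2 S0 H2 H0)))
  (HasSum_scal 8 _ _ (HasSum_prod _ _ _ _ S1 S1 H1 H1))) as HL.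
match type of HL with HasSum ?f _ => set (F := f) in * end.
(* The solutions (i, j) of 2 (2 i + 1) - (2 j + 1) = 10 m + u and (2 i + 1) + 2 (2 j + 1) = 10 n +
   v, for u = 1, 3, 5, 7, 9 in this order. Conversely 2 i - j = 5 m + (u - 1)/2 and i + 2 j + 1 = 5
   n + (v - 1)/2 determine the class and the quotients. *)
set (of := fun p : class5 * (Z * Z) => let m := fst (snd p) in let n := snd (snd p) in
  match fst p with
  | cl0 => (2 * m + n, 2 * n - m) | cl1 => (2 * m + n + 1, 2 * n - m + 1)
  | cl2 => (2 * m + n + 1, 2 * n - m) | cl3 => (2 * m + n + 1, 2 * n - m - 1)
  | cl4 => (2 * m + n + 2, 2 * n - m) end%Z).
set (to := fun p : Z * Z => let i := fst p in let j := snd p in let r := ((2 * i - j) mod 5)%Z in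
  ((if (r =? 0)%Z then cl0 else if (r =? 1)%Z then cl1
   else if (r =? 2)%Z then cl2 else if (r =? 3)%Z then cl3 else cl4),
   ((2 * i - j) / 5, (i + 2 * j + 1) / 5)%Z)).
assert (Hot : forall p, of (to p) = p).
{ intros [i j]; unfold to, of; cbn [fst snd]; cbv zeta.
  repeat match goal with |- context [(?a =? ?b)%Z] => destruct (Z.eqb_spec a b) end;
    cbv iota; f_equal; Z.to_euclidean_division_equations; lia. }
assert (Hto : forall p, to (of p) = p).
{ assert (HD : forall a b c r, (a = 5 * b + r -> 0 <= r < 5 -> c = b -> a / 5 = c)%Z).
  { intros; subst c; symmetry; apply Z.div_unique with r; lia. }
  assert (HM : forall a b r, (a = 5 * b + r -> 0 <= r < 5 -> a mod 5 = r)%Z).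
  { intros; symmetry; apply Z.mod_unique with b; lia. }
  intros [x [m n]]; unfold to, of; destruct x; cbn [fst snd]; cbv zeta; cbn [fst snd].
  - rewrite (HM _ m 0%Z) by lia; cbn [Z.eqb Pos.eqb]; rewrite (HD _ m m 0%Z), (HD _ n n 1%Z) by lia; reflexivity.
  - rewrite (HM _ m 1%Z) by lia; cbn [Z.eqb Pos.eqb]; rewrite (HD _ m m 1%Z), (HD _ n n 4%Z) by lia; reflexivity.
  - rewrite (HM _ m 2%Z) by lia; cbn [Z.eqb Pos.eqb]; rewrite (HD _ m m 2%Z), (HD _ n n 2%Z) by lia; reflexivity.
  - rewrite (HM _ m 3%Z) by lia; cbn [Z.eqb Pos.eqb]; rewrite (HD _ m m 3%Z), (HD _ n n 0%Z) by lia; reflexivity.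
  - rewrite (HM _ m 4%Z) by lia; cbn [Z.eqb Pos.eqb]; rewrite (HD _ m m 4%Z), (HD _ n n 3%Z) by lia; reflexivity. }
apply (HasSum_reindex of to) in HL; [|assumption|assumption].
set (wr := fun u v => quintic u s * quintic_d v s - quintic_d u s * quintic v s).
assert (HR : HasSum (fun p => F (of p)) (Cone * wr 1%Z 3%Z + (Cone * wr 3%Z 9%Z
  + (- Cone * wr 5%Z 5%Z + (Cone * wr 7%Z 1%Z + Cone * wr 9%Z 7%Z))))).
{ apply HasSum_class5;
    (eapply HasSum_ext; [|apply HasSum_scal, HasSum_quintic_wronskian, Hs]);
    intros [m n]; symmetry; unfold F, of; cbn [fst snd]; cbv beta zeta; cbn [fst snd].
  - apply (odd_term_rotate s 1 3 m n _ _ n false); lia.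
  - apply (odd_term_rotate s 3 9 m n _ _ (n + 1) false); lia.
  - apply (odd_term_rotate s 5 5 m n _ _ n true); lia.
  - apply (odd_term_rotate s 7 1 m n _ _ n false); lia.
  - apply (odd_term_rotate s 9 7 m n _ _ (n + 1) false); lia. }
pose proof (HasSum_unique _ _ _ HL HR) as E; unfold wr in E.
pose proof (quintic_reflect 1 s Hs) as R1; pose proof (quintic_reflect 3 s Hs) as R3.
pose proof (quintic_d_reflect 1 s Hs) as D1; pose proof (quintic_d_reflect 3 s Hs) as D3.
simpl (10 - _)%Z in *; rewrite R1, R3, D1, D3 in E.
replace (Cexp (RtoC (5 / 4) * s)) with (Cexp (RtoC (5 / 8) * s) * Cexp (RtoC (5 / 8) * s))
  by (rewrite <- Cexp_add; f_equal; apply Cx_eq; simpl; field).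
apply (Cmul_reg_l (RtoC 4)); [intros E0; injection E0; lra|].
transitivity (8 * (g1 * g1)); [|unfold g1; ring].
transitivity (3 * (g0 * g2) - 3 * (g2 * g0) + 8 * (g1 * g1)); [rewrite E; ring|ring].
Qed.

(** * Differentiation in [tau] *)

Lemma abs_exp_sub1_le (x : R) : (Rabs (exp x - 1) <= Rabs x * exp (Rabs x))%R.
Proof.
assert (H : forall y, (0 <= y -> exp y - 1 <= y * exp y)%R).
{ intros y Hy; assert (1 - y <= exp (- y))%R.
  { destruct (Req_dec y 0) as [->|Hn]; [rewrite Ropp_0, exp_0; lra|].
    pose proof (exp_ineq1 (- y)); lra. }
  rewrite exp_Ropp in H; pose proof (exp_pos y) as Hp.
  apply (Rmult_le_compat_r (exp y)) in H; [|lra]; rewrite Rinv_l in H; lra. }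
destruct (Rle_or_lt 0 x) as [Hx|Hx].
- rewrite (Rabs_pos_eq x), Rabs_pos_eq by (try assumption; pose proof (exp_ge_1_plus x Hx); lra).
  apply H, Hx.
- rewrite (Rabs_left x), Rabs_left by (try assumption; rewrite <- exp_0; pose proof (exp_increasing x 0 Hx); lra).
  pose proof (exp_ineq1 x); pose proof (exp_ge_1_plus (- x)); nra.
Qed.

Lemma abs_exp_sub1_sub_le (x : R) : (Rabs (exp x - 1 - x) <= x ^ 2 * exp (Rabs x))%R.
Proof.
assert (H1 : (0 <= exp x - 1 - x)%R).
{ destruct (Req_dec x 0) as [->|Hn]; [rewrite exp_0; lra|pose proof (exp_ineq1 x); lra]. }
rewrite Rabs_pos_eq by assumption.
destruct (Rle_or_lt 0 x) as [Hx|Hx].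
- pose proof (abs_exp_sub1_le x) as H; rewrite (Rabs_pos_eq x) in * by assumption.
  pose proof (Rle_abs (exp x - 1)).
  assert (exp x - 1 <= x * exp x)%R by lra.
  assert (x * (exp x - 1) <= x * (x * exp x))%R by (apply Rmult_le_compat_l; lra); nra.
- assert (H : (exp x <= / (1 - x))%R).
  { rewrite <- (Ropp_involutive x) at 1; rewrite exp_Ropp; apply Rinv_le_contravar; [lra|].
    pose proof (exp_ge_1_plus (- x)); lra. }
  assert (/ (1 - x) - 1 - x <= x ^ 2)%R.
  { replace (/ (1 - x) - 1 - x)%R with (x ^ 2 * / (1 - x))%R by (field; lra).
    rewrite <- (Rmult_1_r (x ^ 2)) at 2; apply Rmult_le_compat_l; [nra|].
    rewrite <- Rinv_1; apply Rinv_le_contravar; lra. }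
  pose proof (exp_ge_1_plus (Rabs x) (Rabs_pos x)); pose proof (Rabs_pos x); nra.
Qed.

Lemma abs_sin_le (y : R) : (Rabs (sin y) <= Rabs y)%R.
Proof.
assert (H : forall y, (0 <= y -> Rabs (sin y) <= y)%R).
{ intros x [Hx| <-]; [|rewrite sin_0, Rabs_R0; lra].
  destruct (Rle_or_lt x PI) as [Hp|Hp].
  - rewrite Rabs_pos_eq by (apply sin_ge_0; lra); left; apply sin_lt_x, Hx.
  - pose proof (SIN_bound x); pose proof PI2_1; apply Rabs_le; lra. }
destruct (Rle_or_lt 0 y) as [Hy|Hy]; [rewrite (Rabs_pos_eq y) by assumption; auto|].
rewrite (Rabs_left y) by assumption; rewrite <- Rabs_Ropp, <- sin_neg; apply H; lra.
Qed.

Lemma abs_cos_sub1_le (y : R) : (Rabs (cos y - 1) <= y ^ 2)%R.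
Proof.
replace (cos y) with (1 - 2 * sin (y / 2) * sin (y / 2))%R
  by (rewrite <- cos_2a_sin; f_equal; field).
pose proof (abs_sin_le (y / 2)) as H.
assert (sin (y / 2) ^ 2 <= (y / 2) ^ 2)%R.
{ rewrite <- (pow2_abs (sin _)), <- (pow2_abs (y / 2)); apply pow_incr; split;
    [apply Rabs_pos|assumption]. }
pose proof (pow2_ge_0 (sin (y / 2))); apply Rabs_le; nra.
Qed.

Lemma abs_sin_sub_le (y : R) : (Rabs (sin y - y) <= y ^ 2)%R.
Proof.
assert (H : forall y, (0 <= y -> Rabs (sin y - y) <= y ^ 2)%R).
{ intros x Hx; pose proof (abs_sin_le x) as H; rewrite (Rabs_pos_eq x) in H by assumption.
  pose proof (Rle_abs (sin x)).
  rewrite Rabs_left1 by lra.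
  destruct (Rle_or_lt x PI) as [Hp|Hp].
  - destruct (sin_bound x 0 Hx Hp) as [Hl _].
    unfold sin_approx in Hl; simpl in Hl; unfold sin_term in Hl; simpl in Hl.
    assert (x - x ^ 3 / 6 <= sin x)%R by (eapply Rle_trans; [|exact Hl]; right; field).
    pose proof PI_4; nra.
  - pose proof (SIN_bound x); pose proof PI2_1; nra. }
destruct (Rle_or_lt 0 y) as [Hy|Hy]; [auto|].
replace (sin y - y)%R with (- (sin (- y) - - y))%R by (rewrite sin_neg; ring).
rewrite Rabs_Ropp; replace (y ^ 2)%R with ((- y) ^ 2)%R by ring; apply H; lra.
Qed.

(** This global bound of first order supplies the majorant for termwise differentiation; the
    second-order bound after it gives the derivative of [Cexp] at 0. The constants are crude. *)
Lemma Cexp_sub1_le (u : Cx) : (Cnorm (Cexp u - Cone) <= 4 * Cnorm u * exp (Cnorm u))%R.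
Proof.
eapply Rle_trans; [apply Cnorm_le_Re_Im|]; simpl.
pose proof (Cnorm_Re u) as Hx; pose proof (Cnorm_Im u) as Hy.
set (x := Re u) in *; set (y := Im u) in *; set (r := Cnorm u) in *.
pose proof (abs_exp_sub1_le x) as H1; pose proof (abs_sin_le y) as H2.
assert (H3 : (Rabs (cos y - 1) <= 2 * Rabs y)%R).
{ pose proof (abs_cos_sub1_le y) as H; rewrite <- pow2_abs in H.
  pose proof (COS_bound y); pose proof (Rabs_pos y).
  destruct (Rle_or_lt (Rabs y) 1); [nra|]; apply Rabs_le; lra. }
assert (HC : (Rabs (cos y) <= 1)%R) by (apply Rabs_le, COS_bound).
pose proof (Rabs_pos x); pose proof (Rabs_pos y); pose proof (exp_pos x).
assert (HE : (exp (Rabs x) <= exp r)%R) by (apply exp_le_compat; assumption).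
assert (HE' : (exp x <= exp r)%R).
{ apply exp_le_compat; pose proof (Rle_abs x); lra. }
assert (HE1 : (1 <= exp r)%R).
{ rewrite <- exp_0; apply exp_le_compat; unfold r; apply Cnorm_pos. }
set (X := Rabs x) in *; set (Y := Rabs y) in *; set (e := exp r) in *.
assert (B1 : (Rabs (exp x * cos y - 1) <= X * e + 2 * Y)%R).
{ replace (exp x * cos y - 1)%R with ((exp x - 1) * cos y + (cos y - 1))%R by ring.
  eapply Rle_trans; [apply Rabs_triang|]; rewrite Rabs_mult.
  apply Rplus_le_compat; [|assumption].
  apply Rle_trans with (X * e * 1)%R; [|lra].
  apply Rmult_le_compat; try apply Rabs_pos; [|assumption].
  eapply Rle_trans; [exact H1|]; apply Rmult_le_compat_l; assumption. }
assert (B2 : (Rabs (exp x * sin y - 0) <= e * Y)%R).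
{ rewrite Rminus_0_r, Rabs_mult, (Rabs_pos_eq (exp x)) by lra.
  apply Rmult_le_compat; try apply Rabs_pos; try assumption; lra. }
assert (B3 : (X * e + 2 * Y + e * Y <= 4 * r * e)%R).
{ assert (X * e <= r * e)%R by (apply Rmult_le_compat_r; lra).
  assert (Y * e <= r * e)%R by (apply Rmult_le_compat_r; lra).
  assert (2 * Y <= 2 * (Y * e))%R by nra; lra. }
unfold Rminus in *; lra.
Qed.

Lemma Cexp_sub1_sub_le (u : Cx) :
  (Cnorm (Cexp u - Cone - u)%Cx <= 5 * Cnorm u ^ 2 * exp (Cnorm u))%R.
Proof.
eapply Rle_trans; [apply Cnorm_le_Re_Im|]; simpl Re; simpl Im.
pose proof (Cnorm_Re u) as Hx; pose proof (Cnorm_Im u) as Hy.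
set (x := Re u) in *; set (y := Im u) in *; set (r := Cnorm u) in *.
pose proof (abs_exp_sub1_le x) as H1; pose proof (abs_exp_sub1_sub_le x) as H1'.
pose proof (abs_sin_le y) as H2; pose proof (abs_sin_sub_le y) as H2'.
pose proof (abs_cos_sub1_le y) as H3.
rewrite <- (pow2_abs x) in H1'; rewrite <- (pow2_abs y) in H2', H3.
pose proof (Rabs_pos x); pose proof (Rabs_pos y); pose proof (exp_pos x).
assert (HE : (exp (Rabs x) <= exp r)%R) by (apply exp_le_compat; assumption).
assert (HE' : (exp x <= exp r)%R).
{ apply exp_le_compat; pose proof (Rle_abs x); lra. }
assert (HE1 : (1 <= exp r)%R).
{ rewrite <- exp_0; apply exp_le_compat; unfold r; apply Cnorm_pos. }
set (X := Rabs x) in *; set (Y := Rabs y) in *; set (e := exp r) in *.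
assert (B1 : (Rabs (exp x * cos y - 1 - x) <= X ^ 2 * e + e * Y ^ 2)%R).
{ replace (exp x * cos y - 1 - x)%R with ((exp x - 1 - x) + exp x * (cos y - 1))%R by ring.
  eapply Rle_trans; [apply Rabs_triang|]; rewrite Rabs_mult, (Rabs_pos_eq (exp x)) by lra.
  apply Rplus_le_compat.
  - eapply Rle_trans; [exact H1'|]; apply Rmult_le_compat_l; [nra|assumption].
  - apply Rmult_le_compat; try apply Rabs_pos; try assumption; lra. }
assert (B2 : (Rabs (exp x * sin y - 0 - y) <= X * e * Y + Y ^ 2)%R).
{ replace (exp x * sin y - 0 - y)%R with ((exp x - 1) * sin y + (sin y - y))%R by ring.
  eapply Rle_trans; [apply Rabs_triang|]; rewrite Rabs_mult.
  apply Rplus_le_compat; [|assumption].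
  apply Rmult_le_compat; try apply Rabs_pos; [|assumption].
  eapply Rle_trans; [exact H1|]; apply Rmult_le_compat_l; assumption. }
assert (B3 : (X ^ 2 * e + e * Y ^ 2 + (X * e * Y + Y ^ 2) <= 5 * r ^ 2 * e)%R).
{ assert (X2 : (X ^ 2 <= r ^ 2)%R) by (apply pow_incr; lra).
  assert (Y2 : (Y ^ 2 <= r ^ 2)%R) by (apply pow_incr; lra).
  assert (XY : (X * Y <= r ^ 2)%R) by nra.
  pose proof (pow2_ge_0 r).
  assert (X ^ 2 * e <= r ^ 2 * e)%R by (apply Rmult_le_compat_r; lra).
  assert (Y ^ 2 * e <= r ^ 2 * e)%R by (apply Rmult_le_compat_r; lra).
  assert (X * Y * e <= r ^ 2 * e)%R by (apply Rmult_le_compat_r; lra).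
  nra. }
simpl; simpl in B3; unfold Rminus in *; rewrite ?Ropp_0 in *; simpl in *; lra.
Qed.

Lemma Ccv_Cexp_quotient (h : nat -> Cx) : (forall n, h n <> Czero) -> Ccv h Czero ->
  Ccv (fun n => (Cexp (h n) - Cone) / h n) Cone.
Proof.
intros Hn Hh e He.
destruct (Hh (Rmin 1 (e / (5 * exp 1)))) as [N HN].
{ apply Rmin_pos; [lra|apply Rdiv_lt_0_compat; [assumption|]]; pose proof (exp_pos 1); lra. }
exists N; intros n Hnn; specialize (HN n Hnn); specialize (Hn n).
replace (h n - Czero) with (h n) in HN by ring.
pose proof (Rmin_l 1 (e / (5 * exp 1))); pose proof (Rmin_r 1 (e / (5 * exp 1))).
pose proof (Cnorm_gt0 _ Hn) as Hp.
replace ((Cexp (h n) - Cone) / h n - Cone) with ((Cexp (h n) - Cone - h n) / h n)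
  by (field; assumption).
unfold Cdiv; rewrite Cnorm_mul, Cnorm_inv by assumption.
apply (Rmult_lt_reg_r (Cnorm (h n))); [assumption|].
rewrite Rmult_assoc, Rinv_l, Rmult_1_r by lra.
eapply Rle_lt_trans; [apply Cexp_sub1_sub_le|].
assert (HE : (exp (Cnorm (h n)) <= exp 1)%R) by (apply exp_le_compat; lra).
set (r := Cnorm (h n)) in *; pose proof (exp_pos 1).
assert (r * (5 * exp 1) < e)%R.
{ apply (Rmult_lt_reg_r (/ (5 * exp 1))); [apply Rinv_0_lt_compat; lra|].
  replace (r * (5 * exp 1) * / (5 * exp 1))%R with r by (field; lra); unfold Rdiv in *; lra. }
apply Rle_lt_trans with (5 * r ^ 2 * exp 1)%R; [apply Rmult_le_compat_l; [nra|assumption]|].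
replace (5 * r ^ 2 * exp 1)%R with (r * (5 * exp 1) * r)%R by ring.
apply Rmult_lt_compat_r; assumption.
Qed.

(** Termwise differentiation by dominated convergence of the difference quotients. *)
Lemma quintic_derivative (c : Z) (s : Cx) (h : nat -> Cx) : (Re s < 0)%R ->
  (forall n, h n <> Czero) -> Ccv h Czero ->
  Ccv (fun n => (quintic c (s + h n) - quintic c s) / h n) (RtoC (/ 8) * quintic_d c s).
Proof.
intros Hs Hn Hh.
destruct (Hh (- Re s / 2)%R) as [N HN]; [lra|].
set (la := fun m : Z => (IZR (10 * m + c) ^ 2 / 8)%R).
assert (Hla : forall m, (0 <= la m)%R).
{ intros m; unfold la; pose proof (pow2_ge_0 (IZR (10 * m + c))); lra. }
assert (Hterm : forall m u, quintic_term c (s + u) m = quintic_term c s m * Cexp (RtoC (la m) * u)).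
{ intros m u; unfold quintic_term; rewrite <- Cexp_add; f_equal; unfold la; ring. }
(* Once |h| < -Re s / 2, the factor e^(la (Re s + |h|)) is at most e^(la Re s / 2), so the
   derivative series at s/2 provides the majorant. *)
set (s2 := s / 2).
assert (Hs2 : (Re s2 = Re s / 2)%R) by (unfold s2; simpl; field).
destruct (Summable_quintic_d c s2) as [M HM]; [lra|].
apply (HasSum_dominated
  (fun n m => (quintic_term c (s + h n) m - quintic_term c s m) / h n)
  (fun m => RtoC (/ 8) * (RtoC (IZR (10 * m + c) ^ 2) * quintic_term c s m))
  (fun m => 4 / 8 * Cnorm (RtoC (IZR (10 * m + c) ^ 2) * quintic_term c s2 m)%Cx)%R
  (4 / 8 * M) N).
- intros n m Hnn; specialize (HN n Hnn); specialize (Hn n).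
  replace (h n - Czero) with (h n) in HN by ring.
  pose proof (Cnorm_gt0 _ Hn) as Hp.
  rewrite Hterm.
  replace ((quintic_term c s m * Cexp (RtoC (la m) * h n) - quintic_term c s m) / h n)
    with (quintic_term c s m * (Cexp (RtoC (la m) * h n) - Cone) * Cinv (h n))
    by (field; assumption).
  rewrite !Cnorm_mul, Cnorm_inv, !Cnorm_quintic_term, Cnorm_RtoC by assumption.
  rewrite Rabs_pos_eq by apply pow2_ge_0.
  pose proof (Cexp_sub1_le (RtoC (la m) * h n)) as HE.
  rewrite Cnorm_mul, Cnorm_RtoC, (Rabs_pos_eq (la m)) in HE by apply Hla.
  fold (la m).
  apply Rle_trans with (exp (la m * Re s) * (4 * (la m * Cnorm (h n)) * exp (la m * Cnorm (h n)))
     * / Cnorm (h n))%R.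
  { apply Rmult_le_compat_r; [left; apply Rinv_0_lt_compat; assumption|].
    apply Rmult_le_compat_l; [left; apply exp_pos|exact HE]. }
  replace (exp (la m * Re s) * (4 * (la m * Cnorm (h n)) * exp (la m * Cnorm (h n))) * / Cnorm (h n))%R
    with (4 * la m * (exp (la m * Re s) * exp (la m * Cnorm (h n))))%R by (field; lra).
  replace (4 / 8 * (IZR (10 * m + c) ^ 2 * exp (la m * Re s2)))%R
    with (4 * la m * exp (la m * Re s2))%R by (unfold la; field).
  apply Rmult_le_compat_l; [specialize (Hla m); lra|].
  rewrite <- exp_plus; apply exp_le_compat.
  rewrite Hs2.
  specialize (Hla m); nra.
- intros G NG; rewrite rsum_scal; apply Rmult_le_compat_l; [lra|apply HM, NG].
- intros m.
  destruct (Req_dec (la m) 0) as [E0|E0].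
  + apply Ccv_ext with (fun _ => Czero).
    * intros n; rewrite Hterm, E0; replace (RtoC 0 * h n) with Czero by cx.
      rewrite Cexp_0; field; apply Hn.
    * replace (IZR (10 * m + c) ^ 2)%R with (8 * la m)%R by (unfold la; field).
      rewrite E0; replace (RtoC (/ 8) * (RtoC (8 * 0) * quintic_term c s m)) with Czero by cx.
      apply Ccv_const.
  + set (L := RtoC (la m)).
    assert (HL : L <> Czero) by (intros E; apply E0; injection E; auto).
    replace (RtoC (/ 8) * (RtoC (IZR (10 * m + c) ^ 2) * quintic_term c s m))
      with (quintic_term c s m * L * Cone) by (unfold L, la; apply Cx_eq; simpl; field).
    apply Ccv_ext with (fun n => quintic_term c s m * L * ((Cexp (L * h n) - Cone) / (L * h n))).
    * intros n; rewrite Hterm; fold L; field; split; [apply Hn|assumption].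
    * apply Ccv_scal, (Ccv_Cexp_quotient (fun n => L * h n)).
      -- intros n; apply Cmul_neq0; [assumption|apply Hn].
      -- replace Czero with (L * Czero) by ring; apply Ccv_scal, Hh.
- intros n Hnn; specialize (HN n Hnn).
  replace (h n - Czero) with (h n) in HN by ring.
  assert (Re (s + h n) < 0)%R.
  { pose proof (Cnorm_Re (h n)); pose proof (Rle_abs (Re (h n))); simpl; lra. }
  eapply HasSum_ext; [|apply HasSum_div, HasSum_sub; apply HasSum_quintic; eassumption].
  intros m; cbv beta; apply Cmul_comm.
- apply HasSum_scal, HasSum_quintic_d, Hs.
Qed.

(** * The icosahedral form and the Riccati equation *)

Lemma phi_degree_10 (p a b : Cx) : p ^ 2 = p + Cone ->
  (p * a + b) ^ 10 - 11 * (p * a + b) ^ 5 * (a - p * b) ^ 5 - (a - p * b) ^ 10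
  = 125 * p ^ 5 * (a * b * (a ^ 8 + a ^ 7 * b + 2 * a ^ 6 * b ^ 2 + 3 * a ^ 5 * b ^ 3
     + 5 * a ^ 4 * b ^ 4 - 3 * a ^ 3 * b ^ 5 + 2 * a ^ 2 * b ^ 6 - a * b ^ 7 + b ^ 8)).
Proof. intros H; ring [H]. Qed.

(** Factoring out be leaves the golden ratio p = al / be as the only irrationality. The octic in
    [phi_degree_10] is the quotient of a^10 - 11 a^5 b^5 - b^10 by a^2 - a b - b^2, whence its
    Fibonacci coefficients. *)
Lemma al_be_degree_10 (a b : Cx) :
  let X := RtoC al * a + RtoC be * b in let Y := RtoC be * a - RtoC al * b in
  (X ^ 10 - 11 * X ^ 5 * Y ^ 5 - Y ^ 10) * (a ^ 2 - a * b - b ^ 2)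
  = 125 * (RtoC al * RtoC be) ^ 5 * (a * b * (a ^ 10 - 11 * a ^ 5 * b ^ 5 - b ^ 10)).
Proof.
intros X Y; destruct al_be_relations as [H _].
assert (Hb : RtoC be <> Czero) by (apply RtoC_neq0; pose proof be_gt0; lra).
set (p := RtoC al / RtoC be).
assert (Ea : RtoC al = p * RtoC be) by (unfold p; field; assumption).
assert (Hp : p ^ 2 = p + Cone).
{ unfold p; transitivity ((RtoC al * RtoC al) / (RtoC be * RtoC be)); [field; assumption|].
  rewrite H; field; assumption. }
unfold X, Y; rewrite Ea; clearbody p; set (y := RtoC be) in *.
transitivity (y ^ 10 * ((p * a + b) ^ 10 - 11 * (p * a + b) ^ 5 * (a - p * b) ^ 5 - (a - p * b) ^ 10)
  * (a ^ 2 - a * b - b ^ 2)).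
- transitivity (((y * (p * a + b)) ^ 10 - 11 * (y * (p * a + b)) ^ 5 * (y * (a - p * b)) ^ 5
    - (y * (a - p * b)) ^ 10) * (a ^ 2 - a * b - b ^ 2)).
  + replace (p * y * a + y * b) with (y * (p * a + b)) by ring.
    replace (y * a - p * y * b) with (y * (a - p * b)) by ring; reflexivity.
  + rewrite !Cpow_mul_base; set (A := p * a + b); set (B := a - p * b); ring.
- rewrite (phi_degree_10 p a b Hp); ring.
Qed.

Lemma qpoch_inf_euler (k : nat) (tau : Cx) : (0 < Im tau)%R ->
  qpoch_inf (S k) tau = euler (Cexp (twopii * tau) ^ S k).
Proof.
intros Ht; apply Clim_eq.
apply Ccv_ext with (euler_partial (Cexp (twopii * tau) ^ S k)).
- intros N; apply Cprod_ext; intros n; unfold qnome; rewrite <- Cpow_mul; reflexivity.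
- apply euler_cv, Cnorm_pow_lt1, Cnorm_exp_lt1; simpl; pose proof PI_RGT_0; nra.
Qed.

(** The product formula for the two thetas has a right side without zeros, so neither factor can
    vanish. *)
Lemma theta_3_5_neq0 (tau : Cx) : (0 < Im tau)%R -> theta 1 (3 / 5) Czero tau <> Czero.
Proof.
intros Ht; pose proof (theta_product tau Ht) as E; cbv zeta in E.
assert (Hs : (Re (twopii * tau)%Cx < 0)%R) by (simpl; pose proof PI_RGT_0; nra).
pose proof (Cnorm_exp_lt1 _ Hs) as Hq.
refine (proj2 (Cmul_neq0_inv _ _ _)); rewrite E.
repeat apply Cmul_neq0; [|apply Cexp_neq0|apply euler_neq0, Hq|apply euler_neq0, (Cnorm_pow_lt1 _ 4 Hq)].
apply RtoC_neq0; pose proof al_gt0; pose proof be_gt0; nra.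
Qed.

(** Here W = (X / Y)^5 and X' Y - X Y' = (al^2 + be^2)(a b' - a' b), the primes denoting d/ds. The
    25 is al^2 + be^2 = 5 times the exponent 5. *)
Lemma theta_quotient_derivative (tau : Cx) : (0 < Im tau)%R ->
  let s := twopii * tau in
  let a := quintic 1 s in let b := quintic 3 s in
  let X := RtoC al * a + RtoC be * b in let Y := RtoC be * a - RtoC al * b in
  C_derivable_lim W tau
    (twopii * (25 * (Cexp (RtoC (5 / 4) * s) * euler (Cexp s ^ 5) ^ 6) * (X * Y) ^ 4 / Y ^ 10)).
Proof.
intros Ht s a b X Y.
assert (Hs : forall t, (0 < Im t)%R -> (Re (twopii * t)%Cx < 0)%R).
{ intros t H; simpl; pose proof PI_RGT_0; nra. }
assert (N2 : twopii <> Czero).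
{ intros E; apply (f_equal Im) in E; simpl in E; pose proof PI_RGT_0; lra. }
assert (HY : forall t, (0 < Im t)%R ->
  RtoC be * quintic 1 (twopii * t) - RtoC al * quintic 3 (twopii * t) <> Czero).
{ intros t H; rewrite <- theta_3_5 by assumption; apply theta_3_5_neq0, H. }
assert (HW : forall t, (0 < Im t)%R -> W t =
  (RtoC al * quintic 1 (twopii * t) + RtoC be * quintic 3 (twopii * t)) ^ 5
  / (RtoC be * quintic 1 (twopii * t) - RtoC al * quintic 3 (twopii * t)) ^ 5).
{ intros t H; unfold W; rewrite theta_1_5, theta_3_5 by assumption; reflexivity. }
apply C_derivable_lim_seq; intros h Hn Hh.
set (H := fun n => twopii * h n).
assert (HHn : forall n, H n <> Czero) by (intros n; apply Cmul_neq0; auto).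
assert (HH : Ccv H Czero).
{ replace Czero with (twopii * Czero) by ring; apply Ccv_scal, Hh. }
pose proof (quintic_derivative 1 s H (Hs tau Ht) HHn HH) as DA.
pose proof (quintic_derivative 3 s H (Hs tau Ht) HHn HH) as DB.
fold a in DA; fold b in DB.
set (an := fun n => quintic 1 (s + H n)); set (bn := fun n => quintic 3 (s + H n)).
set (xn := fun n => (an n - a) / H n); set (yn := fun n => (bn n - b) / H n).
change (Ccv xn (RtoC (/ 8) * quintic_d 1 s)) in DA.
change (Ccv yn (RtoC (/ 8) * quintic_d 3 s)) in DB.
set (x := RtoC (/ 8) * quintic_d 1 s) in *; set (y := RtoC (/ 8) * quintic_d 3 s) in *.
assert (HA : Ccv an a).
{ pose proof (Ccv_add _ _ _ _ (Ccv_const a) (Ccv_mul _ _ _ _ HH DA)) as K.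
  replace (a + Czero * x) with a in K by ring.
  eapply Ccv_ext; [|exact K]; intros n; unfold xn; field; apply HHn. }
assert (HB : Ccv bn b).
{ pose proof (Ccv_add _ _ _ _ (Ccv_const b) (Ccv_mul _ _ _ _ HH DB)) as K.
  replace (b + Czero * y) with b in K by ring.
  eapply Ccv_ext; [|exact K]; intros n; unfold yn; field; apply HHn. }
set (Xn := fun n => RtoC al * an n + RtoC be * bn n).
set (Yn := fun n => RtoC be * an n - RtoC al * bn n).
assert (HX : Ccv Xn X) by (apply Ccv_add; apply Ccv_scal; assumption).
assert (HYn : Ccv Yn Y) by (apply Ccv_sub; apply Ccv_scal; assumption).
assert (Y0 : Y <> Czero) by (apply HY, Ht).
destruct (Hh (Im tau) Ht) as [N HN].
assert (HI : forall n, (n >= N)%nat -> (0 < Im (tau + h n))%R).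
{ intros n Hnn; specialize (HN n Hnn); replace (h n - Czero) with (h n) in HN by ring.
  pose proof (Cnorm_Im (h n)); pose proof (Rle_abs (- Im (h n))) as HA'.
  rewrite Rabs_Ropp in HA'; simpl; lra. }
(* The difference quotient of W, with P^5 - Q^5 factored for P = [Xn n * Y] and Q = [X * Yn n]: (P -
   Q) / [H n] tends to X' Y - X Y', and the cofactor to 5 (X Y)^4. The factor [twopii] comes from
   [H n = twopii * h n]. *)
apply Ccv_eventually with (N := N) (u := fun n =>
  twopii * (((RtoC al * xn n + RtoC be * yn n) * Y - X * (RtoC be * xn n - RtoC al * yn n))
   * ((Xn n * Y) ^ 4 + (Xn n * Y) ^ 3 * (X * Yn n) + (Xn n * Y) ^ 2 * (X * Yn n) ^ 2
      + (Xn n * Y) * (X * Yn n) ^ 3 + (X * Yn n) ^ 4) / (Yn n ^ 5 * Y ^ 5))).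
- intros n Hnn; rewrite !HW by auto.
  replace (twopii * (tau + h n)) with (s + H n) by (unfold s, H; ring).
  fold s; fold a b; fold X Y; fold (an n) (bn n); fold (Xn n) (Yn n).
  assert (Yn0 : Yn n <> Czero).
  { pose proof (HY _ (HI n Hnn)) as E.
    replace (twopii * (tau + h n)) with (s + H n) in E by (unfold s, H; ring); exact E. }
  replace ((RtoC al * xn n + RtoC be * yn n) * Y - X * (RtoC be * xn n - RtoC al * yn n))
    with ((Xn n * Y - X * Yn n) / H n).
  + unfold H; generalize dependent (Xn n); generalize dependent (Yn n); intros.
    clearbody X Y; specialize (Hn n); field; auto.
  + unfold xn, yn, Xn, Yn, X, Y; field; apply HHn.
- replace (25 * (Cexp (RtoC (5 / 4) * s) * euler (Cexp s ^ 5) ^ 6) * (X * Y) ^ 4 / Y ^ 10)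
    with (((RtoC al * x + RtoC be * y) * Y - X * (RtoC be * x - RtoC al * y))
   * ((X * Y) ^ 4 + (X * Y) ^ 3 * (X * Y) + (X * Y) ^ 2 * (X * Y) ^ 2
      + (X * Y) * (X * Y) ^ 3 + (X * Y) ^ 4) / (Y ^ 5 * Y ^ 5)).
  + apply Ccv_scal, Ccv_div; [apply Cmul_neq0; apply Cpow_neq0; assumption| |].
    * apply Ccv_mul;
       repeat first [assumption | apply Ccv_const | apply (Ccv_pow 4) | apply (Ccv_pow 3)
         | apply (Ccv_pow 2) | apply Ccv_sub | apply Ccv_add | apply Ccv_mul].
    * apply Ccv_mul; [apply Ccv_pow; assumption|apply Ccv_const].
  + pose proof (quintic_wronskian s (Hs tau Ht)) as EW; fold a b in EW.
    destruct al_be_relations as [_ E5].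
    replace ((RtoC al * x + RtoC be * y) * Y - X * (RtoC be * x - RtoC al * y))
      with (5 * (Cexp (RtoC (5 / 4) * s) * euler (Cexp s ^ 5) ^ 6)).
    * field; assumption.
    * transitivity ((RtoC al * RtoC al + RtoC be * RtoC be)
        * (RtoC (/ 8) * (a * quintic_d 3 s - quintic_d 1 s * b))).
      -- rewrite E5, EW; set (w := _ * _ ^ 6).
         transitivity (RtoC 5 * (RtoC (/ 8) * RtoC 8) * w); [|ring].
         rewrite <- RtoC_mul, Rinv_l by lra; ring.
      -- unfold X, Y, x, y; ring.
Qed.

(** Clearing denominators turns the claim into a proportionality between X^10 - 11 X^5 Y^5 - Y^10
    and an eta quotient. The factor (sqrt 5)^(-3) balances c^4 from (X Y)^4 against 125 c^5, where c
    = al be = sqrt 5. *)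
Lemma riccati_value (tau : Cx) : (0 < Im tau)%R ->
  let s := twopii * tau in
  let a := quintic 1 s in let b := quintic 3 s in
  let X := RtoC al * a + RtoC be * b in let Y := RtoC be * a - RtoC al * b in
  Y <> Czero ->
  25 * (Cexp (RtoC (5 / 4) * s) * euler (Cexp s ^ 5) ^ 6) * (X * Y) ^ 4 / Y ^ 10
  = RtoC (1 / (sqrt 5) ^ 3) * (euler (Cexp s) ^ 5 / euler (Cexp s ^ 5)
      * ((X ^ 5 / Y ^ 5) ^ 2 - 11 * (X ^ 5 / Y ^ 5) - Cone)).
Proof.
intros Ht s a b X Y Y0.
assert (Hs : (Re s < 0)%R) by (unfold s; simpl; pose proof PI_RGT_0; nra).
pose proof (Cnorm_exp_lt1 s Hs) as Hq.
pose proof (al_be_degree_10 a b) as HD; cbv zeta in HD; fold X Y in HD.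
pose proof (al_be_form a b) as HF; fold X Y in HF; rewrite RtoC_mul in HF.
pose proof (quintic_form s Hs) as H3; fold a b in H3.
pose proof (quintic_mul s Hs) as H4; fold a b in H4.
pose proof (quintic_degree_10 s Hs) as H5; cbv zeta in H5; fold a b in H5.
set (e := Cexp (RtoC (/ 4) * s)) in *.
assert (E : Cexp (RtoC (5 / 4) * s) = e ^ 5).
{ unfold e; rewrite <- Cexp_INR_mul; f_equal; apply Cx_eq; simpl; field. }
rewrite E in *.
assert (e0 : e <> Czero) by apply Cexp_neq0.
pose proof (euler_neq0 _ Hq) as n1.
pose proof (euler_neq0 _ (Cnorm_pow_lt1 _ 4 Hq)) as n5.
pose proof (euler_neq0 _ (Cnorm_pow_lt1 _ 24 Hq)) as n25.
set (g1 := euler (Cexp s)) in *; set (g5 := euler (Cexp s ^ 5)) in *.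
set (g25 := euler (Cexp s ^ 25)) in *.
set (c := RtoC al * RtoC be) in *.
assert (Ec : c = RtoC (sqrt 5)) by (unfold c; rewrite <- RtoC_mul, al_be; reflexivity).
assert (Ec2 : c * c = 5).
{ rewrite Ec, <- RtoC_mul, sqrt_sqrt by lra; reflexivity. }
assert (Hr : sqrt 5 <> 0%R) by (pose proof (sqrt_lt_R0 5); lra).
assert (c0 : c <> Czero) by (rewrite Ec; apply RtoC_neq0, Hr).
assert (Ei : RtoC (1 / sqrt 5 ^ 3) = Cinv (c ^ 3)).
{ apply (Cmul_reg_l (c ^ 3)); [apply Cpow_neq0, c0|].
  transitivity Cone; [|field; assumption].
  rewrite Ec; replace (RtoC (sqrt 5) ^ 3) with (RtoC (sqrt 5 ^ 3)) by cx.
  rewrite <- RtoC_mul; apply Cx_eq; simpl; [field; assumption|reflexivity]. }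
(* Multiplying by [e * g5 * g25] makes the quadratic form, a b and the degree 10 form all
   replaceable by products; after cancellation neither a, b nor eta_25 remains on the right. *)
assert (K : (X ^ 10 - 11 * X ^ 5 * Y ^ 5 - Y ^ 10) * g1 = 125 * c ^ 5 * e ^ 9 * g5 ^ 11).
{ apply (Cmul_reg_l (e * g5 * g25)); [repeat apply Cmul_neq0; assumption|].
  rewrite H3 in HD.
  transitivity ((X ^ 10 - 11 * X ^ 5 * Y ^ 5 - Y ^ 10) * (e * (g1 * g5)) * g25); [ring|].
  rewrite HD.
  transitivity (125 * c ^ 5 * (a * b * ((a ^ 10 - 11 * a ^ 5 * b ^ 5 - b ^ 10) * g25))); [ring|].
  rewrite H4, H5; ring. }
rewrite H3 in HF; rewrite Ei, HF.
transitivity (25 * c ^ 7 * e ^ 9 * g1 ^ 4 * g5 ^ 11 / (c ^ 3 * Y ^ 10 * g5)); [field; auto|].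
transitivity (g1 ^ 4 * ((X ^ 10 - 11 * X ^ 5 * Y ^ 5 - Y ^ 10) * g1) / (c ^ 3 * Y ^ 10 * g5)).
- rewrite K; replace (c ^ 7) with (c * c * c ^ 5) by ring; rewrite Ec2; field; auto.
- clearbody X Y; field; auto.
Qed.

Local Close Scope Cx_scope.

(* q dW/dq = (1/(2 pi i)) dW/dtau, so dW/dtau = 2 pi i * (RHS of the Riccati equation) *)
Theorem mainTheorem6 : forall tau : Cx, 0 < Im tau ->
  C_derivable_lim W tau
    (Cmul twopii
      (Cmul (RtoC (1 / (sqrt 5) ^ 3))
        (Cmul (Cdiv (Cpow (qpoch_inf 1 tau) 5) (qpoch_inf 5 tau))
              (Csub (Csub (Cpow (W tau) 2) (Cmul (RtoC 11) (W tau))) Cone)))).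
Proof.
intros tau Ht.
assert (Hs : Re (Cmul twopii tau) < 0) by (simpl; pose proof PI_RGT_0; nra).
pose proof (Cnorm_exp_lt1 _ Hs) as Hq.
pose proof (theta_quotient_derivative tau Ht) as HD.
pose proof (riccati_value tau Ht) as HV; cbv zeta in HD, HV.
rewrite (qpoch_inf_euler 0 tau Ht), (qpoch_inf_euler 4 tau Ht).
replace (Cpow (Cexp (Cmul twopii tau)) 1) with (Cexp (Cmul twopii tau)) by (simpl; ring).
replace (W tau) with (Cdiv
  (Cpow (Cadd (Cmul al (quintic 1 (Cmul twopii tau))) (Cmul be (quintic 3 (Cmul twopii tau)))) 5)
  (Cpow (Csub (Cmul be (quintic 1 (Cmul twopii tau))) (Cmul al (quintic 3 (Cmul twopii tau)))) 5))
  by (unfold W; rewrite theta_1_5, theta_3_5 by assumption; reflexivity).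
rewrite <- HV; [|rewrite <- theta_3_5 by assumption; apply theta_3_5_neq0, Ht].
eapply eq_rect; [exact HD|].
unfold Cdiv; ring.
Qed.
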